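(* Let $G$ be a discrete group, let $A$ be a $C^*$-algebra, let $n\in\mathbb{N}$, and let $\alpha=((A_g)_{g\in G},(\alpha_g)_{g\in G})$ be a partial action of $G$ on $A$ with the $n$-decomposition property. For every $\tau\in\mathcal{T}_n(G)$, the restriction of $\alpha$ to $A_{G\cdot\tau}$ is globalizable and amenable, and its enveloping action is $(\mathrm{Ind}_{H_\tau}^G(A_\tau),\mathrm{Ind}_{H_\tau}^G(\alpha),\iota_\tau)$, where the inclusion $\iota_\tau\colon A_{G\cdot\tau}\to\mathrm{Ind}_{H_\tau}^G(A_\tau)$ is given by $$\iota_\tau(a)(g)=\begin{cases}\alpha_g(\pi^\tau_k(a)) & \text{if } g\in H_\tau x_k^\tau\text{ for some }k=0,\ldots,m_\tau,\\ 0&\text{else,}\end{cases}$$ for all $a\in A_{G\cdot\tau}$ and all $g\in G$. (In particular, $\iota_\tau(a)$ is supported on $\tau$.) It follows that $\alpha$ is globalizable and amenable, and its globalization is $$\bigoplus_{z\in\mathcal{O}_n(G)}\big(\mathrm{Ind}_{H_z}^G(A_{\tau_z}),\mathrm{Ind}_{H_z}^G(\alpha),\iota_{\tau_z}\big).$$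
   Context: Partial actions: a partial action $\alpha=((A_g)_{g\in G},(\alpha_g)_{g\in G})$ of a discrete group $G$ on a $C^*$-algebra $A$ consists of closed two-sided ideals $A_g$ of $A$ and $*$-isomorphisms $\alpha_g\colon A_{g^{-1}}\to A_g$ such that $A_1=A$, $\alpha_1=\mathrm{id}_A$, and $\alpha_{gh}$ extends $\alpha_g\circ\alpha_h$ wherever the composition is defined. It is global if $A_g=A$ for all $g$. Decomposition property: for $n\in\mathbb{N}=\{1,2,\ldots\}$ let $\mathcal{T}_n(G)=\{\tau\subseteq G\colon 1\in\tau,\ |\tau|=n\}$, and set $A_\tau=\bigcap_{g\in\tau}A_g$. $\alpha$ has the $n$-decomposition property if (a) $A=\overline{\sum_{\tau\in\mathcal{T}_n(G)}A_\tau}$, and (b) $A_\tau\cap A_g=\{0\}$ for all $\tau\in\mathcal{T}_n(G)$ and all $g\in G\setminus\tau$. Orbit data: $G$ acts partially on $\mathcal{T}_n(G)$ by $\tau\mapsto g\tau$ for $\tau\ni g^{-1}$; $\mathcal{O}_n(G)$ is the orbit space, and for each $z\in\mathcal{O}_n(G)$ a representative $\tau_z\in\mathcal{T}_n(G)$ of $z$ is fixed. For $\tau\in\mathcal{T}_n(G)$ let $H_\tau=\{h\in G\colon h\tau=\tau\}$ (a finite subgroup whose order divides $n$, acting globally on $A_\tau$ by restricting $\alpha$), $m_\tau=\frac{n}{|H_\tau|}-1$, and fix $x_0^\tau=1,x_1^\tau,\ldots,x_{m_\tau}^\tau\in G$ with $\tau=\bigsqcup_{j=0}^{m_\tau}H_\tau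 x_j^\tau$; write $H_z=H_{\tau_z}$. Let $A_{G\cdot\tau}=\sum_{g\in\tau^{-1}}A_{g\tau}$ with $\tau^{-1}=\{g^{-1}\colon g\in\tau\}$. This is a $G$-invariant ideal (so $\alpha$ restricts to a partial action on it with domains $A_{G\cdot\tau}\cap A_g$) and it is the direct sum of the ideals $A_{(x_j^\tau)^{-1}\tau}$, $0\le j\le m_\tau$; $\pi_j^\tau\colon A_{G\cdot\tau}\to A_{(x_j^\tau)^{-1}\tau}$ denotes the projection. $A$ is equivariantly the ($c_0$-)direct sum of the ideals $A_{G\cdot\tau_z}$, $z\in\mathcal{O}_n(G)$. Enveloping action (globalization): a triple $(B,\beta,\iota)$ with $B$ a $C^*$-algebra, $\beta\colon G\to\mathrm{Aut}(B)$ a global action and $\iota\colon A\to B$ an embedding of $A$ as an ideal (identify $A$ with $\iota(A)$) is an enveloping action of $\alpha$ if (1) $A_g=A\cap\beta_g(A)$ for all $g$; (2) $\alpha_g(a)=\beta_g(a)$ for all $a\in A_{g^{-1}}$ and $g\in G$; (3) $B=\overline{\mathrm{span}}\{\beta_g(a)\colon a\in A,g\in G\}$. $\alpha$ is globalizable if an enveloping action exists (it is then unique up to equivariant isomorphism extending the identity on $A$). Amenability: $\alpha$ is amenable if the canonical surjection $A\rtimes_\alpha G\to A\rtimes_{\alpha,r}G$ from the full to the reduced partial crossed product is injective. Induced systems: for a subgroup $H\le G$ and an action $\gamma\colon H\to\mathrm{Aut}(C)$, $\mathrm{Ind}_H^G(C)$ is the $C^*$-algebra of all $\xi\in C_b(G,C)$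 with $\xi(hg)=\gamma_h(\xi(g))$ for $g\in G,h\in H$, such that $Hg\mapsto\|\xi(g)\|$ vanishes at infinity on the (discrete) set of cosets $\{Hg\colon g\in G\}$; it carries the action $\mathrm{Ind}_H^G(\gamma)_g(\xi)(k)=\xi(kg)$. Here $\mathrm{Ind}_{H_\tau}^G(\alpha)$ is induced from the global action of $H_\tau$ on $A_\tau$ given by restricting $\alpha$. *)

(* Defs.v *)
From HB Require Import structures.
From mathcomp Require Import all_boot all_order all_algebra.
From mathcomp Require Import finmap complex.
From mathcomp Require Import all_classical all_reals all_analysis.

Set Implicit Arguments.
Unset Strict Implicit.
Unset Printing Implicit Defensive.

Import Order.TTheory GRing.Theory Num.Theory.
Import numFieldNormedType.Exports.

Local Open Scope classical_set_scope.
Local Open Scope ring_scope.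

Reserved Notation "a ** b" (at level 40, left associativity).

(* C*-algebras are not assumed to be unital. *)
HB.mixin Record isCStarAlgebra (R : realType) A
    of CompleteNormedModule R[i] A := {
  cmul : A -> A -> A;
  star : A -> A;
  cmulA : associative cmul;
  cmulDl : left_distributive cmul +%R;
  cmulDr : right_distributive cmul +%R;
  cmulZl : forall (c : R[i]) (a b : A), cmul (c *: a) b = c *: cmul a b;
  cmulZr : forall (c : R[i]) (a b : A), cmul a (c *: b) = c *: cmul a b;
  starK : involutive star;
  starD : {morph star : a b / a + b};
  starZ : forall (c : R[i]) (a : A), star (c *: a) = Num.conj c *: star a;
  starM : forall a b : A, star (cmul a b) = cmul (star b) (star a);
  normM_le : forall a b : A, `|cmul a b| <= `|a| * `|b|;
  cstar_identity : forall a : A, `|cmul (star a) a| = `|a| ^+ 2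
}.

#[short(type="cstarAlgType")]
HB.structure Definition CStarAlgebra (R : realType) :=
  {A of isCStarAlgebra R A & CompleteNormedModule R[i] A}.

Notation "a ** b" := (cmul a b) : ring_scope.

(* The norm of the library takes its values in R[i]; this is the same number
   seen in R. *)
Definition rnorm (R : realType) (A : cstarAlgType R) (a : A) : R :=
  complex.Re `|a|.

Section Linf.
Context (R : realType) (I : Type) (A : cstarAlgType R).
Local Open Scope complex_scope.

Definition bounded_family : {pred I -> A} :=
  fun f => `[< exists M : R, forall i, rnorm (f i) <= M >].

Record linf := Linf {
  linf_fun :> I -> A;
  linf_bounded : linf_fun \in bounded_family
}.

HB.instance Definition _ := [isSub for linf_fun].
HB.instance Definition _ := gen_eqMixin linf.
HB.instance Definition _ := gen_choiceMixin linf.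

Lemma rnormE (a : A) : `|a| = (rnorm a)%:C.
Proof.
have := normr_ge0 a; rewrite /rnorm lecE /= => /andP[/eqP h _].
by case: (`|a|) h => x y /= ->.
Qed.

Lemma rnorm_ge0 (a : A) : 0 <= rnorm a.
Proof. by have := normr_ge0 a; rewrite rnormE lecR. Qed.

Lemma rnormD (a b : A) : rnorm (a + b) <= rnorm a + rnorm b.
Proof. by have := ler_normD a b; rewrite !rnormE -rmorphD /= lecR. Qed.

Lemma bounded_familyP (f : I -> A) :
  reflect (exists M, forall i, rnorm (f i) <= M) (f \in bounded_family).
Proof. exact: asboolP. Qed.

Lemma rnormZ (c : R[i]) (a : A) : rnorm (c *: a) = complex.Re `|c| * rnorm a.
Proof.
have := normrZ c a; rewrite (rnormE (c *: a)) (rnormE a) => /(congr1 (@complex.Re R)) /= ->.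
by case: (`|c|) => x y /=; rewrite mulr0 subr0.
Qed.

Lemma bounded_family_submod : submod_closed bounded_family.
Proof.
split.
  apply/bounded_familyP; exists 0 => i.
  by have := rnormZ 0 (0 : A); rewrite scaler0 normr0 /= mul0r => ->.
move=> c f g /bounded_familyP[M fM] /bounded_familyP[N gN].
apply/bounded_familyP; exists (complex.Re `|c| * M + N) => i.
apply: (le_trans (rnormD _ _)); apply: lerD (gN i).
rewrite rnormZ; apply: ler_wpM2l (fM i).
by have := normr_ge0 c; rewrite lecE => /andP[].
Qed.
HB.instance Definition _ :=
  GRing.isSubmodClosed.Build _ _ bounded_family bounded_family_submod.

HB.instance Definition _ := [SubChoice_isSubLmodule of linf by <:].

Lemma linfP (f g : linf) : (forall i, f i = g i) -> f = g.
Proof. by move=> fg; apply/val_inj/funext. Qed.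

Definition linf_norm (f : linf) : R := sup (range (fun i => rnorm (f i))).

Lemma le_linf_norm (f : linf) i : rnorm (f i) <= linf_norm f.
Proof.
have /bounded_familyP[M fM] := linf_bounded f.
by apply: ub_le_sup; [exists M => _ [j _ <-] | exists i].
Qed.

Lemma linf_norm_le (f : linf) (M : R) :
  0 <= M -> (forall i, rnorm (f i) <= M) -> linf_norm f <= M.
Proof.
move=> M0 fM; have [E|ne] := eqVneq (range (fun i => rnorm (f i))) set0.
  by rewrite /linf_norm E sup0.
by apply: ge_sup => [|_ [i _ <-]//]; exact/set0P.
Qed.

Lemma linf_norm_ge0 (f : linf) : 0 <= linf_norm f.
Proof.
have [E|/set0P[_ [i _ _]]] := eqVneq (range (fun i => rnorm (f i))) set0.
  by rewrite /linf_norm E sup0.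
exact: le_trans (rnorm_ge0 (f i)) (le_linf_norm f i).
Qed.

Lemma linfDE (f g : linf) i : (f + g) i = f i + g i. Proof. by []. Qed.
Lemma linfZE (c : R[i]) (f : linf) i : (c *: f) i = c *: f i. Proof. by []. Qed.

Lemma linf_normD (f g : linf) :
  (linf_norm (f + g))%:C <= (linf_norm f)%:C + (linf_norm g)%:C.
Proof.
rewrite -rmorphD lecR; apply: linf_norm_le => [|i].
  by rewrite addr_ge0 ?linf_norm_ge0.
by rewrite (le_trans (rnormD _ _))// lerD ?le_linf_norm.
Qed.

Lemma Re_norm_ge0 (c : R[i]) : 0 <= complex.Re `|c|.
Proof. by have := normr_ge0 c; rewrite lecE => /andP[]. Qed.

Lemma normcRe (c : R[i]) : `|c| = (complex.Re `|c|)%:C.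
Proof.
have := normr_ge0 c; rewrite lecE => /andP[/eqP + _].
by case: (`|c|) => x y /= ->.
Qed.

Lemma linf_normZ_le (c : R[i]) (f : linf) :
  linf_norm (c *: f) <= complex.Re `|c| * linf_norm f.
Proof.
apply: linf_norm_le => [|i]; first by rewrite mulr_ge0 ?Re_norm_ge0 ?linf_norm_ge0.
by rewrite linfZE rnormZ ler_wpM2l ?Re_norm_ge0 ?le_linf_norm.
Qed.

Lemma linf_normZ (c : R[i]) (f : linf) :
  (linf_norm (c *: f))%:C = `|c| * (linf_norm f)%:C.
Proof.
rewrite [in RHS]normcRe -rmorphM; congr (_%:C); apply/le_anti.
rewrite linf_normZ_le andTb; have [->|c0] := eqVneq c 0.
  by rewrite normr0 [complex.Re 0]/= mul0r linf_norm_ge0.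
have := linf_normZ_le c^-1 (c *: f).
rewrite scalerA mulVf// scale1r => h.
have e : complex.Re `|c| * complex.Re `|c^-1| = 1.
  have : `|c| * `|c^-1| = 1 by rewrite -normrM divff// normr1.
  by rewrite [ `|c|]normcRe [ `|c^-1|]normcRe -rmorphM => /(congr1 (@complex.Re R)).
by rewrite -[leRHS]mul1r -e -mulrA ler_wpM2l ?Re_norm_ge0.
Qed.

Lemma rnorm0_eq0 (a : A) : rnorm a = 0 -> a = 0.
Proof. by move=> a0; apply/normr0_eq0; rewrite rnormE a0. Qed.

Lemma linf_norm0_eq0 (f : linf) : (linf_norm f)%:C = 0 :> R[i] -> f = 0.
Proof.
move=> /(congr1 (@complex.Re R)) /= f0; apply: linfP => i.
apply: rnorm0_eq0; apply/le_anti; rewrite rnorm_ge0 andbT -f0.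
exact: le_linf_norm.
Qed.

HB.instance Definition _ :=
  Lmodule_isNormed.Build R[i] linf linf_normD linf_normZ linf_norm0_eq0.

Lemma linf_normE (f : linf) : `|f| = (linf_norm f)%:C. Proof. by []. Qed.

Lemma linf_complete (F : set_system linf) :
  ProperFilter F -> cauchy F -> cvg F.
Proof.
move=> FF /cauchy_ballP Fc.
have Fi i : cvg ((fun f : linf => f i) @ F).
  apply: cauchy_cvg; apply/cauchy_ballP => e e0.
  have [[P Q] [/= FP FQ] PQ] := Fc e e0.
  exists ((fun f : linf => f i) @` P, (fun f : linf => f i) @` Q) => /=.
    split; first by apply: filterS FP => f Pf; exists f.
    by apply: filterS FQ => f Qf; exists f.
  case=> _ _ [/= [f Pf <-] [g Qg <-]].
  have := PQ (f, g) (conj Pf Qg).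
  rewrite -!ball_normE /= linf_normE rnormE; apply: le_lt_trans; rewrite lecR.
  exact: (le_linf_norm (f - g) i).
pose l i := lim ((fun f : linf => f i) @ F).
have unif (e : R) : 0 < e ->
    exists2 P, F P & forall f, P f -> forall i, rnorm (l i - f i) <= e.
  move=> e0; have e20 : (0 : R[i]) < (e / 2)%:C by rewrite ltcR divr_gt0.
  have [[P Q] [/= FP FQ] PQ] := Fc _ e20.
  exists P => // f Pf i.
  have /cvgrPdist_lt /(_ _ e20) Hl := Fi i.
  have [g [Qg /=]] := filter_ex (filterI FQ Hl).
  rewrite rnormE ltcR => lg.
  have := PQ (f, g) (conj Pf Qg).
  rewrite -ball_normE /= linf_normE ltcR => fg.
  have -> : l i - f i = (l i - g i) - (f - g) i by rewrite /= opprB addrA subrK.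
  have -> : e = e / 2 + e / 2 by rewrite -splitr.
  apply: (le_trans (rnormD _ _)); apply: lerD; first exact: ltW.
  have -> : rnorm (- (f - g) i) = rnorm ((f - g) i) by rewrite /rnorm normrN.
  exact: le_trans (le_linf_norm _ _) (ltW fg).
have lb : l \in bounded_family.
  have [P FP Pl] := unif 1 ltr01; have [f Pf] := filter_ex FP.
  apply/bounded_familyP; exists (1 + linf_norm f) => i.
  rewrite -[l i](subrK (f i)); apply: (le_trans (rnormD _ _)).
  by apply: lerD; [exact: Pl | exact: le_linf_norm].
apply/cvg_ex; exists (Linf lb); apply/cvgrPdist_le => e e0.
have eE : e = (complex.Re e)%:C.
  by move: e0; rewrite ltcE /= => /andP[/eqP + _]; case: e => x y /= ->.
have e0' : 0 < complex.Re e by rewrite -ltcR -eE.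
have [P FP Pl] := unif _ e0'.
apply: filterS FP => f Pf; rewrite linf_normE eE lecR.
by apply: linf_norm_le => [|i]; [exact: ltW | exact: Pl].
Qed.

HB.instance Definition _ := Uniform_isComplete.Build linf linf_complete.

Lemma rnormM_le (a b : A) : rnorm (a ** b) <= rnorm a * rnorm b.
Proof. by have := normM_le a b; rewrite !rnormE -rmorphM lecR. Qed.

Lemma rnorm_cstar (a : A) : rnorm (star a ** a) = rnorm a ^+ 2.
Proof.
by have := cstar_identity a; rewrite !rnormE -rmorphXn => /(congr1 (@complex.Re R)).
Qed.

Lemma rnorm_star_le (a : A) : rnorm (star a) <= rnorm a.
Proof.
have [->|a0] := eqVneq (star a) 0; first by rewrite {1}/rnorm normr0 [complex.Re 0]/= rnorm_ge0.
have sa : 0 < rnorm (star a).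
  by rewrite lt_neqAle rnorm_ge0 andbT eq_sym; apply: contra_neq a0 => /rnorm0_eq0.
have := rnormM_le a (star a).
have := rnorm_cstar (star a); rewrite starK => ->.
by rewrite expr2 ler_pM2r.
Qed.

Lemma linf_mul_bounded (f g : linf) :
  (fun i => f i ** g i) \in bounded_family.
Proof.
apply/bounded_familyP; exists (linf_norm f * linf_norm g) => i.
apply: (le_trans (rnormM_le _ _)).
by rewrite ler_pM ?rnorm_ge0 ?le_linf_norm.
Qed.

Lemma linf_star_bounded (f : linf) : (fun i => star (f i)) \in bounded_family.
Proof.
apply/bounded_familyP; exists (linf_norm f) => i.
exact: le_trans (rnorm_star_le _) (le_linf_norm _ _).
Qed.

Definition linf_mul (f g : linf) : linf := Linf (linf_mul_bounded f g).
Definition linf_star (f : linf) : linf := Linf (linf_star_bounded f).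

Fact linf_mulA : associative linf_mul.
Proof. by move=> f g h; apply: linfP => i; exact: cmulA. Qed.
Fact linf_mulDl : left_distributive linf_mul +%R.
Proof. by move=> f g h; apply: linfP => i; exact: cmulDl. Qed.
Fact linf_mulDr : right_distributive linf_mul +%R.
Proof. by move=> f g h; apply: linfP => i; exact: cmulDr. Qed.
Fact linf_mulZl (c : R[i]) (f g : linf) :
  linf_mul (c *: f) g = c *: linf_mul f g.
Proof. by apply: linfP => i; exact: cmulZl. Qed.
Fact linf_mulZr (c : R[i]) (f g : linf) :
  linf_mul f (c *: g) = c *: linf_mul f g.
Proof. by apply: linfP => i; exact: cmulZr. Qed.
Fact linf_starK : involutive linf_star.
Proof. by move=> f; apply: linfP => i; exact: starK. Qed.
Fact linf_starD : {morph linf_star : f g / f + g}.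
Proof. by move=> f g; apply: linfP => i; exact: starD. Qed.
Fact linf_starZ (c : R[i]) (f : linf) :
  linf_star (c *: f) = Num.conj c *: linf_star f.
Proof. by apply: linfP => i; exact: starZ. Qed.
Fact linf_starM (f g : linf) :
  linf_star (linf_mul f g) = linf_mul (linf_star g) (linf_star f).
Proof. by apply: linfP => i; exact: starM. Qed.
Fact linf_normM_le (f g : linf) : `|linf_mul f g| <= `|f| * `|g|.
Proof.
rewrite !linf_normE -rmorphM lecR; apply: linf_norm_le => [|i].
  by rewrite mulr_ge0 ?linf_norm_ge0.
apply: (le_trans (rnormM_le _ _)).
by rewrite ler_pM ?rnorm_ge0 ?le_linf_norm.
Qed.
Fact linf_cstar_identity (f : linf) :
  `|linf_mul (linf_star f) f| = `|f| ^+ 2.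
Proof.
rewrite !linf_normE -rmorphXn; congr (_%:C); apply/le_anti/andP; split.
  apply: linf_norm_le => [|i]; first by rewrite exprn_ge0 ?linf_norm_ge0.
  by rewrite rnorm_cstar lerXn2r ?nnegrE ?rnorm_ge0 ?linf_norm_ge0 ?le_linf_norm.
set m := linf_norm (linf_mul _ _).
have m0 : 0 <= m := linf_norm_ge0 _.
suff fm : linf_norm f <= Num.sqrt m.
  rewrite -[leRHS]sqr_sqrtr//.
  by rewrite lerXn2r ?nnegrE ?sqrtr_ge0 ?linf_norm_ge0.
apply: linf_norm_le => [|i]; first exact: sqrtr_ge0.
rewrite -[leLHS]ger0_norm ?rnorm_ge0// -sqrtr_sqr ler_wsqrtr// -rnorm_cstar.
exact: (le_linf_norm (linf_mul (linf_star f) f) i).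
Qed.

HB.instance Definition _ := isCStarAlgebra.Build R linf
  linf_mulA linf_mulDl linf_mulDr linf_mulZl linf_mulZr linf_starK linf_starD
  linf_starZ linf_starM linf_normM_le linf_cstar_identity.

End Linf.

(* 0 if f is unbounded; the families it is applied to below are bounded (for
   c0_sum_act, when the maps beta i g are contractive). *)
Definition to_linf (R : realType) (I : Type) (A : cstarAlgType R) (f : I -> A) :
  linf I A := insubd (0 : linf I A) f.

(* A C*-algebra is given as a norm-closed *-subalgebra S of an ambient
   C*-algebra (S = setT being allowed); a map defined on S is a function on the
   ambient algebra, whose values outside S are irrelevant. *)
Section Subalgebras.
Context (R : realType).
Implicit Type A B : cstarAlgType R.

Definition lspan A (X : set A) : set A :=
  [set a | exists2 s : seq (R[i] * A),
     (forall p, p \in s -> X p.2) & a = \sum_(p <- s) p.1 *: p.2].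

Definition subspace_sum A (I : Type) (F : I -> set A) : set A :=
  lspan (\bigcup_i F i).

Record linear_subspace A (S : set A) : Prop := {
  subspace0 : S 0;
  subspaceP : forall (c : R[i]) a b, S a -> S b -> S (c *: a + b)
}.

Record star_subalgebra A (S : set A) : Prop := {
  starsub_subspace : linear_subspace S;
  starsub_mul : forall a b, S a -> S b -> S (a ** b);
  starsub_star : forall a, S a -> S (star a)
}.

Definition cstar_subalgebra A (S : set A) : Prop :=
  star_subalgebra S /\ closed S.

Record closed_ideal A (S J : set A) : Prop := {
  ideal_sub : J `<=` S;
  ideal_closed : closed J;
  ideal_subspace : linear_subspace J;
  ideal_mull : forall a b, S a -> J b -> J (a ** b);
  ideal_mulr : forall a b, J a -> S b -> J (a ** b)
}.

Record star_hom A B (S : set A) (f : A -> B) : Prop := {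
  star_hom_dom : star_subalgebra S;
  star_homP : forall (c : R[i]) a b, S a -> S b ->
    f (c *: a + b) = c *: f a + f b;
  star_homM : forall a b, S a -> S b -> f (a ** b) = f a ** f b;
  star_homS : forall a, S a -> f (star a) = star (f a)
}.

Definition star_iso A B (S : set A) (T : set B) (f : A -> B) : Prop :=
  star_hom S f /\ set_bij S T f.

End Subalgebras.

Section PartialActions.
Context (R : realType) (G : groupType).
Implicit Type A B F E : cstarAlgType R.

Record pact_data A := PactData {
  dom : G -> set A;
  act : G -> A -> A
}.

(* act alpha g is only meaningful on dom alpha g^-1. That the domains are
   *-subalgebras (contained in star_iso) is automatic for closed ideals. *)
Record is_partial_action A (S : set A) (alpha : pact_data A) : Prop := {
  pact_algebra : cstar_subalgebra S;
  pact_ideal : forall g, closed_ideal S (dom alpha g);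
  pact_iso : forall g,
    star_iso (dom alpha g^-1%g) (dom alpha g) (act alpha g);
  pact_dom1 : dom alpha 1%g = S;
  pact_act1 : forall a, S a -> act alpha 1%g a = a;
  pact_extends : forall g h a,
    dom alpha h^-1%g a -> dom alpha g^-1%g (act alpha h a) ->
    dom alpha (g * h)^-1%g a /\
    act alpha (g * h)%g a = act alpha g (act alpha h a)
}.

Definition restr A (J : set A) (alpha : pact_data A) : pact_data A :=
  PactData (fun g => J `&` dom alpha g) (act alpha).

Definition is_action B (S : set B) (beta : G -> B -> B) : Prop :=
  is_partial_action S (PactData (fun=> S) beta).

Record enveloping_action A (S : set A) (alpha : pact_data A)
    B (T : set B) (beta : G -> B -> B) (iota : A -> B) : Prop := {
  env_pact : is_partial_action S alpha;
  env_action : is_action T beta;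
  env_hom : star_hom S iota;
  env_inj : set_inj S iota;
  env_ideal : closed_ideal T (iota @` S);
  env_dom : forall g,
    iota @` dom alpha g = (iota @` S) `&` (beta g @` (iota @` S));
  env_act : forall g a, dom alpha g^-1%g a ->
    iota (act alpha g a) = beta g (iota a);
  env_span : T =
    closure (lspan [set b | exists g, exists2 a, S a & b = beta g (iota a)])
}.

Definition globalizable A (S : set A) (alpha : pact_data A) : Prop :=
  exists (B : cstarAlgType R) (T : set B) (beta : G -> B -> B) (iota : A -> B),
    enveloping_action S alpha T beta iota.

(* Finitely supported sections f; f stands for \sum_g (f g) delta_g, with
   (a delta_g) (b delta_h) = alpha_g (alpha_{g^-1}(a) b) delta_{gh} and
   (a delta_g)^* = alpha_{g^-1}(a^* ) delta_{g^-1}. *)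
Definition sections A (alpha : pact_data A) : set (G -> A) :=
  [set f | finite_set [set g | f g != 0] /\ forall g, dom alpha g (f g)].

Definition sec_mul A (alpha : pact_data A) (f k : G -> A) : G -> A :=
  fun g => \sum_(h \in [set: G])
    act alpha h (act alpha h^-1%g (f h) ** k (h^-1 * g)%g).

Definition sec_star A (alpha : pact_data A) (f : G -> A) : G -> A :=
  fun g => act alpha g (star (f g^-1%g)).

Record star_rep A (alpha : pact_data A) B (pi : (G -> A) -> B) : Prop := {
  star_repP : forall (c : R[i]) f k, sections alpha f -> sections alpha k ->
    pi (c *: f + k) = c *: pi f + pi k;
  star_repM : forall f k, sections alpha f -> sections alpha k ->
    pi (sec_mul alpha f k) = pi f ** pi k;
  star_repS : forall f, sections alpha f ->
    pi (sec_star alpha f) = star (pi f)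
}.

(* Crossed products are described as completions of the *-algebra of sections
   rather than chosen; this fixes them up to a unique isomorphism compatible
   with the sections. The full one is the enveloping C*-algebra. *)
Record full_crossed_product A (alpha : pact_data A) F (j : (G -> A) -> F) :
    Prop := {
  full_rep : star_rep alpha j;
  full_dense : closure (j @` sections alpha) = setT;
  full_universal : forall (B : cstarAlgType R) (pi : (G -> A) -> B),
    star_rep alpha pi ->
    exists2 phi : F -> B, star_hom setT phi &
      forall f, sections alpha f -> phi (j f) = pi f
}.

(* The A-valued inner product (xi^* eta)(1) of the Hilbert module of
   l^2-sections, of which the finitely supported ones are a dense subspace. *)
Definition sec_inner A (alpha : pact_data A) (xi eta : G -> A) : A :=
  \sum_(g \in [set: G]) act alpha g^-1%g (star (xi g) ** eta g).

Definition sec_l2norm A (alpha : pact_data A) (xi : G -> A) : R :=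
  Num.sqrt (rnorm (sec_inner alpha xi xi)).

(* The operator norm of the left regular representation xi |-> f xi. *)
Definition reduced_norm A (alpha : pact_data A) (f : G -> A) : R :=
  sup [set sec_l2norm alpha (sec_mul alpha f xi) | xi in
        [set xi | sections alpha xi /\ sec_l2norm alpha xi <= 1]].

Record reduced_crossed_product A (alpha : pact_data A) E (r : (G -> A) -> E) :
    Prop := {
  reduced_rep : star_rep alpha r;
  reduced_dense : closure (r @` sections alpha) = setT;
  reduced_normE : forall f, sections alpha f -> rnorm (r f) = reduced_norm alpha f
}.

(* phi is the canonical surjection. *)
Definition amenable A (alpha : pact_data A) : Prop :=
  forall (F E : cstarAlgType R) (j : (G -> A) -> F) (r : (G -> A) -> E)
    (phi : F -> E),
    full_crossed_product alpha j -> reduced_crossed_product alpha r ->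
    star_hom setT phi -> (forall f, sections alpha f -> phi (j f) = r f) ->
    injective phi.

Definition translate (g : G) (tau : {fset G}) : {fset G} :=
  [fset (g * h)%g | h in tau]%fset.

Definition inverses (tau : {fset G}) : {fset G} := [fset g^-1%g | g in tau]%fset.

Definition Tn (n : nat) : Type :=
  {tau : {fset G} | (1%g \in tau) && (#|` tau| == n)}.

Definition Tn_fset n (tau : Tn n) : {fset G} := sval tau.
Coercion Tn_fset : Tn >-> finset_of.

Definition idom A (alpha : pact_data A) (tau : {fset G}) : set A :=
  \bigcap_(g in [set` tau]) dom alpha g.

Record decomposition_property A (n : nat) (alpha : pact_data A) : Prop := {
  decomp_dense :
    closure (subspace_sum (fun tau : Tn n => idom alpha tau)) = setT;
  decomp_disjoint : forall (tau : Tn n) g, g \notin (tau : {fset G}) ->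
    idom alpha tau `&` dom alpha g = [set 0]
}.

Definition orbit n (tau : Tn n) : set (Tn n) :=
  [set sigma | exists2 g, g^-1%g \in (tau : {fset G}) &
     (sigma : {fset G}) = translate g tau].

Definition orbit_space n : Type :=
  {z : set (Tn n) | exists tau, z = orbit tau}.

Definition stab (tau : {fset G}) : set G := [set h | translate h tau = tau].

(* stab tau is contained in tau, as 1 is in tau, so fset_set is not the default
   value it takes on infinite sets; stab_index is the m of tau = H x_0 + ... + H x_m. *)
Definition stab_index n (tau : Tn n) : nat :=
  (n %/ #|` fset_set (stab tau)|)%N.-1.

Definition rcoset (H : set G) (g : G) : set G := [set (h * g)%g | h in H].

Record coset_representatives n (tau : Tn n)
    (x : 'I_(stab_index tau).+1 -> G) : Prop := {
  coset_rep0 : x ord0 = 1%g;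
  coset_rep_cover : [set` (tau : {fset G})] = \bigcup_j rcoset (stab tau) (x j);
  coset_rep_disjoint : trivIset setT (fun j => rcoset (stab tau) (x j))
}.

Definition orbit_ideal A (alpha : pact_data A) (tau : {fset G}) : set A :=
  [set a | exists2 b : G -> A,
     (forall g, g \in inverses tau -> idom alpha (translate g tau) (b g)) &
     a = \sum_(g <- inverses tau) b g].

(* The components of a in the direct sum of the ideals A_{x_j^-1 tau}; they are
   unique under the decomposition property, for a in orbit_ideal alpha tau. *)
Definition orbit_proj A (alpha : pact_data A) (tau : {fset G}) m
    (x : 'I_m -> G) (j : 'I_m) (a : A) : A :=
  xget (fun=> 0) [set b : 'I_m -> A |
    (forall k, idom alpha (translate (x k)^-1%g tau) (b k)) /\
    a = \sum_k b k] j.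

Definition Ind A (H : set G) (C : set A) (gamma : G -> A -> A) :
    set (linf G A) :=
  [set xi | [/\ forall g, C (xi g),
     forall h g, H h -> xi (h * g)%g = gamma h (xi g) &
     forall e : R, 0 < e ->
       finite_set (rcoset H @` [set g | e <= rnorm (xi g)])]].

Definition Ind_act A (g : G) (xi : linf G A) : linf G A :=
  to_linf (fun k => xi (k * g)%g).

Definition iota_tau A (alpha : pact_data A) (tau : {fset G}) m
    (x : 'I_m -> G) (a : A) : linf G A :=
  to_linf (fun g =>
    if [pick k | g \in rcoset (stab tau) (x k)] is Some k
    then act alpha g (orbit_proj alpha tau x k a) else 0).

Definition c0_sum (I : Type) B (T : I -> set B) : set (linf I B) :=
  [set zeta | (forall i, T i (zeta i)) /\
     forall e : R, 0 < e -> finite_set [set i | e <= rnorm (zeta i)]].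

Definition c0_sum_act (I : Type) B (beta : I -> G -> B -> B) (g : G)
    (zeta : linf I B) : linf I B :=
  to_linf (fun i => beta i g (zeta i)).

End PartialActions.

(* Main.v *)
Require Import Defs.
From mathcomp Require Import all_boot all_order all_algebra.
From mathcomp Require Import finmap complex.
From mathcomp Require Import all_classical all_reals all_analysis.
From mathcomp Require Import ring lra zify.

Set Implicit Arguments.
Unset Strict Implicit.
Unset Printing Implicit Defensive.

Import Order.TTheory GRing.Theory Num.Theory.
Import numFieldNormedType.Exports.

Local Open Scope classical_set_scope.
Local Open Scope ring_scope.

(** By the decomposition property the ideals [A_sigma], for [sigma] a set of [n]
    elements containing the unit, are mutually orthogonal and span a dense
    subspace, so [A] is their direct sum; [A_sigma] meets [A_g] only for [g] in
    [sigma], and then [alpha_(g^-1)] maps it onto [A_(g^-1 sigma)]. Every [a] thus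
    has a component in each [A_sigma] ([component]), it is approximated by the
    finite sums of its components ([component_approx]), and membership in the
    ideals at hand can be read off from the components ([orbit_idealP],
    [component_dom_in]).

    Along the orbit of [tau] all components can be transported to [A_tau]: the
    value of [iota_tau(a)] at [g] in [tau] is the image under [alpha_g] of the
    component of [a] in [A_(g^-1 tau)] ([orbit_map]). Its image consists of the
    elements of the induced algebra that are supported in [tau]
    ([orbit_map_image]). This makes it an ideal, it identifies the part common to
    a translate as the sections supported in [tau] and in [tau g^-1], and since
    the stabiliser is contained in [tau] the translates of the image contain all
    sections supported on a single coset, which span a dense subspace
    ([Ind_dense]). This gives [orbit_enveloping]. The global statement
    [global_enveloping] is the direct sum of these: the assembled map is isometric
    ([rnorm_global_map]), so its image is closed.

    For amenability let [u] be in the kernel of the canonical map from the full to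
    the reduced crossed product. For [a] in [A_tau] and [b] in [A_sigma] the
    element [a u b] is a limit of sections [a f b], and these are supported in the
    finite set [tau] ([confined_corner]). Each coordinate of such a section is
    dominated by its reduced norm ([confined_reduced_norm]), which tends to zero;
    hence [a u b = 0]. Since the sums of the ideals [A_tau] are dense, and an
    element killed by all of [A] is zero ([rep_nondegenerate]), [u] is zero
    ([decomposes_amenable]).

    Two facts about C*-algebras enter: homomorphisms are contractive
    ([star_hom_contractive]), and the norm of a sum of elements [y^* y] dominates
    that of each of them ([rnorm_sq_le_sum]). Both rest on the inequality
    [rpact_norm_le]: for self-adjoint [e] the norm of [p(e)] is at most the
    supremum of [|p|] on the spectrum of [e]. For [y] of norm one the powers
    [b^n] of [b = y^2 (1 + y^4) / 2] with [n] a power of two have norm one,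
    whereas the elements [b^n (1 - y^4)] tend to zero, so [1 - y^4] is not
    invertible; for [y] the quotient of [p(e)] by its norm it would be, if [|p|]
    were smaller than that norm on the spectrum. *)

(** * Norms, products and adjoints in a C*-algebra *)

Section CStarBasics.
Context (R : realType) (A : cstarAlgType R).
Implicit Types (a b c x : A) (r s : R).
Local Open Scope complex_scope.

Lemma cmul0r a : a ** 0 = 0.
Proof. by have := cmulZr 0 a (0 : A); rewrite !scale0r. Qed.

Lemma cmul0l a : 0 ** a = 0.
Proof. by have := cmulZl 0 (0 : A) a; rewrite !scale0r. Qed.

Lemma cmulNr a b : a ** (- b) = - (a ** b).
Proof. by rewrite -scaleN1r cmulZr scaleN1r. Qed.

Lemma cmulNl a b : (- a) ** b = - (a ** b).
Proof. by rewrite -scaleN1r cmulZl scaleN1r. Qed.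

Lemma cmulBr a b c : a ** (b - c) = a ** b - a ** c.
Proof. by rewrite cmulDr cmulNr. Qed.

Lemma cmulBl a b c : (a - b) ** c = a ** c - b ** c.
Proof. by rewrite cmulDl cmulNl. Qed.

Lemma cmul_sumr (I : Type) (s : seq I) (P : pred I) (F : I -> A) a :
  a ** (\sum_(i <- s | P i) F i) = \sum_(i <- s | P i) a ** F i.
Proof.
by apply: (big_morph (cmul a)) => [b c|]; rewrite ?cmulDr ?cmul0r.
Qed.

Lemma cmul_suml (I : Type) (s : seq I) (P : pred I) (F : I -> A) a :
  (\sum_(i <- s | P i) F i) ** a = \sum_(i <- s | P i) F i ** a.
Proof.
by apply: (big_morph (fun b => b ** a)) => [b c|]; rewrite ?cmulDl ?cmul0l.
Qed.

Lemma star0 : star (0 : A) = 0.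
Proof. by have := starZ 0 (0 : A); rewrite !scale0r conjC0 scale0r. Qed.

Lemma starN a : star (- a) = - star a.
Proof. by rewrite -scaleN1r starZ rmorphN1 scaleN1r. Qed.

Lemma starB a b : star (a - b) = star a - star b.
Proof. by rewrite starD starN. Qed.

Lemma star_sum (I : Type) (s : seq I) (P : pred I) (F : I -> A) :
  star (\sum_(i <- s | P i) F i) = \sum_(i <- s | P i) star (F i).
Proof. by apply: (big_morph star); [exact: starD | exact: star0]. Qed.

Lemma conj_real r : Num.conj (r%:C) = r%:C.
Proof. by rewrite conj_Creal//; apply/complex_realP; exists r. Qed.

Lemma rnorm0 : rnorm (0 : A) = 0.
Proof. by rewrite /rnorm normr0. Qed.

Lemma rnormN a : rnorm (- a) = rnorm a.
Proof. by rewrite /rnorm normrN. Qed.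

Lemma rnormB a b : rnorm (a - b) = rnorm (b - a).
Proof. by rewrite -rnormN opprB. Qed.

Lemma rnorm_subr_le a b : rnorm (a - b) <= rnorm a + rnorm b.
Proof. by rewrite -(rnormN b) rnormD. Qed.

Lemma rnorm_lerB a b : rnorm a - rnorm b <= rnorm (a + b).
Proof. by rewrite lerBlDr -{1}(addrK b a) rnorm_subr_le. Qed.

Lemma rnormZr r a : rnorm (r%:C *: a) = `|r| * rnorm a.
Proof. by rewrite rnormZ normc_def /= expr0n addr0 sqrtr_sqr. Qed.

Lemma rnorm_sum (I : Type) (s : seq I) (P : pred I) (F : I -> A) :
  rnorm (\sum_(i <- s | P i) F i) <= \sum_(i <- s | P i) rnorm (F i).
Proof.
apply: (big_ind2 (fun a r => rnorm a <= r)) => [|a r b s' ar bs|//].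
  by rewrite rnorm0.
by apply: le_trans (rnormD _ _) _; exact: lerD.
Qed.

Lemma rnorm_eq0 a : (rnorm a == 0) = (a == 0).
Proof. by apply/eqP/eqP => [/rnorm0_eq0|->]; last exact: rnorm0. Qed.

Lemma rnorm_gt0 a : (0 < rnorm a) = (a != 0).
Proof. by rewrite lt_neqAle rnorm_ge0 andbT eq_sym rnorm_eq0. Qed.

Lemma rnorm_le0 a : (forall e, 0 < e -> rnorm a <= e) -> a = 0.
Proof.
move=> h; apply: rnorm0_eq0; apply/le_anti; rewrite rnorm_ge0 andbT.
by apply/ler_addgt0Pl => e e0; rewrite addr0 h.
Qed.

Lemma rnorm_star a : rnorm (star a) = rnorm a.
Proof. by apply/le_anti; rewrite rnorm_star_le -{1}(starK a) rnorm_star_le. Qed.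

Lemma rnorm_cstar' a : rnorm (a ** star a) = rnorm a ^+ 2.
Proof. by rewrite -{1}(starK a) rnorm_cstar rnorm_star. Qed.

Lemma star_cmul_eq0 a : star a ** a = 0 -> a = 0.
Proof.
move=> h; apply: rnorm0_eq0; apply/eqP; rewrite -sqrf_eq0 -rnorm_cstar h.
by rewrite rnorm0.
Qed.

Lemma cmul_star_eq0 a : a ** star a = 0 -> a = 0.
Proof. by rewrite -{1}(starK a) => /star_cmul_eq0 h; rewrite -(starK a) h star0. Qed.

Lemma le_rnormM a b r s : rnorm a <= r -> rnorm b <= s -> rnorm (a ** b) <= r * s.
Proof.
move=> ar bs; apply: le_trans (rnormM_le _ _) _.
by apply: ler_pM => //; exact: rnorm_ge0.
Qed.

End CStarBasics.

(** * Polynomials in a self-adjoint element *)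

Section PolynomialCalculus.
Context (R : realType) (A : cstarAlgType R).
Implicit Types (a b c e x z : A) (r s t : R).
Local Open Scope complex_scope.

(** The algebra may have no unit, so [p(e)] itself need not exist; it is
    represented by the operator of left multiplication by it. *)
Definition pact e (p : {poly R[i]}) x : A :=
  \sum_(i < size p) p`_i *: iter i (cmul e) x.

Lemma pactE n e (p : {poly R[i]}) x : (size p <= n)%N ->
  pact e p x = \sum_(i < n) p`_i *: iter i (cmul e) x.
Proof.
move=> pn; rewrite /pact (big_ord_widen n (fun i => p`_i *: iter i (cmul e) x))//.
rewrite big_mkcond; apply: eq_bigr => i _; case: ltnP => // pi.
by rewrite nth_default// scale0r.
Qed.

Lemma pactD e p q x : pact e (p + q) x = pact e p x + pact e q x.
Proof.
set n := maxn (size p) (size q).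
rewrite (@pactE n _ (p + q)) ?size_polyD// (@pactE n _ p) ?leq_maxl//.
rewrite (@pactE n _ q) ?leq_maxr//.
by rewrite -big_split; apply: eq_bigr => i _; rewrite coefD scalerDl.
Qed.

Lemma pactZ e k p x : pact e (k *: p) x = k *: pact e p x.
Proof.
rewrite (pactE (n := size p)) ?size_scale_leq// scaler_sumr.
by apply: eq_bigr => i _; rewrite coefZ scalerA.
Qed.

Lemma pactC e k x : pact e k%:P x = k *: x.
Proof.
by rewrite (pactE (n := 1)) ?size_polyC ?leq_b1// big_ord1 coefC eqxx.
Qed.

Lemma pactMX e p x : pact e (p * 'X) x = e ** pact e p x.
Proof.
rewrite (pactE (n := (size p).+1)); last first.
  by apply: leq_trans (size_polyMleq _ _) _; rewrite size_polyX addn2.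
rewrite big_ord_recl coefMX eqxx scale0r add0r cmul_sumr.
by apply: eq_bigr => i _; rewrite coefMX /= cmulZr.
Qed.

Lemma iter_cmulZ e i k x : iter i (cmul e) (k *: x) = k *: iter i (cmul e) x.
Proof. by elim: i => //= i ->; rewrite cmulZr. Qed.

Lemma pactZr e p k x : pact e p (k *: x) = k *: pact e p x.
Proof.
rewrite scaler_sumr; apply: eq_bigr => i _.
by rewrite iter_cmulZ !scalerA mulrC.
Qed.

Lemma pact_mulr e p x z : pact e p (x ** z) = pact e p x ** z.
Proof.
rewrite cmul_suml; apply: eq_bigr => i _; rewrite cmulZl; congr (_ *: _).
by elim: (nat_of_ord i) => //= k ->; rewrite cmulA.
Qed.

Lemma pactM e p q x : pact e (p * q) x = pact e p (pact e q x).
Proof.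
elim/poly_ind: p => [|p k IH].
  by rewrite mul0r -[0]/(0%:P) !pactC !scale0r.
rewrite mulrDl -mulrA ['X * q]mulrC mulrA !pactD !pactMX IH.
by rewrite mul_polyC pactZ pactC.
Qed.

Lemma pactX e x : pact e 'X x = e ** x.
Proof. by rewrite -[X in pact _ X]mul1r pactMX -[1]/(1%:P) pactC scale1r. Qed.

Lemma pact_crude e p x : rnorm (pact e p x) <=
  (\sum_(i < size p) complex.Re `|p`_i| * rnorm e ^+ i) * rnorm x.
Proof.
rewrite mulr_suml; apply: le_trans (rnorm_sum _ _ _) _; apply: ler_sum => i _.
rewrite rnormZ -mulrA ler_wpM2l ?Re_norm_ge0//.
elim: (nat_of_ord i) => [|k IH] /=; first by rewrite expr0 mul1r.
by apply: le_trans (rnormM_le _ _) _; rewrite exprS -mulrA ler_wpM2l ?rnorm_ge0.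
Qed.

(** Only polynomials with real coefficients give self-adjoint operators; the
    complex ones serve to split real polynomials into linear factors. *)
Definition rpact e (p : {poly R}) x : A := pact e (map_poly (real_complex R) p) x.

Lemma rpactD e p q x : rpact e (p + q) x = rpact e p x + rpact e q x.
Proof. by rewrite /rpact rmorphD pactD. Qed.

Lemma rpactZ e r p x : rpact e (r *: p) x = r%:C *: rpact e p x.
Proof. by rewrite /rpact map_polyZ pactZ. Qed.

Lemma rpactC e r x : rpact e r%:P x = r%:C *: x.
Proof. by rewrite /rpact map_polyC pactC. Qed.

Lemma rpact1 e x : rpact e 1 x = x.
Proof. by rewrite -[1]/(1%:P) rpactC scale1r. Qed.

Lemma rpactN e p x : rpact e (- p) x = - rpact e p x.
Proof. by rewrite -scaleN1r rpactZ rmorphN1 scaleN1r. Qed.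

Lemma rpactB e p q x : rpact e (p - q) x = rpact e p x - rpact e q x.
Proof. by rewrite rpactD rpactN. Qed.

Lemma rpactX e x : rpact e 'X x = e ** x.
Proof. by rewrite /rpact map_polyX pactX. Qed.

Lemma rpactM e p q x : rpact e (p * q) x = rpact e p (rpact e q x).
Proof. by rewrite /rpact rmorphM pactM. Qed.

Lemma rpactZr e p k x : rpact e p (k *: x) = k *: rpact e p x.
Proof. exact: pactZr. Qed.

Lemma rpact_mulr e p x z : rpact e p (x ** z) = rpact e p x ** z.
Proof. exact: pact_mulr. Qed.

Lemma rpact_adj e p x z : star e = e -> star (rpact e p x) ** z = star x ** rpact e p z.
Proof.
move=> he; rewrite /rpact /pact star_sum cmul_suml cmul_sumr.
apply: eq_bigr => i _; rewrite starZ cmulZl cmulZr coef_map conj_real.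
congr (_ *: _); elim: (nat_of_ord i) x z => // k IH x z.
by rewrite iterS iterSr starM he -cmulA IH.
Qed.

Lemma rpact_self e p : star e = e -> star (rpact e p e) = rpact e p e.
Proof.
move=> he; rewrite /rpact /pact star_sum.
have comm k : iter k (cmul e) e ** e = e ** iter k (cmul e) e.
  by elim: k => //= k IH; rewrite -cmulA IH.
apply: eq_bigr => i _; rewrite starZ coef_map conj_real; congr (_ *: _).
by elim: (nat_of_ord i) => //= k IH; rewrite starM IH he comm.
Qed.

Lemma rpact_bounded e p :
  exists2 M : R, 0 < M & forall x, rnorm (rpact e p x) <= M * rnorm x.
Proof.
exists (1 + \sum_(i < size (map_poly (real_complex R) p))
    complex.Re `|(map_poly (real_complex R) p)`_i| * rnorm e ^+ i) => [|x].
  rewrite ltr_pwDl// sumr_ge0// => i _.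
  by rewrite mulr_ge0 ?Re_norm_ge0 ?exprn_ge0 ?rnorm_ge0.
apply: le_trans (pact_crude _ _ _) _; rewrite mulrDl lerDr mul1r.
exact: rnorm_ge0.
Qed.

End PolynomialCalculus.

(** * The norm of a polynomial in a self-adjoint element *)

Section Bernoulli.
Context (R : realType).

Lemma bernoulli_ineq (x : R) n : -1 <= x -> 1 + n%:R * x <= (1 + x) ^+ n.
Proof.
move=> x1; elim: n => [|n IH]; first by rewrite mul0r addr0 expr0.
have x0 : 0 <= 1 + x by lra.
rewrite exprS; apply: le_trans (ler_wpM2l x0 IH).
have n0 : 0 <= n%:R :> R by exact: ler0n.
by rewrite -natr1; have := mulr_ge0 n0 (sqr_ge0 x); rewrite expr2; nra.
Qed.

Lemma pow_gap (e : R) n : 0 < e -> exists k : nat, n%:R < e * 2 ^+ k.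
Proof.
move=> e0; exists (Num.bound (n%:R / e)).
rewrite -ltr_pdivrMl// mulrC; apply: lt_le_trans (archi_boundP _) _.
  by rewrite divr_ge0 ?ler0n// ltW.
have := @bernoulli_ineq 1 (Num.bound (n%:R / e)); rewrite mulr1 => h.
by apply: le_trans (h _) ; [rewrite lerDr | lra].
Qed.

Lemma small_pow (q e : R) : 0 <= q -> q < 1 -> 0 < e -> exists n : nat, q ^+ n < e.
Proof.
move=> q0 q1 e0; have [->|qn0] := eqVneq q 0; first by exists 1%N; rewrite expr1.
have qp : 0 < q by rewrite lt_neqAle eq_sym qn0.
have d0 : 0 < q^-1 - 1 by rewrite subr_gt0 invf_gt1.
pose n := Num.bound (e^-1 / (q^-1 - 1)); exists n.
rewrite -[q]invrK exprVn invf_plt ?posrE ?exprn_gt0 ?invr_gt0//.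
have := @bernoulli_ineq (q^-1 - 1) n.
have -> : 1 + (q^-1 - 1) = q^-1 by rewrite addrC subrK.
move=> h; apply: lt_le_trans (h _); last by lra.
rewrite ltr_wpDl// -ltr_pdivrMr// archi_boundP//.
by rewrite divr_ge0 ?invr_ge0 ?(ltW e0) ?(ltW d0).
Qed.

(** Consecutive values of the central binomial coefficient over [4^m] have the
    ratio [(2m + 1)/(2m + 2)], whose square is at most [(2m + 1)/(2m + 3)]. *)
Lemma central_binomial m :
  ('C(m.*2, m)%:R / 4 ^+ m : R) ^+ 2 * (m.*2.+1)%:R <= 1.
Proof.
elim: m => [|m IH]; first by rewrite bin0 expr0 divr1 expr1n mul1r.
have e : 'C(m.+1.*2, m.+1)%:R * (m.+1)%:R = 'C(m.*2, m)%:R * (m.*2.+1)%:R * 2 :> R.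
  rewrite -!natrM; congr (_%:R); apply/eqP; rewrite -(eqn_pmul2r (ltn0Sn m)).
  have h1 := mul_bin_diag m.*2.+2 m; have h2 := mul_bin_diag m.*2.+1 m.
  have h3 : 'C(m.*2.+1, m.+1) = 'C(m.*2.+1, m).
    by rewrite -bin_sub -?addnn ?ltnS ?leq_addr// subSS addnK.
  rewrite h3 /= in h2; rewrite /= in h1; rewrite doubleS; apply/eqP.
  have -> : ('C(m.*2.+2, m.+1) * m.+1 = m.*2.+2 * 'C(m.*2.+1, m))%N by rewrite mulnC h1.
  have h4 : ('C(m.*2.+1, m) * m.+1 = m.*2.+1 * 'C(m.*2, m))%N by rewrite mulnC -h2.
  rewrite -mulnA h4 -[m.*2.+2]/(m.+1.*2) -muln2; lia.
set u := 'C(m.*2, m)%:R in e IH; set v := 'C(m.+1.*2, m.+1)%:R in e *.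
have m0 : (0 : R) < m.+1%:R by rewrite ltr0n.
have E : v / 4 ^+ m.+1 = u / 4 ^+ m * ((m.*2.+1)%:R / (2 * m.+1%:R)).
  have p0 : (4 ^+ m : R) != 0 by rewrite expf_neq0.
  have -> : v = u * (m.*2.+1)%:R * 2 / m.+1%:R by rewrite -e mulfK// gt_eqF.
  by rewrite exprS; field; rewrite p0 gt_eqF.
rewrite E exprMn; set a := u / 4 ^+ m in IH *.
apply: le_trans IH; rewrite -mulrA; apply: ler_wpM2l; first exact: sqr_ge0.
rewrite expr_div_n mulrAC ler_pdivrMr ?exprn_gt0 ?mulr_gt0//.
have := ler0n R m; rewrite doubleS -muln2.
rewrite -!natr1 !natrM -!natr1; nra.
Qed.

(** A row of binomial coefficients increases up to its middle and decreases from
    there on, so its total variation telescopes. *)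
Lemma binomial_variation m :
  1 + \sum_(k < m.*2) `| 'C(m.*2, k.+1)%:R - 'C(m.*2, k)%:R | = 2 * 'C(m.*2, m)%:R - 1 :> R.
Proof.
have up k : (k < m)%N -> ('C(m.*2, k) <= 'C(m.*2, k.+1))%N.
  move=> km; rewrite -(leq_pmul2l (ltn0Sn k)) mul_bin_left leq_mul2r.
  by apply/orP; right; rewrite -addnn; lia.
have down k : (m <= k)%N -> ('C(m.*2, k.+1) <= 'C(m.*2, k))%N.
  move=> km; rewrite -(leq_pmul2l (ltn0Sn k)) mul_bin_left leq_mul2r.
  by apply/orP; right; rewrite -addnn; lia.
rewrite -(big_mkord xpredT (fun k => `|'C(m.*2, k.+1)%:R - 'C(m.*2, k)%:R : R|)).
rewrite (big_cat_nat (n := m)) ?leq0n//=; last by rewrite -addnn leq_addr.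
rewrite (eq_big_nat _ _ (F2 := fun k => 'C(m.*2, k.+1)%:R - 'C(m.*2, k)%:R)); last first.
  by move=> k /andP[_ km]; rewrite ger0_norm// subr_ge0 ler_nat up.
rewrite [X in _ + (_ + X)](eq_big_nat _ _
    (F2 := fun k => - ('C(m.*2, k.+1)%:R - 'C(m.*2, k)%:R))); last first.
  by move=> k /andP[mk _]; rewrite ler0_norm// subr_le0 ler_nat down.
rewrite sumrN !(@telescope_sumr R _ _ (fun k => 'C(m.*2, k)%:R)) ?leq0n//.
  by rewrite bin0 binn; ring.
by rewrite -addnn leq_addr.
Qed.

End Bernoulli.

Section SpectralInequality.
Context (R : realType) (A : cstarAlgType R).
Implicit Types (a b c e x z : A) (r s t : R) (K : set R).
Local Open Scope complex_scope.

Lemma conj_imag : Num.conj ('i%R : R[i]) = - 'i%R.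
Proof. exact: conjCi. Qed.

Lemma rnormZi a : rnorm (('i%R : R[i]) *: a) = rnorm a.
Proof. by rewrite rnormZ normCi mul1r. Qed.

Lemma rnorm_pair e p q x : star e = e ->
  rnorm (rpact e p x + 'i%R *: rpact e q x) ^+ 2 =
  rnorm (star x ** rpact e (p ^+ 2 + q ^+ 2) x).
Proof.
move=> he; rewrite -rnorm_cstar; congr rnorm.
rewrite starD starZ conj_imag cmulDl !cmulDr !cmulZr !cmulZl !rpact_adj//.
rewrite -!rpactM [q * p]mulrC rpactD cmulDr !expr2 -!addrA; congr (_ + _).
rewrite scalerA mulrN -expr2 sqrCi opprK scale1r addrA.
by rewrite scaleNr subrr add0r.
Qed.

(** The operator [p(e) + i q(e)] is normal, so it has the norm of
    [p(e) - i q(e)], and [p(e)] is the mean of the two. *)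
Lemma rnorm_pairl e p q x : star e = e ->
  rnorm (rpact e p x) <= rnorm (rpact e p x + 'i%R *: rpact e q x).
Proof.
move=> he; set w := _ + _; set w' := rpact e p x - 'i%R *: rpact e q x.
have ww' : rnorm w' = rnorm w.
  apply/eqP; rewrite -(@eqrXn2 _ 2) ?rnorm_ge0// rnorm_pair// /w' -scalerN -rpactN.
  by rewrite rnorm_pair// sqrrN.
have /(congr1 (@rnorm R A)) : w + w' = (2 : R)%:C *: rpact e p x.
  by rewrite /w /w' addrACA subrr addr0 rmorph_nat scaler_nat mulr2n.
rewrite rnormZr ger0_norm// => h.
by have := rnormD w w'; rewrite h ww' -mulr2n -(mulr_natl (rnorm w)) ler_pM2l.
Qed.

Lemma rnorm_pairr e p q x : star e = e ->
  rnorm (rpact e q x) <= rnorm (rpact e p x + 'i%R *: rpact e q x).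
Proof.
move=> he; rewrite -(rnormZi (_ + _)) scalerDr scalerA -expr2 sqrCi scaleN1r.
by rewrite addrC -rpactN -(rnormN (_ + _)) opprD -rpactN -scalerN -rpactN opprK rnorm_pairl.
Qed.

(** For commuting self-adjoint [p(e)] and [q(e)] this is monotonicity of the norm
    on sums of squares; it is available before any theory of positive elements. *)
Lemma two_squares e p q x : star e = e ->
  rnorm (rpact e p x) ^+ 2 <= rnorm x * rnorm (rpact e (p ^+ 2 + q ^+ 2) x).
Proof.
move=> he; apply: (@le_trans _ _ (rnorm (rpact e p x + 'i%R *: rpact e q x) ^+ 2)).
  by rewrite lerXn2r ?nnegrE ?rnorm_ge0 ?rnorm_pairl.
by rewrite rnorm_pair//; apply: le_trans (rnormM_le _ _) _; rewrite rnorm_star.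
Qed.

Lemma one_square e p x : star e = e ->
  rnorm (rpact e p x) ^+ 2 <= rnorm x * rnorm (rpact e (p ^+ 2) x).
Proof. by move=> he; have := two_squares p 0 x he; rewrite expr0n addr0. Qed.

Definition bounded_below (T : A -> A) :=
  exists2 k, 0 < k & forall x, k * rnorm x <= rnorm (T x).

(** [spec_in e K] says that the approximate point spectrum of left
    multiplication by [e] lies in [K]. For self-adjoint [e] that is the whole
    spectrum, and being bounded below passes to factors of operators more easily
    than being invertible. *)
Definition spec_in e K :=
  forall t, ~ K t -> bounded_below (fun x => e ** x - t%:C *: x).

Lemma bounded_below_comp (S T : A -> A) :
  bounded_below S -> bounded_below T -> bounded_below (S \o T).
Proof.
move=> [k k0 kS] [l l0 lT]; exists (k * l); first exact: mulr_gt0.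
move=> x /=; apply: le_trans (kS _); rewrite -mulrA ler_wpM2l//.
exact: ltW.
Qed.

Lemma bounded_below_factor e p q :
  bounded_below (rpact e (p * q)) -> bounded_below (rpact e q).
Proof.
move=> [k k0 kpq]; have [M M0 Mp] := rpact_bounded e p.
exists (k / M); first exact: divr_gt0.
move=> x; rewrite mulrAC ler_pdivrMr// mulrC.
by rewrite [leRHS]mulrC; apply: le_trans (Mp _); rewrite -rpactM mulrC.
Qed.

Lemma spec_inP e K :
  (forall t, ~ K t -> bounded_below (rpact e ('X - t%:P))) -> spec_in e K.
Proof.
move=> h t /h[k k0 kb]; exists k => // x; apply: le_trans (kb x) _.
by rewrite rpactB rpactX rpactC.
Qed.

Lemma spec_inI e K L : spec_in e K -> spec_in e L -> spec_in e (K `&` L).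
Proof. by move=> hK hL t /not_andP[/hK|/hL]. Qed.

Lemma spec_norm e r : rnorm e <= r -> spec_in e [set t | - r <= t <= r].
Proof.
move=> er t /negP; rewrite -ler_norml -ltNge => rt.
exists (`|t| - rnorm e) => [|x].
  by rewrite subr_gt0; exact: le_lt_trans er rt.
rewrite rnormB mulrBl -rnormZr.
apply: le_trans (rnorm_lerB _ _); rewrite rnormN lerD2l lerN2.
exact: rnormM_le.
Qed.

Lemma spec_ball e : spec_in e [set t | - rnorm e <= t <= rnorm e].
Proof. exact: spec_norm. Qed.

(** Split [p] into linear factors over the complex numbers: a root off the real
    line or off [K] contributes a factor that is bounded below. *)
Lemma spec_poly e K p : star e = e -> spec_in e K -> K !=set0 ->
  (forall t, K t -> p.[t] != 0) -> bounded_below (rpact e p).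
Proof.
move=> he eK [t0 Kt0] pK.
have p0 : p != 0 by apply: contraNneq (pK _ Kt0) => ->; rewrite horner0.
set P := map_poly (real_complex R) p; have [r Pr] := closed_field_poly_normal P.
have linear (z : R[i]) : root P z -> bounded_below (pact e ('X - z%:P)).
  move=> Pz; have [Im0|Im0] := eqVneq (complex.Im z) 0.
    have zE : z = (complex.Re z)%:C by case: (z) Im0 => u v /= ->.
    have [|k k0 kb] := @eK (complex.Re z).
      move=> /pK /negP; apply.
      by move: Pz; rewrite zE /root horner_map fmorph_eq0.
    exists k => // x; apply: le_trans (kb x) _.
    by rewrite pactD pactX -polyCN pactC scaleNr -zE.
  exists `|complex.Im z| => [|x]; first by rewrite normr_gt0.
  have -> : pact e ('X - z%:P) x = rpact e ('X - (complex.Re z)%:P) x +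
      'i%R *: rpact e (- complex.Im z)%:P x.
    rewrite rpactB rpactX !rpactC pactD pactX -polyCN pactC -addrA.
    congr (_ + _); rewrite {1}[z]complexE complexiE scalerA -scaleNr -scalerDl.
    by congr (_ *: _); rewrite opprD rmorphN mulrN.
  by apply: le_trans (rnorm_pairr _ _ _ he); rewrite rpactC rnormZr normrN.
have Q : bounded_below (pact e (\prod_(z <- r) ('X - z%:P))).
  have rP (z : R[i]) : z \in r -> root P z.
    move=> zr; rewrite Pr rootZ ?lead_coef_eq0 ?map_poly_eq0//.
    by rewrite root_prod_XsubC.
  clear Pr; elim: r rP => [|z r IH] rP.
    exists 1 => // x.
    by rewrite big_nil -(polyC1 R[i]) pactC scale1r mul1r.
  rewrite big_cons.
  have /linear h : root P z by apply: rP; rewrite mem_head.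
  have h' : bounded_below (pact e (\prod_(z <- r) ('X - z%:P))).
    by apply: IH => w wr; apply: rP; rewrite in_cons wr orbT.
  have [k k0 kb] := bounded_below_comp h h'.
  by exists k => // x; rewrite pactM; exact: kb.
have [k k0 kb] := Q.
have l0 : 0 < complex.Re `|lead_coef P|.
  have : 0 < `|lead_coef P| by rewrite normr_gt0 lead_coef_eq0 map_poly_eq0.
  by rewrite ltcE => /andP[].
exists (complex.Re `|lead_coef P| * k) => [|x]; first exact: mulr_gt0.
rewrite /rpact -/P [in leRHS]Pr pactZ rnormZ -mulrA ler_wpM2l//.
exact: ltW.
Qed.

(** Summation by parts. *)
Lemma abel_sum (v : nat -> A) (c : nat -> R) V N : 0 <= c 0%N ->
  (forall k, rnorm (v k) <= V) ->
  rnorm (\sum_(k < N.+1) (c k)%:C *: (v k - v k.+1) + (c N)%:C *: v N.+1) <=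
  (c 0%N + \sum_(k < N) `|c k.+1 - c k|) * V.
Proof.
move=> c0 vV; elim: N => [|N IH].
  rewrite big_ord1 big_ord0 addr0 -scalerDr subrK rnormZr ger0_norm//.
  exact: ler_wpM2l.
rewrite big_ord_recr [X in c 0%N + X]big_ord_recr /= addrA mulrDl.
have -> : \sum_(k < N.+1) (c k)%:C *: (v k - v k.+1) +
    (c N.+1)%:C *: (v N.+1 - v N.+2) + (c N.+1)%:C *: v N.+2 =
    (\sum_(k < N.+1) (c k)%:C *: (v k - v k.+1) + (c N)%:C *: v N.+1) +
    (c N.+1 - c N)%:C *: v N.+1.
  by rewrite -!addrA -scalerDr subrK rmorphB scalerBl [X in _ = _ + X]addrC subrK.
apply: le_trans (rnormD _ _) _; apply: lerD IH _.
by rewrite rnormZr ler_wpM2l.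
Qed.

(** For a contraction [T], the powers of [(1 + T)/2] become almost invariant
    under [T]: the coefficients of [(1 + X)^n (1 - X)] have total size twice the
    central binomial coefficient, which is small against [2^n]. *)
Lemma mean_power_bound e T m x : (forall z, rnorm (rpact e T z) <= rnorm z) ->
  rnorm (rpact e ((1 + T) ^+ m.*2 * (1 - T)) x) <= 2 * 'C(m.*2, m)%:R * rnorm x.
Proof.
move=> Tc; set n := m.*2.
have TX k z : rnorm (rpact e (T ^+ k) z) <= rnorm z.
  elim: k => [|k IH]; first by rewrite expr0 rpact1.
  by rewrite exprS rpactM; exact: le_trans (Tc _) IH.
pose c k : R := 'C(n, k)%:R; pose v k := rpact e (T ^+ k) x.
have -> : rpact e ((1 + T) ^+ n * (1 - T)) x =
    \sum_(k < n.+1) (c k)%:C *: (v k - v k.+1).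
  rewrite exprDn mulr_suml /rpact rmorph_sum /=.
  have pact_sum (F : 'I_n.+1 -> {poly R[i]}) :
      pact e (\sum_i F i) x = \sum_i pact e (F i) x.
    apply: (big_morph (fun p => pact e p x)) => [p q|]; first exact: pactD.
    by rewrite -[0]/(0%:P) pactC scale0r.
  rewrite pact_sum; apply: eq_bigr => k _.
  rewrite expr1n mul1r mulrnAl mulrBr mulr1 -exprSr -scaler_nat.
  by rewrite -/(rpact e _ x) rpactZ rpactB.
have c0 : c 0%N = 1 by rewrite /c bin0.
have := @abel_sum v c (rnorm x) n _ (fun k => TX k x).
rewrite c0 => /(_ ler01) h.
rewrite -(addrK ((c n)%:C *: v n.+1) (\sum_(k < n.+1) _)).
apply: le_trans (rnorm_subr_le _ _) _.
have -> : 2 * 'C(n, m)%:R * rnorm x = (2 * 'C(n, m)%:R - 1) * rnorm x + rnorm x.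
  by rewrite mulrBl mul1r subrK.
apply: lerD; first by rewrite -binomial_variation; exact: h.
by rewrite rnormZr /c binn normr1 mul1r; exact: TX.
Qed.

End SpectralInequality.

Section SpectralTheorem.
Context (R : realType) (A : cstarAlgType R).
Implicit Types (a b c e x z : A) (r s t : R) (K : set R).
Local Open Scope complex_scope.

Lemma rpact_pow_contr e p : (forall z, rnorm (rpact e p z) <= rnorm z) ->
  forall k z, rnorm (rpact e (p ^+ k) z) <= rnorm z.
Proof.
move=> pc; elim=> [|k IH] z; first by rewrite expr0 rpact1.
by rewrite exprS rpactM; exact: le_trans (pc _) (IH _).
Qed.

Lemma rnorm_pow_two e p x k : star e = e -> rnorm x <= 1 ->
  rnorm (rpact e p x) ^+ (2 ^ k) <= rnorm (rpact e (p ^+ (2 ^ k)) x).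
Proof.
move=> he x1; elim: k => [|k IH]; first by rewrite !expr1.
rewrite expnSr !exprM.
apply: (@le_trans _ _ (rnorm (rpact e (p ^+ (2 ^ k)) x) ^+ 2)).
  by rewrite lerXn2r ?nnegrE ?exprn_ge0 ?rnorm_ge0.
apply: le_trans (one_square _ _ he) _.
by rewrite ler_piMl ?rnorm_ge0.
Qed.

(** If [1 - y^4] is bounded below, then [y] cannot attain norm one. With
    [b = y^2 (1 + y^4) / 2 = (y^2)^2 + y^2 (1 - y^2)^2 / 2] the two-squares
    inequality gives [|y x|^4 <= |b x|], whereas [b^n (1 - y^4)] tends to zero. *)
Lemma contraction_gap e y : star e = e ->
  (forall z, rnorm (rpact e y z) <= rnorm z) ->
  bounded_below (rpact e (1 - y ^+ 4)) ->
  exists2 d, d < 1 & forall x, rnorm x <= 1 -> rnorm (rpact e y x) <= d.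
Proof.
move=> he yc [k k0 kb]; pose T := y ^+ 4.
pose b := (2^-1)%:P * (y ^+ 2 * (1 + T)) : {poly R}.
have bx x : rnorm x <= 1 -> rnorm (rpact e y x) ^+ 4 <= rnorm (rpact e b x).
  move=> x1; have s2 : Num.sqrt (2^-1 : R) ^+ 2 = 2^-1 by rewrite sqr_sqrtr.
  have := two_squares (y ^+ 2) ((Num.sqrt 2^-1)%:P * (y * (1 - y ^+ 2))) x he.
  have -> : (y ^+ 2) ^+ 2 + ((Num.sqrt 2^-1)%:P * (y * (1 - y ^+ 2))) ^+ 2 = b.
    rewrite [X in _ + X]exprMn -polyC_exp s2 /b /T.
    have h : (2^-1)%:P + (2^-1)%:P = 1 :> {poly R}.
      by rewrite -polyCD -[1 in RHS]/(1%:P); congr (_%:P); lra.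
    by rewrite -[X in X + _ = _]mul1r -{1}h; ring.
  move=> h; apply: le_trans (le_trans h _); last by rewrite ler_piMl ?rnorm_ge0.
  have := @rnorm_pow_two e y x 1 he x1; rewrite !expn1 => h2.
  rewrite (exprM _ 2 2) lerXn2r// ?nnegrE ?exprn_ge0 ?rnorm_ge0//.
(* The power [2m] of [b] makes the coefficient sum [2 C(2m,m) / 4^m] less than
   [k / 2]; [m] is a power of two so that [rnorm_pow_two] applies to [b^(2m)]. *)
have [j kj] : exists j : nat, (2 ^ j)%:R ^-1 < (k / 4) ^+ 2.
  have k4 : 0 < (k / 4) ^+ 2 by rewrite exprn_gt0 ?divr_gt0.
  have [j] := pow_gap 1 k4; rewrite -ltr_pdivrMr ?exprn_gt0// => h.
  by exists j; rewrite natrX -[ltLHS]mul1r.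
pose m := (2 ^ j)%N; pose n := m.*2.
have nE : n = (2 ^ j.+1)%N by rewrite /n -mul2n expnS.
have um : 2 * ('C(n, m)%:R / 4 ^+ m) < k / 2.
  set u := _ / _; have u0 : 0 <= u by rewrite divr_ge0 ?ler0n ?exprn_ge0.
  suff : u < k / 4 by lra.
  rewrite -(ltr_pXn2r (ltn0Sn 1)) ?nnegrE ?divr_ge0 ?(ltW k0)//.
  apply: le_lt_trans kj; have := central_binomial R m; rewrite -/n -/u => h.
  rewrite -[leRHS]mul1r ler_pdivlMr ?ltr0n ?expn_gt0//.
  apply: le_trans h; apply: ler_wpM2l; first exact: sqr_ge0.
  by rewrite ler_nat -/m /n -addnn; lia.
have Tc z : rnorm (rpact e T z) <= rnorm z by exact: rpact_pow_contr.
have main x : rnorm x <= 1 -> rnorm (rpact e y x) ^+ (4 * n) <= 1 / 2.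
  move=> x1; apply: (@le_trans _ _ (rnorm (rpact e (b ^+ n) x))).
    rewrite exprM; apply: (@le_trans _ _ (rnorm (rpact e b x) ^+ n)).
      by rewrite lerXn2r ?nnegrE ?exprn_ge0 ?rnorm_ge0// bx.
    by rewrite nE rnorm_pow_two.
  have h : k * rnorm (rpact e (b ^+ n) x) <= 2 * ('C(n, m)%:R / 4 ^+ m).
    apply: le_trans (kb _) _; rewrite -rpactM.
    have -> : (1 - y ^+ 4) * b ^+ n =
        ((4 ^+ m)^-1)%:P * ((y ^+ 2) ^+ n * ((1 + T) ^+ n * (1 - T))).
      rewrite /b !exprMn -polyC_exp -/T.
      have -> : (2^-1 : R) ^+ n = (4 ^+ m)^-1.
        rewrite /n -mul2n exprM -exprVn; congr (_ ^+ _).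
        by rewrite expr2; lra.
      by ring.
    rewrite rpactM rpactC rnormZr ger0_norm ?invr_ge0 ?exprn_ge0//.
    rewrite [leRHS]mulrA [leLHS]mulrC; apply: ler_wpM2r; first by rewrite invr_ge0 exprn_ge0.
    rewrite rpactM; apply: le_trans (rpact_pow_contr _ _ _) _.
      by move=> z; exact: (rpact_pow_contr yc 2).
    apply: le_trans (mean_power_bound m x Tc) _.
    by rewrite ler_piMr// mulr_ge0 ?ler0n.
  have := le_lt_trans h um; rewrite -ltr_pdivlMl// mulrA mulVf ?gt_eqF// => h'.
  by rewrite ltW.
(* By Bernoulli's inequality a norm above [1 - 1/(16n)] would have a [4n]-th
   power of at least 3/4. *)
have n0 : (0 : R) < n%:R by rewrite ltr0n nE expn_gt0.
exists (1 - (16 * n%:R)^-1) => [|x x1].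
  by rewrite ltrBlDr ltrDl invr_gt0 mulr_gt0.
rewrite leNgt; apply/negP => hx; have := main _ x1; apply/negP; rewrite -ltNge.
set d := (16 * n%:R)^-1 in hx.
have d0 : 0 < d by rewrite invr_gt0 mulr_gt0.
have d1 : d <= 1.
  rewrite invf_le1 ?mulr_gt0//; have : 1 <= n%:R :> R by rewrite ler1n nE expn_gt0.
  lra.
apply: (@lt_le_trans _ _ ((1 - d) ^+ (4 * n))); last first.
  by rewrite lerXn2r ?nnegrE ?rnorm_ge0 ?subr_ge0// ltW.
apply: lt_le_trans (bernoulli_ineq _ _); last by rewrite lerN2.
have : (4 * n)%:R * d = 1 / 4.
  by rewrite natrM /d; field; rewrite gt_eqF.
by rewrite mulrN => ->; lra.
Qed.

Lemma rnorm_unit_ball (T : A -> A) N : 0 <= N ->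
  (forall k x, T (k *: x) = k *: T x) ->
  (forall x, rnorm x <= 1 -> rnorm (T x) <= N) ->
  forall x, rnorm (T x) <= N * rnorm x.
Proof.
move=> N0 TZ TN x; have [->|x0] := eqVneq x 0.
  by have := TZ 0 0; rewrite !scale0r => ->; rewrite rnorm0 mulr0.
have nx : 0 < rnorm x by rewrite rnorm_gt0.
have := TN ((rnorm x)^-1%:C *: x); rewrite rnormZr TZ rnormZr.
rewrite ger0_norm ?invr_ge0 ?rnorm_ge0// mulVf ?gt_eqF// => /(_ (lexx _)).
by rewrite -ler_pdivrMr// mulrC.
Qed.

(** The polynomial functional calculus is contractive: if the norm [N] of [p(e)]
    exceeded [M], the polynomial [p / N] would have norm one, although its values
    on [K] stay away from one. *)
Theorem rpact_norm_le e K p M : star e = e -> spec_in e K -> K !=set0 ->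
  0 <= M -> (forall t, K t -> `|p.[t]| <= M) ->
  forall x, rnorm (rpact e p x) <= M * rnorm x.
Proof.
move=> he eK K0 M0 pM; pose S := [set rnorm (rpact e p x) | x in [set x | rnorm x <= 1]].
have [C C0 pC] := rpact_bounded e p.
have Sub : has_ubound S.
  exists C => _ [x /= x1 <-]; apply: le_trans (pC _) _.
  by rewrite ler_piMr// ltW.
have S0 : S !=set0 by exists (rnorm (rpact e p 0)), 0 => //=; rewrite rnorm0.
have NS x : rnorm x <= 1 -> rnorm (rpact e p x) <= sup S.
  by move=> x1; apply: ub_le_sup => //; exists x.
have N0 : 0 <= sup S.
  by have := NS 0; rewrite rnorm0 => /(_ ler01); apply: le_trans; exact: rnorm_ge0.
have pN := rnorm_unit_ball N0 (@rpactZr _ _ e p) NS.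
suff NM : sup S <= M.
  by move=> x; apply: le_trans (pN x) _; rewrite ler_wpM2r ?rnorm_ge0.
rewrite leNgt; apply/negP => MN; set N := sup S in NS N0 pN MN.
have N1 : 0 < N by exact: le_lt_trans MN.
pose y := N^-1 *: p.
have yc z : rnorm (rpact e y z) <= rnorm z.
  rewrite rpactZ rnormZr ger0_norm ?invr_ge0//.
  by rewrite ler_pdivrMl//.
have [|d d1 yd] := contraction_gap he yc.
  apply: (spec_poly he eK K0) => t Kt.
  rewrite hornerD hornerN horner_exp hornerZ -(polyC1 R) hornerC.
  have yt : `|N^-1 * p.[t]| < 1.
    rewrite normrM ger0_norm ?invr_ge0// ltr_pdivrMl// mulr1.
    exact: le_lt_trans (pM _ Kt) MN.
  rewrite subr_eq0 eq_sym; apply/negP => /eqP /(congr1 Num.norm).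
  rewrite normrX normr1 => /eqP; rewrite pexpr_eq1//.
  by move: yt; rewrite lt_neqAle => /andP[/negP].
have d0 : 0 <= d by have := yd 0; rewrite rnorm0 => /(_ ler01); apply: le_trans; exact: rnorm_ge0.
have /(sup_gt S0) [_ [x /= x1 <-]] : N * d < N by rewrite gtr_pMr.
apply/negP; rewrite -leNgt; have := yd _ x1.
by rewrite rpactZ rnormZr ger0_norm ?invr_ge0// ler_pdivrMl.
Qed.

End SpectralTheorem.

(** * Limits in terms of the real norm *)

Section Limits.
Context (R : realType) (A : cstarAlgType R).
Implicit Types (a b c e x z : A) (r s t : R) (X : set A).
Local Open Scope complex_scope.

Lemma closureP X a :
  closure X a <-> forall r, 0 < r -> exists2 b, X b & rnorm (a - b) < r.
Proof.
split=> [Xa r r0|h B /nbhs_normP[r /= r0 aB]].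
  have r0' : (0 : R[i]) < r%:C by rewrite ltcR.
  have [b [Xb]] := Xa _ (nbhsx_ballx a r%:C r0').
  by rewrite -ball_normE /= rnormE ltcR => ab; exists b.
have rE : r = (complex.Re r)%:C.
  by move: r0; rewrite ltcE /= => /andP[/eqP + _]; case: r aB => x y /= _ ->.
have r0' : 0 < complex.Re r by rewrite -ltcR -rE.
have [b Xb ab] := h _ r0'.
by exists b; split => //; apply: aB; rewrite /= rnormE rE ltcR.
Qed.

Lemma closedP X :
  closed X <-> forall a, (forall r, 0 < r -> exists2 b, X b & rnorm (a - b) < r) -> X a.
Proof.
by split=> [cX a /closureP/cX|h a /closureP/h].
Qed.

Lemma closed_limit X a : closed X ->
  (forall r, 0 < r -> exists2 b, X b & rnorm (a - b) < r) -> X a.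
Proof. by move=> /closedP; apply. Qed.

Lemma complete_seq (u : nat -> A) :
  (forall r, 0 < r -> exists N, forall m k, (N <= m)%N -> (N <= k)%N ->
    rnorm (u m - u k) < r) ->
  exists l, forall r, 0 < r -> exists N, forall m, (N <= m)%N -> rnorm (l - u m) < r.
Proof.
move=> uC; have : cvg (u @ \oo).
  apply: cauchy_cvg; apply/cauchy_ballP => r r0.
  have rE : r = (complex.Re r)%:C.
    by move: r0; rewrite ltcE /= => /andP[/eqP + _]; case: r => x y /= ->.
  have r0' : 0 < complex.Re r by rewrite -ltcR -rE.
  have [N uN] := uC _ r0'.
  exists ([set x | exists2 m, (N <= m)%N & u m = x], [set x | exists2 m, (N <= m)%N & u m = x]) => /=.
    by split; exists N => // m /= Nm; exists m.
  case=> _ _ /= [[m Nm <-] [k Nk <-]].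
  by rewrite -ball_normE /= rnormE rE ltcR uN.
move=> /cvgrPdist_lt ul; exists (lim (u @ \oo)) => r r0.
have r0' : (0 : R[i]) < r%:C by rewrite ltcR.
have [N _ h] := ul _ r0'; exists N => m Nm.
by have := h m Nm; rewrite /= rnormE ltcR.
Qed.

Lemma geometric_seq (u : nat -> A) C q : 0 <= C -> 0 <= q < 1 ->
  (forall n, rnorm (u n.+1 - u n) <= C * q ^+ n) ->
  exists l, forall r, 0 < r -> exists N, forall m, (N <= m)%N -> rnorm (l - u m) < r.
Proof.
move=> C0 /andP[q0 q1] uq; apply: complete_seq => r r0.
have q1' : 0 < 1 - q by lra.
have tail N k : rnorm (u (N + k)%N - u N) <= C * q ^+ N / (1 - q).
  have : rnorm (u (N + k)%N - u N) <= C * q ^+ N * (1 - q ^+ k) / (1 - q).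
    elim: k => [|k IH]; first by rewrite addn0 subrr rnorm0 expr0 subrr mulr0 mul0r.
    rewrite -(subrKA (u (N + k)%N)) addnS; apply: le_trans (rnormD _ _) _.
    apply: (le_trans (lerD (uq _) IH)).
    rewrite -lerBrDr -mulrBl -mulrBr exprD.
    have -> : 1 - q ^+ k.+1 - (1 - q ^+ k) = q ^+ k * (1 - q) by rewrite exprS; ring.
    by rewrite !mulrA mulfK ?gt_eqF.
  move=> /le_trans; apply; rewrite ler_pdivrMr// divfK ?gt_eqF//.
  rewrite ler_piMr ?mulr_ge0 ?exprn_ge0//.
  by rewrite gerBl exprn_ge0.
have [N hN] : exists N, C * q ^+ N / (1 - q) < r / 2.
  have e0 : 0 < r / 2 * (1 - q) / (C + 1).
    by rewrite divr_gt0 ?mulr_gt0 ?divr_gt0// ltr_pwDr.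
  have [N qN] := small_pow q0 q1 e0; exists N.
  rewrite ltr_pdivrMr//; move: qN; rewrite ltr_pdivlMr ?ltr_pwDr// => qN.
  apply: le_lt_trans qN; rewrite mulrC ler_wpM2l ?exprn_ge0//.
  by rewrite lerDl.
exists N => m k Nm Nk.
have h j : (N <= j)%N -> rnorm (u j - u N) < r / 2.
  by move=> Nj; rewrite -(subnKC Nj); apply: le_lt_trans (tail _ _) hN.
rewrite -(subrKA (u N)) [ltRHS]splitr; apply: le_lt_trans (rnormD _ _) _.
by rewrite ltrD ?h// rnormB h.
Qed.

End Limits.

(** * Homomorphisms are contractive *)

Section StarHom.
Context (R : realType) (A B : cstarAlgType R) (S : set A) (f : A -> B).
Hypothesis hf : star_hom S f.
Implicit Types (a b c d e x z : A) (r s t : R).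
Local Open Scope complex_scope.

Lemma subspaceD (T : set A) a b : linear_subspace T -> T a -> T b -> T (a + b).
Proof. by move=> hT Ta Tb; have := subspaceP hT 1 Ta Tb; rewrite scale1r. Qed.

Lemma subspaceZ (T : set A) k a : linear_subspace T -> T a -> T (k *: a).
Proof.
by move=> hT Ta; have := subspaceP hT k Ta (subspace0 hT); rewrite addr0.
Qed.

Lemma subspaceN (T : set A) a : linear_subspace T -> T a -> T (- a).
Proof. by move=> hT Ta; rewrite -scaleN1r; exact: subspaceZ. Qed.

Lemma subspaceB (T : set A) a b : linear_subspace T -> T a -> T b -> T (a - b).
Proof. by move=> hT Ta Tb; apply: subspaceD => //; exact: subspaceN. Qed.

Lemma subspace_sum_in (T : set A) (I : eqType) (r : seq I) (F : I -> A) :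
  linear_subspace T -> (forall i, i \in r -> T (F i)) -> T (\sum_(i <- r) F i).
Proof.
move=> hT; elim: r => [|i r IH] h; first by rewrite big_nil; exact: subspace0.
rewrite big_cons; apply: subspaceD => //; first by apply: h; rewrite mem_head.
by apply: IH => j jr; apply: h; rewrite in_cons jr orbT.
Qed.

Let S0 := starsub_subspace (star_hom_dom hf).

Lemma star_hom0 : f 0 = 0.
Proof.
have := star_homP hf 1 (subspace0 S0) (subspace0 S0).
by rewrite !scale1r addr0 => h; apply: (addrI (f 0)); rewrite addr0 -h.
Qed.

Lemma star_homD a b : S a -> S b -> f (a + b) = f a + f b.
Proof. by move=> Sa Sb; have := star_homP hf 1 Sa Sb; rewrite !scale1r. Qed.

Lemma star_homZ k a : S a -> f (k *: a) = k *: f a.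
Proof.
by move=> Sa; have := star_homP hf k Sa (subspace0 S0); rewrite star_hom0 !addr0.
Qed.

Lemma star_homN a : S a -> f (- a) = - f a.
Proof. by move=> Sa; rewrite -scaleN1r star_homZ// scaleN1r. Qed.

Lemma star_homB a b : S a -> S b -> f (a - b) = f a - f b.
Proof. by move=> Sa Sb; rewrite star_homD ?star_homN//; exact: subspaceN. Qed.

(** The Neumann series, written without a unit: [s] is [(1 - d)^-1 - 1]. *)
Lemma quasi_inverse d : closed S -> S d -> rnorm d < 1 ->
  exists2 s, S s & s = d + s ** d.
Proof.
move=> cS Sd d1; pose u := fix u n := if n is n.+1 then d + u n ** d else 0.
have Su n : S (u n).
  elim: n => [|n IH]; first exact: subspace0.
  by apply: subspaceD => //; exact: (starsub_mul (star_hom_dom hf)).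
have [|n|l ul] := @geometric_seq R A u (rnorm d) (rnorm d) (rnorm_ge0 d).
- by rewrite rnorm_ge0.
- rewrite -exprS; elim: n => [|n IH].
    by rewrite /= cmul0l addr0 subr0 expr1.
  rewrite [X in rnorm (X - _)]/= [X in rnorm (_ - X)]/= opprD addrACA subrr add0r.
  by rewrite -cmulBl exprSr; apply: le_rnormM.
exists l.
  apply: (closed_limit cS) => r r0; have [N hN] := ul r r0.
  by exists (u N) => //; exact: hN.
apply/eqP; rewrite -subr_eq0; apply/eqP/rnorm_le0 => r r0.
have r20 : 0 < r / 2 by rewrite divr_gt0.
have [N hN] := ul _ r20.
have -> : l - (d + l ** d) = (l - u N.+1) - (l - u N) ** d.
  by rewrite /= cmulBl opprB !opprD !addrA subrK.
apply: le_trans (rnorm_subr_le _ _) _; rewrite [leRHS]splitr.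
apply: lerD; first by rewrite ltW// hN.
rewrite -[leRHS]mulr1; apply: le_rnormM; last exact: ltW.
by rewrite ltW// hN.
Qed.

(** With [c = a^* a], every [c - t] with [|t| > |c|] has an inverse, which [f]
    carries to one of [f c - t]; so the spectrum of [f c] lies within the norm
    of [c]. *)
Theorem star_hom_contractive a : closed S -> S a -> rnorm (f a) <= rnorm a.
Proof.
move=> cS Sa; have [SS Sm Sst] := star_hom_dom hf.
pose c := star a ** a; pose y := f c.
have Sc : S c by apply: Sm => //; exact: Sst.
have yE : y = star (f a) ** f a by rewrite /y (star_homM hf) ?(star_homS hf)//; exact: Sst.
have ys : star y = y by rewrite yE starM starK.
have yspec : spec_in y [set t | - rnorm c <= t <= rnorm c].
  move=> t /negP; rewrite -ler_norml -ltNge => ct.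
  have t0 : t != 0 by rewrite -normr_gt0; apply: le_lt_trans ct; exact: rnorm_ge0.
  pose d := t^-1%:C *: c.
  have d1 : rnorm d < 1.
    by rewrite rnormZr normfV ltr_pdivrMl ?normr_gt0// mulr1.
  have Sd : S d by exact: subspaceZ.
  have [s Ss sE] := quasi_inverse cS Sd d1.
  have fs : f s = f d + f s ** f d.
    by rewrite {1}sE star_homD ?(star_homM hf)//; exact: Sm.
  have s1 : 0 < 1 + rnorm (f s) by rewrite ltr_pwDl ?rnorm_ge0.
  exists (`|t| / (1 + rnorm (f s))) => [|x].
    by rewrite divr_gt0 ?normr_gt0.
  have -> : y ** x - t%:C *: x = - (t%:C *: (x - f d ** x)).
    rewrite scalerBr opprB star_homZ// cmulZl scalerA -rmorphM mulfV//.
    by rewrite scale1r.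
  rewrite rnormN rnormZr -mulrA ler_wpM2l// ler_pdivrMl//.
  have {1}-> : x = (x - f d ** x) + f s ** (x - f d ** x).
    have e : f s ** x = f d ** x + (f s ** f d) ** x by rewrite -cmulDl -fs.
    by rewrite cmulBr cmulA e addrK subrK.
  by rewrite mulrDl mul1r; apply: le_trans (rnormD _ _) _; rewrite lerD2l rnormM_le.
have K0 : [set t | - rnorm c <= t <= rnorm c] !=set0.
  by exists 0; rewrite /= oppr_le0 rnorm_ge0.
have := rpact_norm_le (p := 'X) ys yspec K0 (rnorm_ge0 c) _ y.
rewrite rpactX -{1}ys rnorm_cstar => h.
have {}h : rnorm y <= rnorm c.
  have [->|y0] := eqVneq y 0; first by rewrite rnorm0 rnorm_ge0.
  rewrite -(@ler_pM2r _ (rnorm y)) ?rnorm_gt0// -expr2; apply: h => t /=.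
  by rewrite hornerX -ler_norml.
move: h; rewrite yE /c !rnorm_cstar ler_pXn2r ?nnegrE ?rnorm_ge0//.
Qed.

End StarHom.

(** * Positivity *)

Section Positivity.
Context (R : realType) (A : cstarAlgType R).
Implicit Types (a b c e x y z : A) (r s t m : R) (K : set R) (L : A -> A).
Local Open Scope complex_scope.

(** For a self-adjoint [L] this says that the spectrum of [L] is bounded below
    by [m]; expressed by a norm estimate, it is stable under sums. *)
Definition op_ge m L :=
  exists2 T : R, 0 <= T & forall x, rnorm (T%:C *: x - L x) <= (T - m) * rnorm x.

Lemma op_geD m m' L L' : op_ge m L -> op_ge m' L' ->
  op_ge (m + m') (fun x => L x + L' x).
Proof.
move=> [T T0 hT] [U U0 hU]; exists (T + U); first exact: addr_ge0.
move=> x; rewrite rmorphD scalerDl opprD addrACA.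
apply: le_trans (rnormD _ _) _; apply: le_trans (lerD (hT x) (hU x)) _.
by rewrite -mulrDl opprD addrACA.
Qed.

Lemma op_geZ m r L : 0 <= r -> op_ge m L -> op_ge (r * m) (fun x => r%:C *: L x).
Proof.
move=> r0 [T T0 hT]; exists (r * T); first exact: mulr_ge0.
move=> x; rewrite rmorphM -scalerA -scalerBr rnormZr ger0_norm// -mulrBr -mulrA.
by rewrite ler_wpM2l.
Qed.

Lemma eq_op_ge m L L' : L =1 L' -> op_ge m L -> op_ge m L'.
Proof. by move=> LL' [T T0 hT]; exists T => // x; rewrite -LL'. Qed.

Lemma op_ge_bound m L s x : op_ge m L ->
  (s + m) * rnorm x <= rnorm (s%:C *: x + L x).
Proof.
move=> [T _ hT]; have -> : s%:C *: x + L x = (s + T)%:C *: x - (T%:C *: x - L x).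
  by rewrite rmorphD scalerDl opprB addrA addrAC addrK.
have h := rnorm_lerB ((s + T)%:C *: x) (- (T%:C *: x - L x)).
apply: le_trans h; rewrite rnormN lerBrDr.
apply: le_trans (lerD (lexx _) (hT x)) _; rewrite -mulrDl rnormZr.
by rewrite ler_wpM2r ?rnorm_ge0// (le_trans _ (ler_norm _))//; lra.
Qed.

Lemma op_ge_poly e K p m M : star e = e -> spec_in e K -> K !=set0 ->
  (forall t, K t -> m <= p.[t] <= M) -> op_ge m (rpact e p).
Proof.
move=> he eK K0 pK; have [t0 Kt0] := K0; have /andP[m0 M0] := pK _ Kt0.
have MM : M <= `|M| := ler_norm _.
exists `|M| => // x; rewrite -(rpactC e) -rpactB.
apply: (rpact_norm_le he eK K0) => [|t /pK /andP[mp pM]]; first lra.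
rewrite hornerD hornerN hornerC ger0_norm; lra.
Qed.

Lemma op_ge_square e : star e = e -> op_ge 0 (fun x => e ** (e ** x)).
Proof.
move=> he; apply: (@eq_op_ge 0 (rpact e ('X ^+ 2))) => [x|].
  by rewrite expr2 rpactM !rpactX.
apply: (op_ge_poly (M := rnorm e ^+ 2) he (@spec_ball _ _ e)).
  by exists 0; rewrite /= oppr_le0 rnorm_ge0.
move=> t /= h; rewrite hornerXn sqr_ge0 -real_normK ?num_real//=.
by rewrite lerXn2r ?nnegrE ?rnorm_ge0// ler_norml.
Qed.

(** The spectrum of [x^* x] is nonnegative. For [c = x^* x] of norm at most [r]
    and [p(t) = (1 - t/r)^k], put [v = p(c) x^*]. Then [v v^* = c p(c)^2] is at
    most [r], while [v v^* + v^* v] is a sum of squares of self-adjoint elements,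
    so [v^* v >= - r]. The spectra of [v^* v] and [v v^*] agree off zero, hence
    [c p(c)^2 >= - r], which for large [k] excludes a given negative [t] from the
    spectrum of [c], as [t p(t)^2] tends to minus infinity. *)
Theorem spec_star_mul x : spec_in (star x ** x) [set t | 0 <= t].
Proof.
set c := star x ** x; have cs : star c = c by rewrite starM starK.
apply: spec_inP => t /negP; rewrite -ltNge => t0.
(* The summand one keeps [r] positive when [c] is zero. *)
pose r := rnorm c + 1; have r0 : 0 < r by rewrite ltr_pwDr ?rnorm_ge0.
have cr : rnorm c <= r by rewrite lerDl.
pose q := 1 - t / r; have q1 : 1 < q.
  by rewrite ltrBrDr gtrDl pmulr_llt0 ?invr_gt0.
have q0 : 0 < q by exact: lt_trans q1.
have [k hk] : exists k : nat, r < - t * q ^+ (2 * k).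
  have i0 : 0 <= (q ^+ 2)^-1 by rewrite invr_ge0 exprn_ge0// ltW.
  have i1 : (q ^+ 2)^-1 < 1.
    by rewrite invf_lt1 ?exprn_gt0// exprn_egt1.
  have d0 : 0 < - t / r by rewrite divr_gt0// oppr_gt0.
  have [k hk] := small_pow i0 i1 d0; exists k; move: hk.
  have Q : 0 < q ^+ (2 * k) by exact: exprn_gt0.
  by rewrite exprVn -exprM -div1r ltr_pdivrMr// mulrAC ltr_pdivlMr// mul1r.
pose p : {poly R} := (1 - r^-1 *: 'X) ^+ k.
pose v := rpact c p (star x).
have vvE z : v ** (star v ** z) = rpact c (p ^+ 2 * 'X) z.
  have h : star x ** (star v ** z) = rpact c p (c ** z).
    by rewrite cmulA -starM /v -rpact_mulr rpact_self// rpact_mulr.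
  by rewrite /v -rpact_mulr h -rpactX -!rpactM expr2.
(* Up to factors, [h] and [g] are the real and the imaginary part of [v]; the
   mixed terms cancel in [h^2 + g^2 = 2 (v v^* + v^* v)]. *)
pose h := v + star v; pose g := 'i%R *: (v - star v).
have hs : star h = h by rewrite starD starK addrC.
have gs : star g = g.
  by rewrite starZ conj_imag starB starK scaleNr -scalerN opprB.
have hgE z : star v ** (v ** z) =
    (2^-1)%:C *: (h ** (h ** z) + g ** (g ** z)) - v ** (star v ** z).
  apply/(canRL (addrK _)).
  have -> : h ** (h ** z) + g ** (g ** z) =
      (2 : R)%:C *: (star v ** (v ** z) + v ** (star v ** z)).
    rewrite /h /g !cmulZl !cmulZr scalerA -expr2 sqrCi scaleN1r.
    rewrite !cmulDl !cmulDr !cmulNl !cmulNr !opprD !opprK.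
    set a1 := v ** (v ** z); set a2 := v ** (star v ** z).
    set a3 := star v ** (v ** z); set a4 := star v ** (star v ** z).
    rewrite rmorph_nat scaler_nat mulr2n.
    rewrite addrACA [X in X + _]addrACA [X in _ + X]addrACA !subrr add0r addr0.
    by rewrite addrC addrACA.
  by rewrite scalerA -rmorphM mulVf ?scale1r.
have vv : op_ge (- r) (fun z => star v ** (v ** z)).
  apply: (@eq_op_ge _ (fun z => (2^-1)%:C *: (h ** (h ** z) + g ** (g ** z)) +
      rpact c (- (p ^+ 2 * 'X)) z)) => [z|].
    by rewrite hgE rpactN -vvE.
  rewrite -[- r]add0r; apply: op_geD.
    rewrite -(mulr0 2^-1); apply: op_geZ => //; rewrite -[0]addr0.
    by apply: op_geD; apply: op_ge_square.
  have K0 : [set s | - r <= s <= r] !=set0 by exists 0; rewrite /= oppr_le0 ltW.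
  apply: (op_ge_poly (M := r * 2 ^+ (2 * k)) cs (spec_norm cr) K0) => s /= /andP[rs sr].
  rewrite hornerN hornerM hornerX /p -exprM mulnC horner_exp hornerD hornerN.
  rewrite -(polyC1 R) hornerC hornerZ hornerX mulrC.
  set w := 1 - r^-1 * s.
  have w2 : w <= 2 by rewrite /w lerBlDr -lerBlDl ler_pdivlMl//; lra.
  have w0 : 0 <= w by rewrite subr_ge0 ler_pdivrMl// mulr1.
  have wk : 0 <= w ^+ (2 * k) by exact: exprn_ge0.
  have wk2 : w ^+ (2 * k) <= 2 ^+ (2 * k) by rewrite lerXn2r ?nnegrE.
  apply/andP; split; last first.
    rewrite -mulNr; apply: (@le_trans _ _ (r * w ^+ (2 * k))).
      by rewrite ler_wpM2r//; lra.
    by rewrite ler_wpM2l// ltW.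
  rewrite lerN2; have [s0|s0] := leP 0 s.
    have w1 : w <= 1 by rewrite gerBl mulr_ge0// invr_ge0 ltW.
    by apply: le_trans sr; rewrite ler_piMr// exprn_ile1.
  apply: le_trans (ltW r0); by rewrite mulr_le0_ge0// ltW.
(* [- s] is the value of [X p^2] at [t], so that [s + X p^2] has the root [t]. *)
pose s := - t * q ^+ (2 * k).
have sr : 0 < s - r by rewrite subr_gt0.
have bb : bounded_below (rpact c (s%:P + p ^+ 2 * 'X)).
  pose M := 1 + rnorm v * (rnorm v / (s - r)).
  have M0 : 0 < M by rewrite ltr_pwDl// mulr_ge0 ?divr_ge0 ?rnorm_ge0// ltW.
  have s0 : 0 < s by lra.
  exists (s / M) => [|z]; first exact: divr_gt0.
  rewrite mulrAC ler_pdivrMr// rpactD rpactC -vvE; set y := _ + _.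
  (* [v^* y = (s + v^* v) v^* z], where [s + v^* v] is at least [s - r]. *)
  have h1 : rnorm (star v ** z) <= rnorm v / (s - r) * rnorm y.
    rewrite mulrAC ler_pdivlMr// mulrC -{1}[s - r]/(s + - r).
    apply: le_trans (op_ge_bound _ _ vv) _.
    have -> : s%:C *: (star v ** z) + star v ** (v ** (star v ** z)) = star v ** y.
      by rewrite cmulDr cmulZr.
    by rewrite -{1}(rnorm_star v) rnormM_le.
  have -> : s * rnorm z = rnorm (y - v ** (star v ** z)).
    by rewrite addrK rnormZr gtr0_norm.
  apply: le_trans (rnorm_subr_le _ _) _; rewrite mulrC mulrDl mul1r lerD2l.
  by apply: le_trans (rnormM_le _ _) _; rewrite -mulrA ler_wpM2l ?rnorm_ge0.
have /factor_theorem[u uE] : root (s%:P + p ^+ 2 * 'X) t.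
  rewrite /root hornerD hornerC hornerM hornerX /p -exprM mulnC horner_exp.
  rewrite hornerD hornerN -(polyC1 R) hornerC hornerZ hornerX [r^-1 * t]mulrC.
  by rewrite -/q /s mulNr mulrC addNr.
by apply: (bounded_below_factor (p := u)); rewrite -uE.
Qed.

End Positivity.

Section NormEstimates.
Context (R : realType) (A : cstarAlgType R).
Implicit Types (a b c e x y z : A) (r s t : R).
Local Open Scope complex_scope.

Lemma op_ge_star_mul x : op_ge 0 (cmul (star x ** x)).
Proof.
set c := star x ** x; have cs : star c = c by rewrite starM starK.
apply: (@eq_op_ge _ _ 0 (rpact c 'X)) => [z|]; first exact: rpactX.
have ck := spec_inI (@spec_star_mul _ _ x) (@spec_ball _ _ c).
apply: (op_ge_poly (M := rnorm c) cs ck).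
  by exists 0; rewrite /= oppr_le0 rnorm_ge0 lexx.
by move=> t [/= t0 /andP[_ tc]]; rewrite hornerX t0.
Qed.

Lemma op_ge_sum_star_mul (I : Type) (r : seq I) (F : I -> A) :
  op_ge 0 (cmul (\sum_(i <- r) star (F i) ** F i)).
Proof.
elim: r => [|i r IH].
  by exists 0 => // x; rewrite big_nil scale0r cmul0l subrr rnorm0 subrr mul0r.
rewrite -[0]addr0; apply: eq_op_ge (op_geD (@op_ge_star_mul (F i)) IH) => x.
by rewrite big_cons cmulDl.
Qed.

(** The norm is monotone on sums of elements [y^* y]: if [m = y^* y + q] with
    [q >= 0], no [t > |m|] is in the spectrum of [y^* y]. *)
Theorem rnorm_sq_le_sum (I : Type) (r : seq I) (F : I -> A) y :
  rnorm y ^+ 2 <= rnorm (star y ** y + \sum_(i <- r) star (F i) ** F i).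
Proof.
rewrite -rnorm_cstar; set p := star y ** y; set q := \sum_(i <- r) _; set n := rnorm (p + q).
have ps : star p = p by rewrite starM starK.
have pn : spec_in p [set t | t <= n].
  move=> t /negP; rewrite -ltNge => nt; exists (t - n); first by rewrite subr_gt0.
  move=> x; have h := op_ge_bound t x (op_ge_sum_star_mul r F).
  have -> : p ** x - t%:C *: x = - ((t%:C *: x + q ** x) - (p + q) ** x).
    by rewrite cmulDl opprB opprD addrACA addrC addrA subrr add0r.
  rewrite rnormN; apply: le_trans (rnorm_lerB _ _); rewrite rnormN mulrBl.
  by rewrite addr0 in h; apply: lerB => //; exact: rnormM_le.
have K0 : [set t : R | 0 <= t] `&` [set t | t <= n] !=set0.
  by exists 0; split => /=; rewrite ?lexx// rnorm_ge0.
have := rpact_norm_le (p := 'X) ps (spec_inI (@spec_star_mul _ _ y) pn) K0 (rnorm_ge0 _) _ p.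
rewrite rpactX -{1}ps rnorm_cstar => h.
have [->|p0] := eqVneq p 0; first by rewrite rnorm0 rnorm_ge0.
rewrite -(@ler_pM2r _ (rnorm p)) ?rnorm_gt0// -expr2; apply: h => t [/= t0 tn].
by rewrite hornerX ger0_norm.
Qed.

Lemma root_le (N x M : R) : 0 <= N -> 0 <= x -> 0 <= M ->
  (forall k, x ^+ (2 ^ k) <= N * M ^+ (2 ^ k)) -> x <= M.
Proof.
move=> N0 x0 M0 h; rewrite leNgt; apply/negP => Mx.
have xp : 0 < x by exact: le_lt_trans Mx.
have q0 : 0 <= M / x by rewrite divr_ge0.
have q1 : M / x < 1 by rewrite ltr_pdivrMr// mul1r.
have e0 : 0 < (N + 1)^-1 by rewrite invr_gt0 ltr_pwDr.
have [k hk] := small_pow q0 q1 e0.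
have {}hk : (M / x) ^+ (2 ^ k) < (N + 1)^-1.
  have k2 : (k <= 2 ^ k)%N by apply: ltnW; exact: ltn_expl.
  exact: le_lt_trans (ler_wiXn2l q0 (ltW q1) k2) hk.
have := h k; apply/negP; rewrite -ltNge.
move: hk; rewrite expr_div_n ltr_pdivrMr ?exprn_gt0// mulrC ltr_pdivlMr ?ltr_pwDr//.
by apply: le_lt_trans; rewrite mulrC ler_wpM2l ?exprn_ge0// lerDl.
Qed.

(** Norms of powers of a self-adjoint element multiply, and a power of an
    orthogonal sum is the sum of the powers; so the number of terms disappears in
    the limit of large powers. *)
Lemma rnorm_orth_selfadj (I : eqType) (r : seq I) (F : I -> A) M :
  uniq r -> 0 <= M -> (forall i, i \in r -> star (F i) = F i) ->
  (forall i j, i \in r -> j \in r -> i != j -> F i ** F j = 0) ->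
  (forall i, i \in r -> rnorm (F i) <= M) -> rnorm (\sum_(i <- r) F i) <= M.
Proof.
move=> ur M0 Fs Fo FM; pose sq (a : A) := a ** a.
have sqs k a : star a = a -> star (iter k sq a) = iter k sq a.
  by move=> sa; elim: k => //= k IH; rewrite /sq starM IH.
have sqn k a : star a = a -> rnorm (iter k sq a) = rnorm a ^+ (2 ^ k).
  move=> sa; elim: k => [|k IH]; first by rewrite expr1.
  by rewrite iterS /sq -{1}(sqs k a sa) rnorm_cstar IH -exprM expnSr.
have sq0 k i j : i \in r -> j \in r -> i != j -> iter k sq (F i) ** iter k sq (F j) = 0.
  move=> ir jr ij; elim: k => /= [|k IH]; first exact: Fo.
  by rewrite /sq -cmulA [X in _ ** X]cmulA IH cmul0l cmul0r.
have sqS k : iter k sq (\sum_(i <- r) F i) = \sum_(i <- r) iter k sq (F i).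
  elim: k => //= k ->; rewrite /sq cmul_suml.
  apply: eq_big_seq => i ir; rewrite cmul_sumr (bigD1_seq i)//= big_seq_cond.
  rewrite big1 ?addr0// => j /andP[jr ji]; rewrite sq0//.
  by rewrite eq_sym.
have Ss : star (\sum_(i <- r) F i) = \sum_(i <- r) F i.
  by rewrite star_sum; apply: eq_big_seq.
apply: (@root_le (size r)%:R) => //; first exact: rnorm_ge0.
move=> k; rewrite -sqn// sqS; apply: le_trans (rnorm_sum _ _ _) _.
have -> : (size r)%:R * M ^+ (2 ^ k) = \sum_(i <- r) M ^+ (2 ^ k).
  by rewrite big_const_seq count_predT iter_addr_0 mulr_natl.
rewrite big_seq [leRHS]big_seq; apply: ler_sum => i ir.
by rewrite sqn ?Fs// lerXn2r ?nnegrE ?rnorm_ge0// FM.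
Qed.

(** The general case follows with the orthogonal positive elements [a_i^* a_i]. *)
Lemma rnorm_orth_le (I : eqType) (r : seq I) (F : I -> A) M :
  uniq r -> 0 <= M ->
  (forall i j, i \in r -> j \in r -> i != j -> star (F i) ** F j = 0) ->
  (forall i j, i \in r -> j \in r -> i != j -> F i ** star (F j) = 0) ->
  (forall i, i \in r -> rnorm (F i) <= M) -> rnorm (\sum_(i <- r) F i) <= M.
Proof.
move=> ur M0 Fo Fo' FM.
rewrite -(@ler_pXn2r _ 2) ?nnegrE ?rnorm_ge0// -rnorm_cstar.
have -> : star (\sum_(i <- r) F i) ** (\sum_(i <- r) F i) =
    \sum_(i <- r) star (F i) ** F i.
  rewrite star_sum cmul_suml.
  apply: eq_big_seq => i ir; rewrite cmul_sumr (bigD1_seq i)//= big_seq_cond.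
  by rewrite big1 ?addr0// => j /andP[jr ji]; rewrite Fo// eq_sym.
apply: rnorm_orth_selfadj => // [|i _|i j ir jr ij|i ir].
- exact: exprn_ge0.
- by rewrite starM starK.
- by rewrite -cmulA [X in _ ** X]cmulA Fo'// cmul0l cmul0r.
- by rewrite rnorm_cstar lerXn2r ?nnegrE ?rnorm_ge0// FM.
Qed.

End NormEstimates.

(** * Ideals and partial actions *)

Section Ideals.
Context (R : realType) (A : cstarAlgType R) (S : set A).
Implicit Types (I J : set A).

Lemma closed_idealI I J : closed_ideal S I -> closed_ideal S J ->
  closed_ideal S (I `&` J).
Proof.
move=> [IS Ic [I0 IP] Il Ir] [JS Jc [J0 JP] Jl Jr]; split.
- by move=> a [/IS].
- exact: closedI.
- split=> [//|c a b [Ia Ja] [Ib Jb]]; split; [exact: IP | exact: JP].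
- by move=> a b Sa [Ib Jb]; split; [exact: Il | exact: Jl].
- by move=> a b [Ia Ja] Sb; split; [exact: Ir | exact: Jr].
Qed.

Lemma cmul_idealI I J a b : closed_ideal S I -> closed_ideal S J ->
  I a -> J b -> (I `&` J) (a ** b).
Proof.
move=> hI hJ Ia Jb; split; last exact: (ideal_mull hJ (ideal_sub hI Ia)).
exact: (ideal_mulr hI Ia (ideal_sub hJ Jb)).
Qed.

End Ideals.

Section LinearSpan.
Context (R : realType) (A : cstarAlgType R).
Implicit Types (X Y : set A).

Lemma lspan_min X Y : linear_subspace Y -> X `<=` Y -> lspan X `<=` Y.
Proof.
move=> hY XY _ [s sX ->]; apply: subspace_sum_in => // p /sX /XY.
exact: subspaceZ.
Qed.

Lemma sub_lspan X : X `<=` lspan X.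
Proof.
move=> a Xa; exists [:: (1, a)]; first by move=> p; rewrite inE => /eqP ->.
by rewrite big_seq1 scale1r.
Qed.

Lemma lspan_subspace X : linear_subspace (lspan X).
Proof.
split; first by exists [::]; rewrite ?big_nil.
move=> c _ _ [s sX ->] [s' s'X ->].
exists ([seq (c * p.1, p.2) | p <- s] ++ s').
  by move=> p; rewrite mem_cat => /orP[/mapP[q /sX Xq ->]|/s'X].
rewrite big_cat big_map scaler_sumr; congr (_ + _).
by apply: eq_bigr => p _; rewrite scalerA.
Qed.

End LinearSpan.

Section Translates.
Context (G : groupType).
Implicit Types (g h : G) (tau sigma : {fset G}).

Lemma in_translate g h tau : (h \in translate g tau) = ((g^-1 * h)%g \in tau).
Proof.
apply/imfsetP/idP => [[k /= kt ->]|ht]; first by rewrite mulKg.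
by exists (g^-1 * h)%g => //=; rewrite mulVKg.
Qed.

Lemma translateM g h tau : translate g (translate h tau) = translate (g * h)%g tau.
Proof. by apply/fsetP => k; rewrite !in_translate invgM mulgA. Qed.

Lemma translate1 tau : translate 1%g tau = tau.
Proof. by apply/fsetP => k; rewrite in_translate invg1 mul1g. Qed.

Lemma translateK g tau : translate g^-1%g (translate g tau) = tau.
Proof. by rewrite translateM mulVg translate1. Qed.

Lemma translateVK g tau : translate g (translate g^-1%g tau) = tau.
Proof. by rewrite translateM mulgV translate1. Qed.

Lemma card_translate g tau : #|` translate g tau| = #|` tau|.
Proof. by rewrite card_imfset//; exact: mulgI. Qed.

Lemma one_in_translate g tau : (1%g \in translate g^-1%g tau) = (g \in tau).
Proof. by rewrite in_translate invgK mulg1. Qed.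

End Translates.

Section PartialActions.
Context (R : realType) (G : groupType) (A : cstarAlgType R).
Context (S : set A) (alpha : pact_data G A) (pa : is_partial_action S alpha).
Implicit Types (g h k : G) (a b c : A) (tau sigma : {fset G}).
Local Open Scope complex_scope.

Lemma act_hom g : star_hom (dom alpha g^-1%g) (act alpha g).
Proof. by have [] := pact_iso pa g. Qed.

Lemma act_homV g : star_hom (dom alpha g) (act alpha g^-1%g).
Proof. by have := act_hom g^-1%g; rewrite invgK. Qed.

Lemma dom_subspace g : linear_subspace (dom alpha g).
Proof. exact: ideal_subspace (pact_ideal pa g). Qed.

Lemma act_dom g a : dom alpha g^-1%g a -> dom alpha g (act alpha g a).
Proof. by move=> ga; have [_ [h _ _]] := pact_iso pa g; exact: h. Qed.

Lemma act_domV g a : dom alpha g a -> dom alpha g^-1%g (act alpha g^-1%g a).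
Proof. by move=> ga; apply: act_dom; rewrite invgK. Qed.

Lemma dom_S g a : dom alpha g a -> S a.
Proof. exact: (ideal_sub (pact_ideal pa g)). Qed.

Lemma act0 g : act alpha g 0 = 0.
Proof. exact: star_hom0 (act_hom g). Qed.

Lemma actK g a : dom alpha g^-1%g a -> act alpha g^-1%g (act alpha g a) = a.
Proof.
move=> ga; have [|_] := pact_extends pa (g := g^-1%g) ga.
  by rewrite invgK; exact: act_dom.
by rewrite mulVg => <-; apply: (pact_act1 pa); exact: dom_S ga.
Qed.

Lemma actVK g a : dom alpha g a -> act alpha g (act alpha g^-1%g a) = a.
Proof. by move=> ga; rewrite -{1}(invgK g) actK// invgK. Qed.

Lemma act_inter g h a : dom alpha g^-1%g a -> dom alpha h a ->
  dom alpha (g * h)%g (act alpha g a).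
Proof.
move=> ga ha; have [] := pact_extends pa (g := g) (act_domV ha).
  by rewrite actVK.
by rewrite actVK// => /act_dom + e; rewrite e.
Qed.

Lemma actM g h a : dom alpha h^-1%g a -> dom alpha (g * h)^-1%g a ->
  act alpha (g * h)%g a = act alpha g (act alpha h a).
Proof.
move=> ha gha; have [//|//] := pact_extends pa (g := g) ha.
by have := act_inter ha gha; rewrite invgM mulVKg.
Qed.

Lemma dom_closed g : closed (dom alpha g).
Proof. exact: ideal_closed (pact_ideal pa g). Qed.

Lemma rnorm_act g a : dom alpha g^-1%g a -> rnorm (act alpha g a) = rnorm a.
Proof.
move=> ga; apply/le_anti/andP; split.
  by apply: (star_hom_contractive (act_hom g)) => //; exact: dom_closed.
rewrite -{1}(actK ga); apply: (star_hom_contractive (act_homV g)).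
  exact: dom_closed.
exact: act_dom.
Qed.

Lemma idom_dom g tau a : g \in tau -> idom alpha tau a -> dom alpha g a.
Proof. by move=> gt; apply. Qed.

Lemma idom_ideal g tau : g \in tau -> closed_ideal S (idom alpha tau).
Proof.
move=> gt; split.
- by move=> a /(idom_dom gt)/dom_S.
- by apply: closed_bigI => h _; exact: dom_closed.
- split=> [h _|c a b ta tb h ht]; first exact: subspace0 (dom_subspace h).
  by apply: (subspaceP (dom_subspace h)); [exact: ta | exact: tb].
- by move=> a b Sa tb h ht; apply: (ideal_mull (pact_ideal pa h)) => //; exact: tb.
- by move=> a b ta Sb h ht; apply: (ideal_mulr (pact_ideal pa h)) => //; exact: ta.
Qed.

Lemma act_idom g tau a : g^-1%g \in tau -> idom alpha tau a ->
  idom alpha (translate g tau) (act alpha g a).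
Proof.
move=> gt ta h /=; rewrite in_translate => ht.
by rewrite -(mulVKg g h); apply: act_inter; exact: ta.
Qed.

Lemma act_idomV g tau a : g \in tau -> idom alpha tau a ->
  idom alpha (translate g^-1%g tau) (act alpha g^-1%g a).
Proof. by move=> gt; apply: act_idom; rewrite invgK. Qed.

Lemma S_mul a b : S a -> S b -> S (a ** b).
Proof. by have [[_ h _] _] := pact_algebra pa; exact: h. Qed.

Lemma S_star a : S a -> S (star a).
Proof. by have [[_ _ h] _] := pact_algebra pa; exact: h. Qed.

Lemma S_subspace : linear_subspace S.
Proof. by have [[h _ _] _] := pact_algebra pa. Qed.

Lemma dom_star g a : dom alpha g a -> dom alpha g (star a).
Proof. exact: (starsub_star (star_hom_dom (act_homV g))). Qed.

Lemma idom_star tau a : idom alpha tau a -> idom alpha tau (star a).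
Proof. by move=> ta h /ta; exact: dom_star. Qed.

End PartialActions.

(** * Amenability *)

Section Sections.
Context (R : realType) (G : groupType) (A : cstarAlgType R).
Context (S : set A) (alpha : pact_data G A) (pa : is_partial_action S alpha).
Implicit Types (g h : G) (a b c : A) (f k xi : G -> A) (tau sigma : {fset G}).
Local Open Scope complex_scope.

Definition single g a : G -> A := fun h => if h == g then a else 0.

Definition fsupport f : {fset G} := fset_set [set g | f g != 0].

Lemma fsupportP f g : sections alpha f -> g \notin fsupport f -> f g = 0.
Proof.
by move=> [ff _]; rewrite in_fset_set// => /negP; apply: contra_notP => /eqP fg; exact/mem_set.
Qed.

Lemma section_support f (X : {fset G}) :
  (forall g, g \notin X -> f g = 0) -> (forall g, dom alpha g (f g)) ->
  sections alpha f.
Proof.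
move=> fX fd; split=> //; apply: (@sub_finite_set _ _ [set` X]) => // g /= fg.
by apply: contraTT fg => /fX ->; rewrite negbK.
Qed.

Lemma section_single g a : dom alpha g a -> sections alpha (single g a).
Proof.
move=> ga; apply: (@section_support _ [fset g]%fset) => h.
  by rewrite in_fset1 /single => /negPf ->.
by rewrite /single; case: eqP => [->//|_]; exact: subspace0 (dom_subspace pa h).
Qed.

Lemma section_lin (c : R[i]) f k : sections alpha f -> sections alpha k ->
  sections alpha (c *: f + k).
Proof.
move=> hf hk; apply: (@section_support _ (fsupport f `|` fsupport k)%fset) => g.
  rewrite in_fsetU negb_or => /andP[/(fsupportP hf) f0 /(fsupportP hk) k0].
  have -> : (c *: f + k) g = c *: f g + k g by [].
  by rewrite f0 k0 scaler0 addr0.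
exact: (subspaceP (dom_subspace pa g) c (hf.2 g) (hk.2 g)).
Qed.

Lemma sec_mulE (X : {fset G}) f k g : (forall h, h \notin X -> f h = 0) ->
  sec_mul alpha f k g =
  \sum_(h <- X) act alpha h (act alpha h^-1%g (f h) ** k (h^-1 * g)%g).
Proof.
move=> fX; rewrite /sec_mul (@fsbigTE _ _ _ _ X)// => h hX.
by rewrite fX// (act0 pa) cmul0l (act0 pa).
Qed.

Lemma sec_term_dom h g a b : dom alpha h a -> dom alpha (h^-1 * g)%g b ->
  dom alpha g (act alpha h (act alpha h^-1%g a ** b)).
Proof.
move=> ha hb; rewrite -(mulVKg h g).
have [u v] := cmul_idealI (pact_ideal pa _) (pact_ideal pa _) (act_domV pa ha) hb.
exact: (act_inter pa).
Qed.

Lemma section_mul f k : sections alpha f -> sections alpha k ->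
  sections alpha (sec_mul alpha f k).
Proof.
move=> hf hk; have fX := fun h => @fsupportP _ h hf.
apply: (@section_support _ [fset (u.1 * u.2)%g | u in (fsupport f `*` fsupport k)%fset]%fset) => g.
  move=> gn; rewrite (sec_mulE _ _ fX) big_seq big1// => h hX.
  rewrite (fsupportP hk) ?cmul0r ?(act0 pa)//.
  apply: contra gn => kX; apply/imfsetP; exists (h, h^-1 * g)%g => /=.
    by rewrite in_fsetM hX kX.
  by rewrite mulVKg.
rewrite (sec_mulE _ _ fX); apply: subspace_sum_in; first exact: (dom_subspace pa).
by move=> h hX; apply: sec_term_dom; [exact: hf.2 | exact: hk.2].
Qed.

Lemma sec_mul1l a f : S a -> sections alpha f ->
  sec_mul alpha (single 1%g a) f = fun g => a ** f g.
Proof.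
move=> Sa hf; apply/funext => g.
rewrite (@sec_mulE [fset 1%g]%fset) => [|h]; last by rewrite in_fset1 /single => /negPf ->.
rewrite big_seq_fset1 /single eqxx invg1 mul1g !(pact_act1 pa)//.
by apply: (S_mul pa) => //; apply: (dom_S pa); exact: hf.2.
Qed.

Lemma sec_mul1r f b : sec_mul alpha f (single 1%g b) =
  fun g => act alpha g (act alpha g^-1%g (f g) ** b).
Proof.
apply/funext => g; rewrite /sec_mul (@fsbigTE _ _ _ _ [fset g]%fset).
  by rewrite big_seq_fset1 /single mulVg eqxx.
move=> h; rewrite in_fset1 => hg; rewrite /single -(inj_eq (mulgI h)) mulVKg mulg1.
by rewrite eq_sym (negPf hg) cmul0r (act0 pa).
Qed.

Lemma sec_star_single g a :
  sec_star alpha (single g a) = single g^-1%g (act alpha g^-1%g (star a)).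
Proof.
apply/funext => h; rewrite /sec_star /single.
have [->|hg] := eqVneq h g^-1%g; first by rewrite invgK eqxx.
have /negPf -> : h^-1%g != g by apply: contra_neq hg => <-; rewrite invgK.
by rewrite star0 (act0 pa).
Qed.

Lemma single_star_mul g a : dom alpha g a ->
  sec_mul alpha (single g^-1%g (act alpha g^-1%g (star a))) (single g a) =
  single 1%g (act alpha g^-1%g (star a ** a)).
Proof.
move=> ga; apply/funext => l.
rewrite (@sec_mulE [fset g^-1%g]%fset) => [|h]; last first.
  by rewrite in_fset1 /single => /negPf ->.
rewrite big_seq_fset1 /single eqxx invgK (actVK pa); last exact: (dom_star pa).
have -> : ((g * l)%g == g) = (l == 1%g) by rewrite -{2}(mulg1 g) (inj_eq (mulgI g)).
by case: eqP => // _; rewrite cmul0r (act0 pa).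
Qed.

(** A coordinate of a section is dominated by its norm in the Hilbert module,
    because the squared norm is that of a sum of positive elements. *)
Lemma rnorm_le_l2norm xi g : sections alpha xi -> rnorm (xi g) <= sec_l2norm alpha xi.
Proof.
move=> hxi; set eta := sec_inner alpha xi xi; have xd h : dom alpha h (xi h) := hxi.2 h.
suff h : rnorm (xi g) ^+ 2 <= rnorm eta.
  by rewrite /sec_l2norm -(ger0_norm (rnorm_ge0 (xi g))) -sqrtr_sqr ler_wsqrtr.
pose y h := act alpha h^-1%g (xi h).
have yE h : act alpha h^-1%g (star (xi h) ** xi h) = star (y h) ** y h.
  rewrite (star_homM (act_homV pa h)) ?(star_homS (act_homV pa h))//.
  exact: (dom_star pa).
have -> : rnorm (xi g) = rnorm (y g).
  by rewrite /y (rnorm_act pa)// invgK.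
have -> : eta = star (y g) ** y g + \sum_(h <- ((g |` fsupport xi) `\ g)%fset) star (y h) ** y h.
  rewrite /eta /sec_inner (@fsbigTE _ _ _ _ (g |` fsupport xi)%fset); last first.
    move=> h; rewrite in_fset1U negb_or => /andP[_ /(fsupportP hxi) ->].
    by rewrite cmul0r (act0 pa).
  rewrite (eq_bigr (fun h => star (y h) ** y h)) => [|h _]; last exact: yE.
  by rewrite (big_fsetD1 g) ?fset1U1.
exact: rnorm_sq_le_sum.
Qed.

End Sections.

Section Decompositions.
Context (R : realType) (G : groupType) (A : cstarAlgType R).

(** The decomposition property relative to an invariant ideal [S] in place of
    the whole algebra, so that it also applies to the ideals of the orbits. *)
Record decomposes (S : set A) (n : nat) (alpha : pact_data G A) : Prop := {
  decomposes_dense : forall a, S a -> forall r : R, 0 < r ->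
    exists2 b, subspace_sum (fun tau : Tn G n => idom alpha tau) b &
      rnorm (a - b) < r;
  decomposes_disjoint : forall (tau : Tn G n) g a,
    g \notin (tau : {fset G}) -> idom alpha tau a -> dom alpha g a -> a = 0
}.

End Decompositions.

Section ReducedNorm.
Context (R : realType) (G : groupType) (A : cstarAlgType R) (n : nat).
Context (S : set A) (alpha : pact_data G A) (pa : is_partial_action S alpha).
Hypothesis dec : decomposes S n alpha.
Implicit Types (g h : G) (a b c : A) (f k xi : G -> A) (tau sigma : Tn G n).
Local Open Scope complex_scope.

Lemma Tn1 tau : 1%g \in (tau : {fset G}).
Proof. by have /andP[] := valP tau. Qed.

Lemma Tn_ideal tau : closed_ideal S (idom alpha tau).
Proof. exact: (idom_ideal pa (Tn1 tau)). Qed.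

(** The sections that arise from an arbitrary one by multiplying with elements of
    [A_tau] on the left and of [A_sigma] on the right. *)
Definition confined tau sigma f :=
  [/\ sections alpha f, forall g, g \notin (tau : {fset G}) -> f g = 0 &
      forall g, idom alpha sigma (act alpha g^-1%g (f g))].

Lemma confined_corner tau sigma f a b :
  sections alpha f -> idom alpha tau a -> idom alpha sigma b ->
  confined tau sigma
    (sec_mul alpha (sec_mul alpha (single 1%g a) f) (single 1%g b)).
Proof.
move=> hf ta sb; have Sa := ideal_sub (Tn_ideal tau) ta.
have Sb := ideal_sub (Tn_ideal sigma) sb.
have s1 c : S c -> sections alpha (single 1%g c).
  by move=> Sc; apply: (section_single pa); rewrite (pact_dom1 pa).
have h1 := section_mul pa (s1 _ Sa) hf.
split; first exact: (section_mul pa h1 (s1 _ Sb)).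
  move=> g gt; rewrite (sec_mul1r pa) (sec_mul1l pa)//.
  have [ta' ga'] := cmul_idealI (Tn_ideal tau) (pact_ideal pa g) ta (hf.2 g).
  by rewrite (decomposes_disjoint dec gt ta' ga') (act0 pa) cmul0l (act0 pa).
move=> g; rewrite (sec_mul1r pa).
have d := act_domV pa (h1.2 g).
have [d' sb'] := cmul_idealI (pact_ideal pa _) (Tn_ideal sigma) d sb.
by rewrite (actK pa).
Qed.

(** For such [f] only the coordinates of [xi] in [sigma] enter [f * xi], and the
    result is supported in [tau sigma]; so [f] acts boundedly. *)
Lemma confined_bounded tau sigma f : confined tau sigma f ->
  has_ubound [set sec_l2norm alpha (sec_mul alpha f xi) | xi in
    [set xi | sections alpha xi /\ sec_l2norm alpha xi <= 1]].
Proof.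
move=> [hf ft fs]; pose C := \sum_(h <- (tau : {fset G})) rnorm (f h).
have C0 : 0 <= C by apply: sumr_ge0 => h _; exact: rnorm_ge0.
pose X := [fset (u.1 * u.2)%g | u in ((tau : {fset G}) `*` (sigma : {fset G}))%fset]%fset.
exists (Num.sqrt (\sum_(g <- X) C ^+ 2)) => _ [xi [hxi xi1] <-].
have xin h : rnorm (xi h) <= 1 by exact: le_trans (rnorm_le_l2norm pa h hxi) xi1.
set eta := sec_mul alpha f xi; have heta : sections alpha eta := section_mul pa hf hxi.
have etaE g := sec_mulE pa xi g ft.
have etaC g : rnorm (eta g) <= C.
  rewrite /eta etaE; apply: le_trans (rnorm_sum _ _ _) _; apply: ler_sum => h _.
  have [d1 d2] := cmul_idealI (pact_ideal pa _) (pact_ideal pa _)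
    (act_domV pa (hf.2 h)) (hxi.2 (h^-1 * g)%g).
  rewrite (rnorm_act pa)//; apply: le_trans (rnormM_le _ _) _.
  rewrite (rnorm_act pa) ?invgK; last exact: hf.2.
  by rewrite ler_piMr ?rnorm_ge0.
have eta0 g : g \notin X -> eta g = 0.
  move=> gX; rewrite /eta etaE big_seq big1// => h ht.
  have [d1 d2] := cmul_idealI (Tn_ideal sigma) (pact_ideal pa _)
    (fs h) (hxi.2 (h^-1 * g)%g).
  have hg : (h^-1 * g)%g \notin (sigma : {fset G}).
    apply: contra gX => hg; apply/imfsetP; exists (h, h^-1 * g)%g => /=.
      by rewrite in_fsetM ht hg.
    by rewrite mulVKg.
  by rewrite (decomposes_disjoint dec hg d1 d2) (act0 pa).
rewrite /sec_l2norm ler_wsqrtr//.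
rewrite /sec_inner (@fsbigTE _ _ _ _ X) => [|g /eta0 ->]; last first.
  by rewrite cmul0r (act0 pa).
apply: le_trans (rnorm_sum _ _ _) _; apply: ler_sum => g _.
have d := dom_star pa (heta.2 g).
rewrite (rnorm_act pa) ?invgK; last first.
  by apply: (ideal_mull (pact_ideal pa g)); [exact: (dom_S pa d) | exact: heta.2].
by rewrite rnorm_cstar lerXn2r ?nnegrE ?rnorm_ge0.
Qed.

(** The coordinate [f_g] is recovered by letting [f] act on [b delta_1], where [b]
    is the normalised adjoint of [alpha_(g^-1)(f_g)]. *)
Lemma confined_reduced_norm tau sigma f g : confined tau sigma f ->
  rnorm (f g) <= reduced_norm alpha f.
Proof.
move=> cf; have ub := ub_le_sup (confined_bounded cf); have [hf _ _] := cf.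
pose a := act alpha g^-1%g (f g).
have aS : S a := dom_S pa (act_domV pa (hf.2 g)).
have an : rnorm a = rnorm (f g) by rewrite /a (rnorm_act pa) ?invgK//; exact: hf.2.
pose b := (rnorm a)^-1%:C *: star a.
have Sb : S b by apply: subspaceZ; [exact: (S_subspace pa) | exact: (S_star pa)].
have bn : rnorm b <= 1.
  rewrite rnormZr rnorm_star ger0_norm ?invr_ge0 ?rnorm_ge0//.
  by have [->|a0] := eqVneq (rnorm a) 0; rewrite ?mulr0// mulVf.
have hb : sections alpha (single 1%g b).
  by apply: (section_single pa); rewrite (pact_dom1 pa).
have l2b : sec_l2norm alpha (single 1%g b) <= 1.
  rewrite /sec_l2norm /sec_inner (@fsbigTE _ _ _ _ [fset 1%g]%fset) => [|h].
    rewrite big_seq_fset1 /single eqxx invg1 (pact_act1 pa); last first.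
      by apply: (S_mul pa) => //; exact: (S_star pa).
    by rewrite rnorm_cstar sqrtr_sqr ger0_norm ?rnorm_ge0.
  by rewrite in_fset1 /single => /negPf ->; rewrite cmul0r (act0 pa).
have := ub _ (imageP _ (conj hb l2b)); apply: le_trans.
apply: le_trans (rnorm_le_l2norm pa g (section_mul pa hf hb)).
rewrite (sec_mul1r pa) -/a (rnorm_act pa); last first.
  apply: (ideal_mulr (pact_ideal pa _)) => //; exact: (act_domV pa (hf.2 g)).
rewrite /b cmulZr rnormZr rnorm_cstar' ger0_norm ?invr_ge0 ?rnorm_ge0// -an.
have [->|a0] := eqVneq (rnorm a) 0; first by rewrite expr0n mulr0.
by rewrite expr2 mulKf.
Qed.

End ReducedNorm.

Section Amenability.
Context (R : realType) (G : groupType) (A : cstarAlgType R) (n : nat).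
Context (S : set A) (alpha : pact_data G A) (pa : is_partial_action S alpha).
Hypothesis dec : decomposes S n alpha.
Implicit Types (g h : G) (a b c : A) (f k xi : G -> A) (tau sigma : Tn G n).
Local Open Scope complex_scope.

Section Representations.
Context (F : cstarAlgType R) (j : (G -> A) -> F) (hj : star_rep alpha j).

Let section1 a : S a -> sections alpha (single 1%g a).
Proof. by move=> Sa; apply: (section_single pa); rewrite (pact_dom1 pa). Qed.

Lemma single_lin g (x : R[i]) a b :
  single g (x *: a + b) = x *: single g a + single g b.
Proof.
apply/funext => h; rewrite /single.
have -> : (x *: (fun h => if h == g then a else 0) + (fun h => if h == g then b else 0)) h =
  x *: (if h == g then a else 0) + (if h == g then b else 0) by [].
by case: eqP => // _; rewrite scaler0 addr0.
Qed.

Lemma section0 : sections alpha 0.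
Proof.
apply: (@section_support _ _ _ _ _ fset0) => // g.
exact: subspace0 (dom_subspace pa g).
Qed.

Lemma rep0 : j 0 = 0.
Proof.
have := star_repP hj 1 section0 section0.
by rewrite !scale1r addr0 => h; apply: (addrI (j 0)); rewrite addr0 -h.
Qed.

Lemma rep_sum f (X : {fset G}) : sections alpha f ->
  (forall g, g \notin X -> f g = 0) -> j f = \sum_(g <- X) j (single g (f g)).
Proof.
move=> hf fX; have fE : f = \sum_(g <- X) single g (f g).
  apply/funext => h; rewrite fct_sumE.
  have [hX|hX] := boolP (h \in X).
    rewrite (big_fsetD1 h)//= {1}/single eqxx big_seq big1 ?addr0// => g.
    by rewrite in_fsetD1 /single eq_sym => /andP[/negPf ->].
  rewrite big_seq big1 ?fX// => g gX; rewrite /single.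
  by case: eqP => // hg; rewrite hg gX in hX.
rewrite {1}fE; elim: (X : seq G) => [|g r IH].
  by rewrite !big_nil rep0.
rewrite !big_cons -IH -{1}(scale1r (single g (f g))) (star_repP hj).
- by rewrite scale1r.
- by apply: (section_single pa); exact: hf.2.
elim: r {IH} => [|h r IH]; first by rewrite big_nil; exact: section0.
rewrite big_cons -(scale1r (single h (f h))); apply: (section_lin pa) => //.
by apply: (section_single pa); exact: hf.2.
Qed.

Lemma rep_single_hom : star_hom S (fun a => j (single 1%g a)).
Proof.
have [[SS Sm Ss] _] := pact_algebra pa.
split=> [|c a b Sa Sb|a b Sa Sb|a Sa].
- by split.
- by rewrite single_lin (star_repP hj)//; exact: section1.
- rewrite -(star_repM hj) ?(sec_mul1l pa)//; do ?exact: section1.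
  by congr j; apply/funext => h; rewrite /single; case: eqP => // _; rewrite cmul0r.
- rewrite -(star_repS hj) ?(sec_star_single pa); last exact: section1.
  by rewrite invg1 (pact_act1 pa)//; exact: Ss.
Qed.

Lemma rep_single_star g a : dom alpha g a ->
  star (j (single g a)) ** j (single g a) =
  j (single 1%g (act alpha g^-1%g (star a ** a))).
Proof.
move=> ga; have hs := section_single pa ga.
rewrite -(star_repS hj)// (sec_star_single pa) -(star_repM hj)//.
  by rewrite (single_star_mul pa).
apply: (section_single pa); apply: (act_domV pa); exact: (dom_star pa).
Qed.

Lemma rnorm_rep_single g a : dom alpha g a -> rnorm (j (single g a)) <= rnorm a.
Proof.
move=> ga; rewrite -(@ler_pXn2r _ 2) ?nnegrE ?rnorm_ge0// -rnorm_cstar.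
have da : dom alpha g (star a ** a).
  apply: (ideal_mull (pact_ideal pa g)) => //; apply: (S_star pa); exact: (dom_S pa ga).
rewrite rep_single_star//; have Sa := dom_S pa (act_domV pa da).
apply: le_trans (star_hom_contractive rep_single_hom _ Sa) _.
  by have [_ h] := pact_algebra pa.
by rewrite (rnorm_act pa) ?invgK// rnorm_cstar.
Qed.

(** As [w^* j(f)^* j(f) w] only involves [j] on the coefficients at the unit, an
    element killed by those is killed by all of the dense range of [j]. *)
Lemma rep_nondegenerate w : closure (j @` sections alpha) = setT ->
  (forall a, S a -> j (single 1%g a) ** w = 0) -> w = 0.
Proof.
move=> jd wS; have single0 g a : dom alpha g a -> j (single g a) ** w = 0.
  move=> ga; apply: star_cmul_eq0; rewrite starM -cmulA [X in _ ** X]cmulA.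
  rewrite rep_single_star// wS ?cmul0r//; apply: (dom_S pa); apply: (act_domV pa).
  apply: (ideal_mull (pact_ideal pa g)) => //; apply: (S_star pa); exact: (dom_S pa ga).
have jw f : sections alpha f -> j f ** w = 0.
  move=> hf; rewrite (rep_sum hf (fun g => @fsupportP _ _ _ _ _ g hf)) cmul_suml big1// => g _.
  by apply: single0; exact: hf.2.
apply: star_cmul_eq0; apply: rnorm_le0 => e e0.
have w1 : 0 < rnorm w + 1 by rewrite ltr_pwDr ?rnorm_ge0.
have [|_ [f hf <-] fe] := (@closureP _ _ (j @` sections alpha) (star w)).1 _ _ (divr_gt0 e0 w1).
  by rewrite jd.
rewrite -[star w ** w]subr0 -(jw _ hf) -cmulBl.
apply: le_trans (rnormM_le _ _) _; apply: (@le_trans _ _ (e / (rnorm w + 1) * (rnorm w + 1))).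
  by rewrite ler_pM ?rnorm_ge0 ?lerDl// ltW.
by rewrite divfK ?gt_eqF.
Qed.

End Representations.

(** The full and the reduced norm are compared on the corners cut out of the full
    crossed product by [A_tau] and [A_sigma]: a confined section has finitely many
    coordinates, each of which is dominated by the reduced norm. An element [u] of
    the kernel is therefore killed in all corners, hence is zero. *)
Theorem decomposes_amenable : amenable alpha.
Proof.
move=> F E j r phi [hj jd _] [_ _ rn] hphi phij u v uv.
apply/eqP; rewrite -subr_eq0; apply/eqP.
have : phi (u - v) = 0 by rewrite (star_homB hphi)// uv subrr.
move: (u - v) => {uv v}u phiu.
pose J a := j (single 1%g a).
have hJ : star_hom S J := rep_single_hom hj.
have [[SS Sm Ss] cS] := pact_algebra pa.
have section1 a : S a -> sections alpha (single 1%g a).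
  by move=> Sa; apply: (section_single pa); rewrite (pact_dom1 pa).
have corner tau sigma a b : idom alpha tau a -> idom alpha sigma b ->
    J a ** u ** J b = 0.
  move=> ta sb; have Sa := ideal_sub (Tn_ideal pa tau) ta.
  have Sb := ideal_sub (Tn_ideal pa sigma) sb.
  pose C := rnorm (J a) * rnorm (J b).
  have C0 : 0 <= C by rewrite mulr_ge0 ?rnorm_ge0.
  apply: rnorm_le0 => e e0; pose d := e / ((n.+1)%:R * (C + 1)).
  have d0 : 0 < d by rewrite divr_gt0// mulr_gt0 ?ltr0n// ltr_pwDr.
  have [|_ [f hf <-] fd] := (@closureP _ _ (j @` sections alpha) u).1 _ _ d0.
    by rewrite jd.
  pose f' := sec_mul alpha (sec_mul alpha (single 1%g a) f) (single 1%g b).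
  have cf : confined alpha tau sigma f' := confined_corner pa dec hf ta sb.
  have [hf' ft _] := cf.
  have jf' : j f' = J a ** j f ** J b.
    rewrite (star_repM hj) ?(star_repM hj)//; do ?exact: section1.
    by apply: (section_mul pa) => //; exact: section1.
  have near : rnorm (J a ** u ** J b - j f') <= C * d.
    rewrite jf' -cmulBl -cmulBr /C mulrAC.
    by apply: le_rnormM => //; apply: le_rnormM => //; exact: ltW.
  have small g : rnorm (f' g) <= C * d.
    apply: le_trans (confined_reduced_norm pa dec g cf) _.
    rewrite -rn// -phij// -rnormN -sub0r.
    have <- : phi (J a ** u ** J b) = 0.
      by rewrite !(star_homM hphi)// phiu cmul0r cmul0l.
    rewrite -(star_homB hphi)//; apply: le_trans near.
    by apply: (star_hom_contractive hphi) => //; exact: closedT.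
  rewrite -(subrK (j f') (J a ** u ** J b)).
  apply: le_trans (rnormD _ _) _; apply: (@le_trans _ _ (C * d + n%:R * (C * d))).
    apply: lerD => //; rewrite (rep_sum hj hf' ft).
    apply: le_trans (rnorm_sum _ _ _) _.
    have -> : n%:R * (C * d) = \sum_(g <- (tau : {fset G})) C * d.
      rewrite big_const_seq count_predT iter_addr_0 mulr_natl.
      by have /andP[_ /eqP {1}<-] := valP tau.
    apply: ler_sum => g _; apply: le_trans (rnorm_rep_single hj (hf'.2 g)) _.
    exact: small.
  have -> : C * d + n%:R * (C * d) = (C / (C + 1)) * e.
    have C1 : C + 1 != 0 by rewrite gt_eqF// ltr_pwDr.
    have n1 : n.+1%:R != 0 :> R by rewrite pnatr_eq0.
    by rewrite /d -natr1; field; rewrite C1 natr1.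
  rewrite ler_piMl ?(ltW e0)// ler_pdivrMr ?ltr_pwDr// mul1r.
  by rewrite lerDl.
have extend (T : A -> F) M : 0 <= M ->
    (forall (c : R[i]) a b, S a -> S b -> T (c *: a + b) = c *: T a + T b) ->
    (forall a, S a -> rnorm (T a) <= M * rnorm a) ->
    (forall tau a, idom alpha tau a -> T a = 0) -> forall a, S a -> T a = 0.
  move=> M0 TP TM T0 a Sa; apply: rnorm_le0 => e e0.
  have M1 : 0 < M + 1 by rewrite ltr_pwDr.
  have [b sb ab] := decomposes_dense dec Sa (divr_gt0 e0 M1).
  have [Sb Tb] : S b /\ T b = 0.
    suff h : linear_subspace [set a | S a /\ T a = 0].
      apply: (lspan_min h _ sb) => c [tau _ tc]; split; last exact: T0 tc.
      exact: (ideal_sub (Tn_ideal pa tau) tc).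
    have S0 := subspace0 SS; split=> [|c x y [Sx Tx] [Sy Ty]].
      split=> //; apply: rnorm0_eq0; apply/le_anti; rewrite rnorm_ge0 andbT.
      by have := TM _ S0; rewrite rnorm0 mulr0.
    split; first exact: (subspaceP SS).
    by rewrite TP// Tx Ty scaler0 addr0.
  have -> : T a = T (a - b).
    have := TP 1 _ _ (subspaceB SS Sa Sb) Sb.
    by rewrite !scale1r subrK Tb addr0.
  apply: le_trans (TM _ (subspaceB SS Sa Sb)) _.
  apply: (@le_trans _ _ ((M + 1) * (e / (M + 1)))); last first.
    by rewrite mulrC divfK ?gt_eqF.
  by apply: ler_pM => //; rewrite ?rnorm_ge0 ?(ltW ab)// lerDl.
have Jn a : S a -> rnorm (J a) <= rnorm a.
  by move=> Sa; apply: (rnorm_rep_single hj); rewrite (pact_dom1 pa).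
have kill_l sigma b a : idom alpha sigma b -> S a -> J a ** u ** J b = 0.
  move=> sb; apply: (extend (fun a => J a ** u ** J b) (rnorm u * rnorm (J b))).
  - by rewrite mulr_ge0 ?rnorm_ge0.
  - by move=> c x y Sx Sy; rewrite (star_homP hJ)// !cmulDl !cmulZl.
  - move=> x Sx; rewrite mulrC mulrA; apply: le_rnormM => //.
    by apply: le_rnormM => //; exact: Jn.
  - by move=> tau x tx; exact: corner tx sb.
have kill a b : S a -> S b -> J a ** u ** J b = 0.
  move=> Sa; apply: (extend (fun b => J a ** u ** J b) (rnorm (J a ** u))).
  - exact: rnorm_ge0.
  - by move=> c x y Sx Sy; rewrite (star_homP hJ)// !cmulDr !cmulZr.
  - by move=> x Sx; apply: le_rnormM => //; exact: Jn.
  - by move=> sigma x sx; exact: kill_l sx Sa.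
apply: (rep_nondegenerate hj jd) => a Sa; rewrite -[LHS]starK -[RHS]star0; congr star.
apply: (rep_nondegenerate hj jd) => b Sb.
have := kill _ _ Sa (Ss _ Sb); rewrite (star_homS hJ)// => /(congr1 star).
by rewrite starM starK star0.
Qed.

End Amenability.

(** * Projections onto the ideals of a decomposition *)

Section LiftLimit.
Context (R : realType) (A B : cstarAlgType R).

(** A contractive relation with values in a complete space extends to the closure
    of its domain. *)
Lemma lift_limit (P : A -> B -> Prop) a :
  (forall a b a' b', P a b -> P a' b' -> rnorm (b - b') <= rnorm (a - a')) ->
  (forall r, 0 < r -> exists a', exists2 b, P a' b & rnorm (a - a') < r) ->
  exists b, forall r, 0 < r ->
    exists a' b', [/\ P a' b', rnorm (a - a') < r & rnorm (b - b') < r].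
Proof.
move=> Pc Pa; have inv0 (k : nat) : (0 : R) < k.+1%:R^-1 by rewrite invr_gt0.
have /choice[u uP] : forall k : nat, exists p : A * B,
    P p.1 p.2 /\ rnorm (a - p.1) < k.+1%:R^-1.
  by move=> k; have [a' [b Pab h]] := Pa _ (inv0 k); exists (a', b).
have small r : 0 < r -> exists N, forall k, (N <= k)%N -> rnorm (a - (u k).1) < r.
  move=> r0; exists (Num.bound r^-1) => k Nk; apply: lt_trans (uP k).2 _.
  rewrite invf_plt ?posrE//; apply: lt_le_trans (archi_boundP _) _.
    by rewrite invr_ge0 ltW.
  by rewrite ler_nat; exact: leq_trans Nk (leqnSn _).
have [b bu] : exists b, forall r, 0 < r -> exists N, forall k, (N <= k)%N ->
    rnorm (b - (u k).2) < r.
  apply: complete_seq => r r0; have [N hN] := small _ (divr_gt0 r0 (ltr0n _ 2)).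
  exists N => m k Nm Nk; apply: le_lt_trans (Pc _ _ _ _ (uP m).1 (uP k).1) _.
  rewrite -(subrKA a) [ltRHS]splitr; apply: le_lt_trans (rnormD _ _) _.
  by rewrite ltrD ?hN// rnormB hN.
exists b => r r0; have [N hN] := small r r0; have [M hM] := bu r r0.
exists (u (maxn N M)).1, (u (maxn N M)).2; split; first exact: (uP _).1.
  by rewrite hN ?leq_maxl.
by rewrite hM ?leq_maxr.
Qed.

End LiftLimit.

Section Projections.
Context (R : realType) (G : groupType) (A : cstarAlgType R) (n : nat).
Context (alpha : pact_data G A) (pa : is_partial_action setT alpha).
Hypothesis dec : decomposition_property n alpha.
Implicit Types (g h : G) (a b c : A) (sigma rho : {fset G}) (tau : Tn G n).
Local Open Scope complex_scope.

Lemma decomposition_decomposes : decomposes setT n alpha.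
Proof.
split=> [a _ r r0|tau g a gt ta ga].
  have : closure (subspace_sum (fun tau : Tn G n => idom alpha tau)) a.
    by rewrite (decomp_dense dec).
  by move=> /closureP; apply.
by have /seteqP[h _] := decomp_disjoint dec gt; apply: h.
Qed.

Definition is_Tn sigma := (1%g \in sigma) && (#|` sigma| == n).

Lemma is_TnP tau : is_Tn tau. Proof. exact: valP. Qed.

Lemma is_Tn_ideal sigma : is_Tn sigma -> closed_ideal setT (idom alpha sigma).
Proof. by move=> /andP[s1 _]; exact: (idom_ideal pa s1). Qed.

Lemma is_Tn_translate sigma g : is_Tn sigma -> g \in sigma ->
  is_Tn (translate g^-1%g sigma).
Proof.
by move=> /andP[_ sn] gs; rewrite /is_Tn one_in_translate gs card_translate.
Qed.

Lemma idom_disjoint_dom sigma g a : is_Tn sigma -> g \notin sigma ->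
  idom alpha sigma a -> dom alpha g a -> a = 0.
Proof.
move=> sT; exact: (decomposes_disjoint decomposition_decomposes
  (tau := exist _ sigma sT)).
Qed.

Lemma idom_disjoint sigma rho a : is_Tn sigma -> is_Tn rho -> sigma != rho ->
  idom alpha sigma a -> idom alpha rho a -> a = 0.
Proof.
move=> sT rT sr sa ra; have [g gr gs] : exists2 g, g \in rho & g \notin sigma.
  apply/fsubsetPn; apply: contra sr => rs; rewrite eq_sym eqEfcard rs /=.
  by have /andP[_ /eqP ->] := sT; have /andP[_ /eqP ->] := rT.
exact: (idom_disjoint_dom sT gs sa (ra _ gr)).
Qed.

Lemma idom_orthogonal sigma rho a b : is_Tn sigma -> is_Tn rho -> sigma != rho ->
  idom alpha sigma a -> idom alpha rho b -> a ** b = 0.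
Proof.
move=> sT rT sr sa rb.
have [u v] := cmul_idealI (is_Tn_ideal sT) (is_Tn_ideal rT) sa rb.
exact: (idom_disjoint sT rT sr u v).
Qed.

(** The component of [a] in [A_sigma]: as the algebra is a direct sum containing
    [A_sigma] as a summand, [a] acts on [A_sigma] by its component. *)
Definition component sigma a : A :=
  xget 0 [set b | idom alpha sigma b /\ forall c, idom alpha sigma c -> b ** c = a ** c].

Local Notation E := component.

Let is_component sigma a b :=
  idom alpha sigma b /\ forall c, idom alpha sigma c -> b ** c = a ** c.

Lemma component_unique sigma a b b' : is_Tn sigma ->
  is_component sigma a b -> is_component sigma a b' -> b = b'.
Proof.
move=> sT [sb ab] [sb' ab']; apply/eqP; rewrite -subr_eq0; apply/eqP/cmul_star_eq0.
have h : idom alpha sigma (star (b - b')).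
  apply: (idom_star pa); exact: (subspaceB (ideal_subspace (is_Tn_ideal sT))).
by rewrite cmulBl ab// ab'// subrr.
Qed.

(** Finite sums of elements of the ideals have a component, and the passage to
    the component is contractive. *)
Lemma component_exists sigma a : is_Tn sigma -> exists b, is_component sigma a b.
Proof.
move=> sT; have hs := is_Tn_ideal sT; have ss := ideal_subspace hs.
have contr a1 b1 a2 b2 : is_component sigma a1 b1 -> is_component sigma a2 b2 ->
    rnorm (b1 - b2) <= rnorm (a1 - a2).
  move=> [s1 h1] [s2 h2]; set b := b1 - b2.
  have sb : idom alpha sigma (star b) by apply: (idom_star pa); exact: (subspaceB ss).
  have [->|b0] := eqVneq b 0; first by rewrite rnorm0 rnorm_ge0.
  rewrite -(@ler_pM2r _ (rnorm b)) ?rnorm_gt0// -expr2 -rnorm_cstar'.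
  rewrite {1}/b cmulBl h1// h2// -cmulBl -(rnorm_star b); exact: rnormM_le.
have [|b hb] := @lift_limit R A A (is_component sigma) a contr.
  move=> r r0; have [b sb ab] := decomposes_dense decomposition_decomposes (a := a) I r0.
  exists b; suff [c hc] : exists c, is_component sigma b c by exists c.
  apply: (@lspan_min _ _ _ [set x | exists c, is_component sigma x c] _ _ _ sb)
    => [|c [rho _ rc]].
    split; first by exists 0; split=> //; exact: (subspace0 ss).
    move=> k x y [x' [sx hx]] [y' [sy hy]]; exists (k *: x' + y'); split.
      exact: (subspaceP ss).
    by move=> c sc; rewrite !cmulDl !cmulZl hx// hy.
  have [/eqP e|e] := boolP (sigma == (rho : {fset G})).
    by exists c; split=> //; rewrite e.
  exists 0; split; first exact: (subspace0 ss).
  move=> d sd; rewrite cmul0l (@idom_orthogonal rho sigma)//; first exact: is_TnP.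
  by rewrite eq_sym.
exists b; split.
  apply: (closed_limit (ideal_closed hs)) => r /hb[a' [b' [[sb' _] _ h]]].
  by exists b'.
move=> c sc; apply/eqP; rewrite -subr_eq0 -cmulBl; apply/eqP/rnorm_le0 => e e0.
have c1 : 0 < 2 * (rnorm c + 1) by rewrite mulr_gt0// ltr_pwDr ?rnorm_ge0.
have [a' [b' [[sb' hb'] aa' bb']]] := hb _ (divr_gt0 e0 c1).
have -> : (b - a) ** c = (b - b') ** c - (a - a') ** c.
  by rewrite !cmulBl hb'// opprB addrA subrK.
apply: le_trans (rnorm_subr_le _ _) _; set d := e / _ in aa' bb'.
have d0 : 0 < d by exact: divr_gt0.
apply: (@le_trans _ _ (d * rnorm c + d * rnorm c)).
  by apply: lerD; apply: le_rnormM => //; exact: ltW.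
have -> : e = d * (rnorm c + 1) + d * (rnorm c + 1).
  by rewrite /d; field; rewrite gt_eqF// ltr_pwDr ?rnorm_ge0.
by apply: lerD; rewrite ler_pM2l// lerDl.
Qed.

Lemma componentP sigma a : is_Tn sigma -> is_component sigma a (E sigma a).
Proof.
by move=> sT; have [b hb] := component_exists a sT; apply: (@xgetPex _ 0); exists b.
Qed.

Lemma component_in sigma a : is_Tn sigma -> idom alpha sigma (E sigma a).
Proof. by move=> /(@componentP _ a)[]. Qed.

Lemma component_mul sigma a c : is_Tn sigma -> idom alpha sigma c ->
  E sigma a ** c = a ** c.
Proof. by move=> /(@componentP _ a)[_]; apply. Qed.

Lemma componentE sigma a b : is_Tn sigma -> idom alpha sigma b ->
  (forall c, idom alpha sigma c -> b ** c = a ** c) -> E sigma a = b.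
Proof.
by move=> sT sb ab; apply: (component_unique sT (componentP a sT)); split.
Qed.

Lemma component_mull sigma a c : is_Tn sigma -> idom alpha sigma c ->
  c ** E sigma a = c ** a.
Proof.
move=> sT sc; have hs := is_Tn_ideal sT; apply/eqP; rewrite -subr_eq0 -cmulBr.
apply/eqP/cmul_star_eq0; set d := c ** _.
have sd : idom alpha sigma (star d).
  by apply: (idom_star pa); exact: (ideal_mulr hs sc).
by rewrite {1}/d -cmulA cmulBl component_mul// subrr cmul0r.
Qed.

Lemma component_id sigma a : is_Tn sigma -> idom alpha sigma a -> E sigma a = a.
Proof. by move=> sT sa; apply: componentE. Qed.

Lemma component_other sigma rho a : is_Tn sigma -> is_Tn rho -> sigma != rho ->
  idom alpha rho a -> E sigma a = 0.
Proof.
move=> sT rT sr ra; apply: componentE => //.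
  exact: subspace0 (ideal_subspace (is_Tn_ideal sT)).
by move=> c sc; rewrite cmul0l (@idom_orthogonal rho sigma)// eq_sym.
Qed.

Lemma component_lin sigma (k : R[i]) a b : is_Tn sigma ->
  E sigma (k *: a + b) = k *: E sigma a + E sigma b.
Proof.
move=> sT; apply: componentE => // [|c sc].
  by apply: (subspaceP (ideal_subspace (is_Tn_ideal sT))); exact: component_in.
by rewrite !cmulDl !cmulZl !component_mul.
Qed.

Lemma component0 sigma : is_Tn sigma -> E sigma 0 = 0.
Proof.
by move=> sT; apply: component_id => //; exact: subspace0 (ideal_subspace (is_Tn_ideal sT)).
Qed.

Lemma componentD sigma a b : is_Tn sigma -> E sigma (a + b) = E sigma a + E sigma b.
Proof. by move=> sT; have := component_lin 1 a b sT; rewrite !scale1r. Qed.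

Lemma componentB sigma a b : is_Tn sigma -> E sigma (a - b) = E sigma a - E sigma b.
Proof.
by move=> sT; have := component_lin (-1) b a sT; rewrite !scaleN1r !(addrC (- _)).
Qed.

Lemma component_sum sigma (I : Type) (r : seq I) (F : I -> A) : is_Tn sigma ->
  E sigma (\sum_(i <- r) F i) = \sum_(i <- r) E sigma (F i).
Proof.
move=> sT; apply: (big_morph (E sigma)) => [a b|]; first exact: componentD.
exact: component0.
Qed.

Lemma componentM sigma a b : is_Tn sigma -> E sigma (a ** b) = E sigma a ** E sigma b.
Proof.
move=> sT; have hs := is_Tn_ideal sT; apply: componentE => // [|c sc].
  by apply: (ideal_mull hs) => //; exact: component_in.
by rewrite -!cmulA !component_mul//; apply: (ideal_mull hs).
Qed.

Lemma component_star sigma a : is_Tn sigma -> E sigma (star a) = star (E sigma a).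
Proof.
move=> sT; apply: componentE => // [|c sc].
  by apply: (idom_star pa); exact: component_in.
have sc' : idom alpha sigma (star c) by exact: (idom_star pa).
by rewrite -[c in LHS]starK -starM component_mull// starM starK.
Qed.

Lemma rnorm_component sigma a : is_Tn sigma -> rnorm (E sigma a) <= rnorm a.
Proof.
move=> sT; have [->|e0] := eqVneq (E sigma a) 0; first by rewrite rnorm0 rnorm_ge0.
rewrite -(@ler_pM2r _ (rnorm (E sigma a))) ?rnorm_gt0// -expr2 -rnorm_cstar'.
rewrite component_mul//; last by apply: (idom_star pa); exact: component_in.
by rewrite -(rnorm_star (E sigma a)) rnormM_le.
Qed.

Lemma component_dom sigma g a : is_Tn sigma -> g \notin sigma -> dom alpha g a ->
  E sigma a = 0.
Proof.
move=> sT gs ga; apply: componentE => // [|c sc].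
  exact: subspace0 (ideal_subspace (is_Tn_ideal sT)).
have [u v] := cmul_idealI (pact_ideal pa g) (is_Tn_ideal sT) ga sc.
by rewrite cmul0l (idom_disjoint_dom sT gs v u).
Qed.

Lemma component_act sigma g a : is_Tn sigma -> g \in sigma -> dom alpha g^-1%g a ->
  E sigma (act alpha g a) = act alpha g (E (translate g^-1%g sigma) a).
Proof.
move=> sT gs ga; have sT' := is_Tn_translate sT gs.
have gs' : g^-1%g \in translate g^-1%g sigma.
  by rewrite in_translate invgK mulgV; case/andP: sT.
have ea := component_in a sT'.
apply: componentE => // [|c sc].
  by have := act_idom pa gs' ea; rewrite translateVK.
have sc' : idom alpha (translate g^-1%g sigma) (act alpha g^-1%g c).
  exact: (act_idomV pa).
have {1 2}-> : c = act alpha g (act alpha g^-1%g c) by rewrite (actVK pa)//; exact: sc.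
rewrite -!(star_homM (act_hom pa g)) ?component_mul//; try exact: sc'.
exact: ea.
Qed.

Lemma rnorm_component_sum (r : seq {fset G}) a M : uniq r -> all is_Tn r ->
  0 <= M -> (forall sigma, sigma \in r -> rnorm (E sigma a) <= M) ->
  rnorm (\sum_(sigma <- r) E sigma a) <= M.
Proof.
move=> ur /allP rT M0 rM; apply: rnorm_orth_le => //.
- move=> s s' /rT sT /rT s'T ss'; apply: (idom_orthogonal sT s'T ss').
    by apply: (idom_star pa); exact: component_in.
  exact: component_in.
- move=> s s' /rT sT /rT s'T ss'; apply: (idom_orthogonal sT s'T ss').
    exact: component_in.
  by apply: (idom_star pa); exact: component_in.
Qed.

(** The sums of components over large finite sets approximate [a]: this is clear
    for finite sums of elements of the ideals, and such sums are dense. *)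
Lemma component_approx a e : 0 < e -> exists2 r : seq {fset G}, all is_Tn r &
  forall r', uniq r' -> all is_Tn r' -> {subset r <= r'} ->
    rnorm (a - \sum_(sigma <- r') E sigma a) <= e.
Proof.
move=> e0; have e2 : 0 < e / 2 by rewrite divr_gt0.
have [b sb ab] := decomposes_dense decomposition_decomposes (a := a) I e2.
have [r rT hr] : exists2 r : seq {fset G}, all is_Tn r &
    forall r', uniq r' -> all is_Tn r' -> {subset r <= r'} ->
    b = \sum_(sigma <- r') E sigma b.
  pose finite_sum x := exists2 r : seq {fset G}, all is_Tn r &
    forall r', uniq r' -> all is_Tn r' -> {subset r <= r'} ->
    x = \sum_(sigma <- r') E sigma x.
  apply: (@lspan_min _ _ _ finite_sum _ _ _ sb) => [|c [rho _ rc]].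
    split.
      by exists [::] => // r' _ /allP rT' _; rewrite big_seq big1// => s /rT' /component0.
    move=> k x y [r rT hr] [s sT hs]; exists (r ++ s); first by rewrite all_cat rT.
    move=> r' ur' rT' sub.
    have ex : x = \sum_(sigma <- r') E sigma x.
      by apply: hr => // z zr; apply: sub; rewrite mem_cat zr.
    have ey : y = \sum_(sigma <- r') E sigma y.
      by apply: hs => // z zs; apply: sub; rewrite mem_cat zs orbT.
    rewrite {1}ex {1}ey scaler_sumr -big_split; apply: eq_big_seq => z zr'.
    by rewrite component_lin//; exact: (allP rT').
  exists [:: (rho : {fset G})]; first by rewrite /= is_TnP.
  move=> r' ur' /allP rT' sub; have rr' : (rho : {fset G}) \in r'.
    by apply: sub; rewrite mem_head.
  rewrite (bigD1_seq (rho : {fset G}))//= component_id//; last exact: is_TnP.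
  rewrite big_seq_cond big1 ?addr0// => s /andP[/rT' sT sr].
  by rewrite (@component_other s rho)//; exact: is_TnP.
exists r => // r' ur' rT' sub.
have -> : a - \sum_(sigma <- r') E sigma a = (a - b) - \sum_(sigma <- r') E sigma (a - b).
  have -> : \sum_(sigma <- r') E sigma (a - b) = \sum_(sigma <- r') E sigma a - b.
    rewrite [X in _ = _ - X](hr r')// -sumrB; apply: eq_big_seq => s sr'.
    by rewrite componentB//; exact: (allP rT').
  by rewrite opprB addrA subrK.
apply: le_trans (rnorm_subr_le _ _) _; rewrite [leRHS]splitr.
apply: lerD; first exact: ltW.
apply: rnorm_component_sum => //; first exact: ltW.
move=> s /(allP rT') sT; apply: le_trans (rnorm_component _ sT) _; exact: ltW.
Qed.

Lemma rnorm_le_component a M : 0 <= M ->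
  (forall sigma, is_Tn sigma -> rnorm (E sigma a) <= M) -> rnorm a <= M.
Proof.
move=> M0 aM; apply/ler_addgt0Pl => e e0; have [r rT hr] := component_approx a e0.
rewrite -[a](subrK (\sum_(sigma <- undup r) E sigma a)).
apply: le_trans (rnormD _ _) _.
have uT : all is_Tn (undup r) by apply/allP => s; rewrite mem_undup => /(allP rT).
apply: lerD.
  by apply: hr => //; [exact: undup_uniq | move=> s; rewrite mem_undup].
by apply: rnorm_component_sum => //; [exact: undup_uniq | move=> s /(allP uT)/aM].
Qed.

Lemma component_eq0 a : (forall sigma, is_Tn sigma -> E sigma a = 0) -> a = 0.
Proof.
move=> h; apply: rnorm0_eq0; apply/le_anti; rewrite rnorm_ge0 andbT.
by apply: rnorm_le_component => // s /h ->; rewrite rnorm0.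
Qed.

(** Membership in a closed ideal can be tested on components, because [a] is the
    limit of the sums of its components. *)
Lemma component_dom_in g a : (forall sigma, is_Tn sigma -> dom alpha g (E sigma a)) ->
  dom alpha g a.
Proof.
move=> h; apply: (closed_limit (@dom_closed _ _ _ _ _ pa g)) => r r0.
have [s sT hs] := component_approx a (divr_gt0 r0 (ltr0n _ 2)).
have uT : all is_Tn (undup s) by apply/allP => z; rewrite mem_undup => /(allP sT).
exists (\sum_(sigma <- undup s) E sigma a).
  by apply: subspace_sum_in (dom_subspace pa g) _ => z /(allP uT)/h.
apply: (@le_lt_trans _ _ (r / 2)); last by rewrite ltr_pdivrMr// mulr_natr mulr2n ltrDl.
by apply: hs => //; [exact: undup_uniq | move=> z; rewrite mem_undup].
Qed.

End Projections.

(** * The ideal of an orbit *)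

Section Restriction.
Context (R : realType) (G : groupType) (A : cstarAlgType R) (J : set A).
Context (alpha : pact_data G A) (pa : is_partial_action setT alpha).
Implicit Types (g h : G) (a b : A).

Lemma restr_pact : closed_ideal setT J -> (forall a, J a -> J (star a)) ->
  (forall g a, J a -> dom alpha g^-1%g a -> J (act alpha g a)) ->
  is_partial_action J (restr J alpha).
Proof.
move=> hJ Js Ja; have JJ := ideal_subspace hJ.
have dS g : star_subalgebra (J `&` dom alpha g).
  have [dl dm ds] := star_hom_dom (act_homV pa g).
  split=> [|a b [Ja' da] [Jb db]|a [Ja' da]].
  - by have := ideal_subspace (closed_idealI hJ (pact_ideal pa g)).
  - by split; [exact: (ideal_mull hJ) | exact: dm].
  - by split; [exact: Js | exact: ds].
split=> /=.
- split; last exact: ideal_closed hJ.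
  by split=> // a b _ Jb; exact: (ideal_mull hJ).
- move=> g; have [_ c l ml mr] := closed_idealI hJ (pact_ideal pa g).
  by split=> [a []//|//|//|a b _ Jb|a b Ja' _]; [exact: ml | exact: mr].
- move=> g; have [hf [h1 h2 h3]] := pact_iso pa g; split.
    split=> // [c a b [_ da] [_ db]|a b [_ da] [_ db]|a [_ da]].
    + exact: (star_homP hf).
    + exact: (star_homM hf).
    + exact: (star_homS hf).
  split=> [a /= [Ja' da]|a b /set_mem[_ da] /set_mem[_ db]|b /= [Jb db]].
  + by split; [exact: Ja | exact: h1].
  + by apply: h2; exact/mem_set.
  + exists (act alpha g^-1%g b); last exact: (actVK pa).
    by split; [apply: Ja; rewrite ?invgK | exact: (act_domV pa)].
- by rewrite (pact_dom1 pa) setIT.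
- by move=> a _; exact: (pact_act1 pa).
- move=> g h a [Ja' da] [Jb db].
  by have [d e] := pact_extends pa da db.
Qed.

End Restriction.

Section Orbits.
Context (G : groupType) (n : nat) (tau : Tn G n).
Implicit Types (g h : G) (sigma : {fset G}).

Definition translate_of sigma :=
  exists2 g, g \in (tau : {fset G}) & sigma = translate g^-1%g tau.

Lemma translate_of_Tn sigma : translate_of sigma -> is_Tn n sigma.
Proof. by move=> [g gt ->]; exact: is_Tn_translate (is_TnP tau) gt. Qed.

Lemma translate_of_translate g sigma : is_Tn n sigma -> g \in sigma ->
  translate_of (translate g^-1%g sigma) <-> translate_of sigma.
Proof.
move=> /andP[s1 _] gs; split=> [[k kt e]|[k kt e]]; last first.
  exists (k * g)%g; last by rewrite e translateM invgM.
  by move: gs; rewrite e in_translate invgK.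
have {}e : sigma = translate (g * k^-1)%g tau.
  by rewrite -translateM -e translateVK.
exists (k * g^-1)%g; last by rewrite invgM invgK.
by move: s1; rewrite e in_translate mulg1 invgM invgK.
Qed.

Lemma stabV h : stab tau h -> stab tau h^-1%g.
Proof. by rewrite /stab /= => {1}<-; rewrite translateK. Qed.

Lemma stab_in h : stab tau h -> h \in (tau : {fset G}).
Proof. by move=> <-; rewrite in_translate mulVg; exact: Tn1. Qed.

Lemma translate_stab h g : stab tau h -> translate (h * g)^-1%g tau = translate g^-1%g tau.
Proof. by move=> /stabV hs; rewrite invgM -translateM hs. Qed.

Lemma stab_mul h g : stab tau h -> ((h * g)%g \in (tau : {fset G})) = (g \in (tau : {fset G})).
Proof. by move=> {1}<-; rewrite in_translate mulKg. Qed.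

Section CosetRepresentatives.
Variable x : 'I_(stab_index tau).+1 -> G.
Hypothesis xr : coset_representatives x.

Lemma rcoset_rep k : rcoset (stab tau) (x k) (x k).
Proof. by exists 1%g; rewrite ?mul1g//= /stab /= translate1. Qed.

Lemma rep_in k : x k \in (tau : {fset G}).
Proof.
have : (\bigcup_j rcoset (stab tau) (x j)) (x k) by exists k => //; exact: rcoset_rep.
by rewrite -(coset_rep_cover xr).
Qed.

Lemma coset_rep_exists g : g \in (tau : {fset G}) ->
  exists k, rcoset (stab tau) (x k) g.
Proof.
move=> gt; have : [set` (tau : {fset G})] g by [].
by rewrite (coset_rep_cover xr) => -[k _ h]; exists k.
Qed.

Lemma rcoset_in k g : rcoset (stab tau) (x k) g -> g \in (tau : {fset G}).
Proof. by move=> [h hs <-]; rewrite stab_mul//; exact: rep_in. Qed.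

Lemma translate_rcoset k g : rcoset (stab tau) (x k) g ->
  translate g^-1%g tau = translate (x k)^-1%g tau.
Proof. by move=> [h hs <-]; rewrite translate_stab. Qed.

Lemma rep_inj j k : translate (x j)^-1%g tau = translate (x k)^-1%g tau -> j = k.
Proof.
move=> e; apply: (coset_rep_disjoint xr) => //; exists (x k); split.
  exists (x k * (x j)^-1)%g; last by rewrite mulgVK.
  by rewrite /stab /= -translateM e translateVK.
exact: rcoset_rep.
Qed.

End CosetRepresentatives.

End Orbits.

Section OrbitIdeal.
Context (R : realType) (G : groupType) (A : cstarAlgType R) (n : nat).
Context (alpha : pact_data G A) (pa : is_partial_action setT alpha).
Hypothesis dec : decomposition_property n alpha.
Context (tau : Tn G n) (x : 'I_(stab_index tau).+1 -> G).
Hypothesis xr : coset_representatives x.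
Implicit Types (g h : G) (a b c : A) (sigma rho : {fset G}).
Local Open Scope complex_scope.

Local Notation E := (component alpha).
Local Notation J := (orbit_ideal alpha tau).

Let orb k : {fset G} := translate (x k)^-1%g tau.

Let orbT k : is_Tn n (orb k).
Proof. exact: is_Tn_translate (is_TnP tau) (rep_in xr k). Qed.

Lemma orbit_component_sum a :
  (forall sigma, is_Tn n sigma -> ~ translate_of tau sigma -> E sigma a = 0) ->
  a = \sum_k E (orb k) a.
Proof.
move=> h; apply/eqP; rewrite -subr_eq0; apply/eqP/(component_eq0 pa dec) => s sT.
rewrite (componentB pa dec)// (component_sum pa dec)//.
have [[g gt ge]|so] := pselect (translate_of tau s); last first.
  rewrite h// big1 ?subrr// => k _.
  rewrite (component_other pa dec sT (orbT k))//; last exact: (component_in pa dec).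
  by apply/eqP => e; apply: so; exists (x k); [exact: (rep_in xr) | rewrite e].
have [k gk] := coset_rep_exists xr gt.
have sk : s = orb k by rewrite ge (translate_rcoset gk).
rewrite (bigD1 k)//= big1 => [|i ik].
  by rewrite addr0 sk (component_id pa dec (orbT k) (component_in pa dec a (orbT k))) subrr.
rewrite (component_other pa dec sT (orbT i))//; last exact: (component_in pa dec).
by apply: contra_neq ik => e; apply: (rep_inj xr); rewrite -/(orb i) -e sk.
Qed.

(** The ideal of an orbit consists of the elements without components outside the
    orbit; in this form its closedness and invariance are evident. *)
Lemma orbit_idealP a : J a <->
  forall sigma, is_Tn n sigma -> ~ translate_of tau sigma -> E sigma a = 0.
Proof.
split=> [[b tb ->] s sT so|h].
  rewrite (component_sum pa dec)// big_seq big1// => g gi.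
  have [k kt gk] : exists2 k, k \in (tau : {fset G}) & g = k^-1%g.
    by have /imfsetP[k /= kt ->] := gi; exists k.
  have gT : is_Tn n (translate g tau).
    by rewrite gk; exact: is_Tn_translate (is_TnP tau) kt.
  rewrite (component_other pa dec sT gT)//; last exact: tb.
  by apply/eqP => e; apply: so; exists k; rewrite // e gk.
(* Several [g] give the same ideal [A_(g tau)]; its component is attached to the
   inverse of the coset representative. *)
exists (fun g => \sum_(k | (x k)^-1%g == g) E (translate g tau) a) => [g gi|].
  rewrite -big_filter; apply: subspace_sum_in => [|k].
    have /imfsetP[k /= kt ->] := gi.
    exact: ideal_subspace (is_Tn_ideal pa (is_Tn_translate (is_TnP tau) kt)).
  by rewrite mem_filter => /andP[/eqP <- _]; exact: (component_in pa dec a (orbT k)).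
rewrite (exchange_big_dep xpredT)//= [LHS]orbit_component_sum//.
apply: eq_bigr => k _.
have ki : (x k)^-1%g \in inverses tau by rewrite in_imfset//; exact: (rep_in xr).
rewrite big_mkcond (bigD1_seq (x k)^-1%g)//= ?fset_uniq// eqxx big1 ?addr0// => g.
by rewrite eq_sym => /negPf ->.
Qed.

Lemma orbit_ideal_ideal : closed_ideal setT J.
Proof.
split=> //.
- apply/closedP => a ha; apply/orbit_idealP => s sT so.
  apply: rnorm_le0 => e /ha[b /orbit_idealP Jb ab].
  rewrite -[E s a]subr0 -(Jb s)// -(componentB pa dec)//.
  by apply: le_trans (rnorm_component pa dec _ sT) _; exact: ltW.
- split; first by apply/orbit_idealP => s sT _; exact: (component0 pa dec).
  move=> c a b /orbit_idealP Ja /orbit_idealP Jb; apply/orbit_idealP => s sT so.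
  by rewrite (component_lin pa dec)// Ja// Jb// scaler0 addr0.
- move=> a b _ /orbit_idealP Jb; apply/orbit_idealP => s sT so.
  by rewrite (componentM pa dec)// Jb// cmul0r.
- move=> a b /orbit_idealP Ja _; apply/orbit_idealP => s sT so.
  by rewrite (componentM pa dec)// Ja// cmul0l.
Qed.

Lemma orbit_ideal_star a : J a -> J (star a).
Proof.
move=> /orbit_idealP Ja; apply/orbit_idealP => s sT so.
by rewrite (component_star pa dec)// Ja// star0.
Qed.

Lemma orbit_ideal_act g a : J a -> dom alpha g^-1%g a -> J (act alpha g a).
Proof.
move=> /orbit_idealP Ja ga; apply/orbit_idealP => s sT so.
have [gs|gs] := boolP (g \in s); last first.
  by rewrite (component_dom pa dec sT gs)//; exact: (act_dom pa).
rewrite (component_act pa dec)// Ja ?(act0 pa)//; first exact: is_Tn_translate.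
by move=> /(translate_of_translate _ sT gs).
Qed.

Lemma orbit_ideal_pact : is_partial_action J (restr J alpha).
Proof.
apply: (restr_pact pa); first exact: orbit_ideal_ideal.
  exact: orbit_ideal_star.
exact: orbit_ideal_act.
Qed.

Lemma idom_orbit_ideal sigma a : translate_of tau sigma -> idom alpha sigma a -> J a.
Proof.
move=> so sa; apply/orbit_idealP => s sT sn.
rewrite (component_other pa dec sT (translate_of_Tn so))//.
by apply/eqP => e; apply: sn; rewrite e.
Qed.

Lemma orbit_ideal_decomposes : decomposes J n (restr J alpha).
Proof.
split=> [a /orbit_idealP Ja r r0|rho g a gr ra [_ ga]].
  exists a; last by rewrite subrr rnorm0.
  rewrite {1}(orbit_component_sum Ja).
  apply: subspace_sum_in => [|k _]; first exact: lspan_subspace.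
  apply: sub_lspan; exists (exist _ (orb k) (orbT k)) => // g go.
  split; last exact: (component_in pa dec a (orbT k)).
  apply: (idom_orbit_ideal _ (component_in pa dec a (orbT k))).
  by exists (x k) => //; exact: (rep_in xr).
apply: (idom_disjoint_dom dec (is_TnP rho) gr _ ga).
by move=> h /ra[].
Qed.

Lemma orbit_projE a k : J a -> orbit_proj alpha tau x k a = E (orb k) a.
Proof.
move=> /orbit_idealP Ja; rewrite /orbit_proj; set P := [set b | _].
have : P (xget (fun=> 0) P).
  apply: xgetPex; exists (fun k => E (orb k) a); split => [j|].
    exact: (component_in pa dec a (orbT j)).
  exact: orbit_component_sum.
move: (xget _ P) => b [bo ->].
rewrite (component_sum pa dec)// (bigD1 k)//= (component_id pa dec) ?big1 ?addr0//; first last.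
  exact: bo.
move=> i ik; rewrite (component_other pa dec (orbT k) (orbT i))//; last exact: bo.
by apply: contra_neq ik => e; apply: (rep_inj xr); rewrite -/(orb i) -e.
Qed.

End OrbitIdeal.

(** * Bounded families vanishing at infinity *)

Section BoundedFamilies.
Context (R : realType) (I : Type) (A : cstarAlgType R).
Implicit Types (f g : linf I A) (i : I) (r M : R).

Lemma rnorm_coord f i : rnorm (f i) <= rnorm f.
Proof. exact: le_linf_norm. Qed.

Lemma rnorm_linf_le f M : 0 <= M -> (forall i, rnorm (f i) <= M) -> rnorm f <= M.
Proof. exact: linf_norm_le. Qed.

Lemma to_linfE (u : I -> A) M i : (forall i, rnorm (u i) <= M) -> to_linf u i = u i.
Proof.
move=> uM; have ub : u \in @bounded_family R I A by apply/bounded_familyP; exists M.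
by rewrite /to_linf (insubdK _ ub).
Qed.

Lemma linfBE f g i : (f - g) i = f i - g i. Proof. by []. Qed.
Lemma linf0E i : (0 : linf I A) i = 0. Proof. by []. Qed.
Lemma linfME f g i : (f ** g) i = f i ** g i. Proof. by []. Qed.
Lemma linf_starE f i : (star f) i = star (f i). Proof. by []. Qed.

(** [f] vanishes at infinity along the map [p]: for [p] the projection onto the
    right cosets this is the condition on induced algebras, for [p] the identity
    it is the one on direct sums. *)
Definition vanishing (K : Type) (p : I -> K) f :=
  forall r, 0 < r -> finite_set (p @` [set i | r <= rnorm (f i)]).

Variables (K : Type) (p : I -> K).

Lemma vanishing_le (f g : linf I A) M : 0 <= M ->
  (forall i, rnorm (f i) <= M * rnorm (g i)) -> vanishing p g -> vanishing p f.
Proof.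
move=> M0 fg vg r r0; have M1 : 0 < M + 1 by rewrite ltr_pwDr.
apply: sub_finite_set (vg _ (divr_gt0 r0 M1)); apply: image_subset => i /= ri.
rewrite ler_pdivrMr// mulrC; apply: le_trans ri (le_trans (fg i) _).
by rewrite ler_wpM2r ?rnorm_ge0// lerDl.
Qed.

Lemma vanishing_lin (c : R[i]) f g :
  vanishing p f -> vanishing p g -> vanishing p (c *: f + g).
Proof.
move=> vf vg r r0; have cf : vanishing p (c *: f).
  apply: (vanishing_le (M := complex.Re `|c|)) vf; first exact: Re_norm_ge0.
  by move=> i; rewrite linfZE rnormZ.
have r2 : 0 < r / 2 by rewrite divr_gt0.
apply: (@sub_finite_set _ _ (p @` [set i | r / 2 <= rnorm ((c *: f) i)] `|`
  p @` [set i | r / 2 <= rnorm (g i)])).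
  move=> _ [i /= ri <-]; have [h|h] := leP (r / 2) (rnorm ((c *: f) i)).
    by left; exists i.
  right; exists i => //=; rewrite leNgt; apply/negP => h'.
  move: ri; rewrite leNgt => /negP; apply.
  apply: (@le_lt_trans _ _ (rnorm ((c *: f) i) + rnorm (g i))); first exact: rnormD.
  by rewrite [ltRHS]splitr ltrD.
by rewrite finite_setU; split; [exact: cf | exact: vg].
Qed.

Lemma vanishing0 : vanishing p 0.
Proof.
move=> r r0; apply: (@sub_finite_set _ _ set0) => // y [i /= h _].
by move: h; rewrite leNgt [rnorm _]rnorm0 r0.
Qed.

Lemma vanishing_mul f g : vanishing p f -> vanishing p (f ** g).
Proof.
apply: (vanishing_le (M := rnorm g)); first exact: rnorm_ge0.
by move=> i; rewrite linfME mulrC; apply: le_rnormM => //; exact: rnorm_coord.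
Qed.

Lemma vanishing_star f : vanishing p f -> vanishing p (star f).
Proof.
apply: (vanishing_le (M := 1)) => // i; by rewrite linf_starE rnorm_star mul1r.
Qed.

Lemma vanishing_limit f :
  (forall r, 0 < r -> exists2 g, vanishing p g & rnorm (f - g) < r) -> vanishing p f.
Proof.
move=> h r r0; have r2 : 0 < r / 2 by rewrite divr_gt0.
have [g vg fg] := h _ r2; apply: sub_finite_set (vg _ r2).
apply: image_subset => i /= ri; rewrite -(lerD2l (r / 2)) -splitr.
apply: le_trans ri _; rewrite -[f i](subrK (g i)); apply: le_trans (rnormD _ _) _.
by rewrite lerD2r; apply: le_trans (ltW fg); exact: (rnorm_coord (f - g)).
Qed.

End BoundedFamilies.

Section GlobalActions.
Context (R : realType) (G : groupType) (B : cstarAlgType R) (T : set B).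

Lemma action_intro (beta : G -> B -> B) : cstar_subalgebra T ->
  (forall g, star_hom T (beta g)) -> (forall g b, T b -> T (beta g b)) ->
  (forall b, T b -> beta 1%g b = b) ->
  (forall g h b, T b -> beta (g * h)%g b = beta g (beta h b)) ->
  is_action T beta.
Proof.
move=> hT bh bT b1 bM; have [[Tl Tm Ts] Tc] := hT.
split=> //= [g|g|g h a Ta _]; last by split=> //; exact: bM.
  by split=> // a b Ta Tb; exact: Tm.
split=> //; split=> [b /= /bT//|a b /set_mem Ta /set_mem Tb e|b /= Tb].
  by rewrite -(b1 _ Ta) -(b1 _ Tb) -(mulVg g) !bM// e.
by exists (beta g^-1%g b); rewrite -?bM ?mulgV ?b1//; exact: bT.
Qed.

Lemma eq_enveloping_action (A : cstarAlgType R) (S : set A) (alpha : pact_data G A)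
    (beta : G -> B -> B) (i i' : A -> B) : (forall a, S a -> i a = i' a) ->
  enveloping_action S alpha T beta i -> enveloping_action S alpha T beta i'.
Proof.
move=> ii [pa ac hm inj idl dm at' sp].
have im (X : set A) : X `<=` S -> i' @` X = i @` X.
  by move=> XS; apply/seteqP; split=> _ [a Xa <-]; exists a; rewrite // ii//; exact: XS.
have [[[Sl Sm Ss] _] id1 _ _ _ _] := pa.
have dS g : dom alpha g `<=` S := ideal_sub (id1 g).
split=> //.
- split=> [//|c a b Sa Sb|a b Sa Sb|a Sa].
  + by rewrite -!ii//; [exact: (star_homP hm) | exact: (subspaceP Sl)].
  + by rewrite -!ii//; [exact: (star_homM hm) | exact: Sm].
  + by rewrite -!ii//; [exact: (star_homS hm) | exact: Ss].
- move=> a b Sa Sb; rewrite -!ii; [exact: inj | exact: set_mem Sb | exact: set_mem Sa].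
- by rewrite im.
- by move=> g; rewrite !im.
- move=> g a da; have [h1 [h2 _ _]] := pact_iso pa g.
  by rewrite -!ii ?at'//; [exact: dS da | apply: dS; exact: h2].
rewrite sp; congr (closure (lspan _)); apply/seteqP; split=> b [g [a Sa ->]];
  by exists g, a; rewrite // ii.
Qed.

End GlobalActions.

(** * The induced algebra as enveloping algebra of an orbit *)

Section Induced.
Context (R : realType) (G : groupType) (A : cstarAlgType R) (n : nat).
Context (alpha : pact_data G A) (pa : is_partial_action setT alpha).
Context (tau : Tn G n).
Implicit Types (g h k : G) (a b c : A) (xi eta : linf G A) (r : R).
Local Open Scope complex_scope.

Local Notation T := (Ind (stab tau) (idom alpha tau) (act alpha)).

Lemma IndP xi : T xi <-> [/\ forall g, idom alpha tau (xi g),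
  forall h g, stab tau h -> xi (h * g)%g = act alpha h (xi g) &
  vanishing (rcoset (stab tau)) xi].
Proof. by []. Qed.

Let C_ideal : closed_ideal setT (idom alpha tau).
Proof. exact: (Tn_ideal pa). Qed.

Lemma stab_dom h a : stab tau h -> idom alpha tau a -> dom alpha h^-1%g a.
Proof. by move=> /stabV /stab_in ht; apply. Qed.

Lemma Ind_cstar : cstar_subalgebra T.
Proof.
have Cl := ideal_subspace C_ideal; split; last first.
  apply/closedP => xi lim; apply/IndP; split.
  - move=> g; apply: (closed_limit (ideal_closed C_ideal)) => r /lim[eta [Te _ _] d].
    by exists (eta g) => //; apply: le_lt_trans d; exact: (rnorm_coord (xi - eta)).
  - move=> h g hs; have Cx : idom alpha tau (xi g).
      apply: (closed_limit (ideal_closed C_ideal)) => r /lim[eta [Te _ _] d].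
      by exists (eta g) => //; apply: le_lt_trans d; exact: (rnorm_coord (xi - eta)).
    apply/eqP; rewrite -subr_eq0; apply/eqP/rnorm_le0 => e e0.
    have [eta [Te et _] d] := lim _ (divr_gt0 e0 (ltr0n _ 2)).
    rewrite -(subrKA (eta (h * g)%g)) [leRHS]splitr.
    apply: le_trans (rnormD _ _) _; apply: lerD.
      by apply: le_trans (ltW d); exact: (rnorm_coord (xi - eta)).
    have d1 := stab_dom hs Cx; have d2 := stab_dom hs (Te g).
    rewrite et// -(star_homB (act_hom pa h))// (rnorm_act pa); last first.
      exact: (subspaceB (dom_subspace pa _)).
    by rewrite rnormB; apply: le_trans (ltW d); exact: (rnorm_coord (xi - eta)).
  - by apply: vanishing_limit => r /lim[eta [_ _ ve] d]; exists eta.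
split.
- split.
    split=> [g|h g _|]; [exact: (subspace0 Cl) | by rewrite (act0 pa) | exact: vanishing0].
  move=> c xi eta [Tx xt vx] [Te et ve]; split=> [g|h g hs|].
  + exact: (subspaceP Cl c (Tx g) (Te g)).
  + rewrite linfDE linfZE xt// et//.
    by rewrite -(star_homP (act_hom pa h))//; exact: stab_dom.
  + exact: vanishing_lin.
- move=> xi eta [Tx xt vx] [Te et ve]; split=> [g|h g hs|].
  + by apply: (ideal_mull C_ideal) => //; exact: Te.
  + by rewrite linfME xt// et// -(star_homM (act_hom pa h))//; exact: stab_dom.
  + exact: vanishing_mul.
- move=> xi [Tx xt vx]; split=> [g|h g hs|].
  + exact: (idom_star pa (Tx g)).
  + by rewrite linf_starE xt// -(star_homS (act_hom pa h))//; exact: stab_dom.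
  + exact: vanishing_star.
Qed.

Lemma Ind_actE g xi k : Ind_act g xi k = xi (k * g)%g.
Proof. by apply: (to_linfE (M := rnorm xi)) => i; exact: rnorm_coord. Qed.

Lemma rnorm_Ind_act g xi : rnorm (Ind_act g xi) <= rnorm xi.
Proof.
apply: rnorm_linf_le => [|k]; first exact: rnorm_ge0.
by rewrite Ind_actE rnorm_coord.
Qed.

Lemma Ind_act_in g xi : T xi -> T (Ind_act g xi).
Proof.
move=> [Tx xt vx]; split=> [k|h k hs|r r0].
- by rewrite Ind_actE; exact: Tx.
- by rewrite !Ind_actE -mulgA; exact: xt.
- pose s (X : set G) := [set y | X (y * g)%g].
  apply: (@sub_finite_set _ _ (s @` (rcoset (stab tau) @` [set i | r <= rnorm (xi i)]))).
    move=> _ [k /= rk <-]; exists (rcoset (stab tau) (k * g)%g).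
      by exists (k * g)%g => //=; rewrite -Ind_actE.
    apply/seteqP; split=> y [h hs /= e]; exists h => //=.
      by apply: (mulIg g); rewrite -mulgA.
    by rewrite -e mulgA.
  by apply: finite_image; exact: vx.
Qed.

Lemma Ind_action : is_action T (@Ind_act R G A).
Proof.
apply: action_intro; first exact: Ind_cstar.
- move=> g; split; first by have [] := Ind_cstar.
  + by move=> c xi eta _ _; apply: linfP => k; rewrite linfDE linfZE !Ind_actE.
  + by move=> xi eta _ _; apply: linfP => k; rewrite linfME !Ind_actE.
  + by move=> xi _; apply: linfP => k; rewrite linf_starE !Ind_actE.
- exact: Ind_act_in.
- by move=> xi _; apply: linfP => k; rewrite Ind_actE mulg1.
- by move=> g h xi _; apply: linfP => k; rewrite !Ind_actE mulgA.
Qed.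

End Induced.

Section OrbitMap.
Context (R : realType) (G : groupType) (A : cstarAlgType R) (n : nat).
Context (alpha : pact_data G A) (pa : is_partial_action setT alpha).
Hypothesis dec : decomposition_property n alpha.
Context (tau : Tn G n).
Implicit Types (g h : G) (a b c : A) (xi eta : linf G A) (r : R).
Local Open Scope complex_scope.

Local Notation E := (component alpha).
Local Notation J := (orbit_ideal alpha tau).
Local Notation T := (Ind (stab tau) (idom alpha tau) (act alpha)).

(** The map [iota_tau], written without coset representatives and extended by
    zero to the other orbit ideals; a global [iota] is then assembled from these
    maps without splitting its argument first. *)
Definition orbit_map a : linf G A :=
  to_linf (fun g => if g \in (tau : {fset G})
                    then act alpha g (E (translate g^-1%g tau) a) else 0).

Let tT g : g \in (tau : {fset G}) -> is_Tn n (translate g^-1%g tau).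
Proof. exact: is_Tn_translate (is_TnP tau). Qed.

Let comp_dom g a : g \in (tau : {fset G}) ->
  dom alpha g^-1%g (E (translate g^-1%g tau) a).
Proof.
move=> gt; apply: (component_in pa dec a (tT gt)).
by rewrite /= in_translate invgK mulgV; exact: Tn1.
Qed.

Let orbit_map_bound a g : rnorm (if g \in (tau : {fset G})
  then act alpha g (E (translate g^-1%g tau) a) else 0) <= rnorm a.
Proof.
case: ifP => gt; last by rewrite rnorm0 rnorm_ge0.
by rewrite (rnorm_act pa) ?(rnorm_component pa dec)//; [exact: tT | exact: comp_dom].
Qed.

Lemma orbit_mapE a g : orbit_map a g = if g \in (tau : {fset G})
  then act alpha g (E (translate g^-1%g tau) a) else 0.
Proof. exact: (to_linfE (M := rnorm a)). Qed.

Lemma orbit_map_in a g : g \in (tau : {fset G}) ->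
  orbit_map a g = act alpha g (E (translate g^-1%g tau) a).
Proof. by rewrite orbit_mapE => ->. Qed.

Lemma orbit_map_out a g : g \notin (tau : {fset G}) -> orbit_map a g = 0.
Proof. by rewrite orbit_mapE => /negPf ->. Qed.

Lemma rnorm_orbit_map a : rnorm (orbit_map a) <= rnorm a.
Proof.
apply: rnorm_linf_le => [|g]; first exact: rnorm_ge0.
by rewrite orbit_mapE.
Qed.

Lemma rnorm_orbit_map_coord a g : g \in (tau : {fset G}) ->
  rnorm (orbit_map a g) = rnorm (E (translate g^-1%g tau) a).
Proof. by move=> gt; rewrite orbit_map_in// (rnorm_act pa)//; exact: comp_dom. Qed.

Lemma orbit_map_lin (c : R[i]) a b :
  orbit_map (c *: a + b) = c *: orbit_map a + orbit_map b.
Proof.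
apply: linfP => g; rewrite linfDE linfZE !orbit_mapE.
case: ifP => gt; last by rewrite scaler0 addr0.
rewrite (component_lin pa dec) ?(star_homP (act_hom pa g))//; last exact: tT.
  exact: comp_dom.
exact: comp_dom.
Qed.

Lemma orbit_mapM a b : orbit_map (a ** b) = orbit_map a ** orbit_map b.
Proof.
apply: linfP => g; rewrite linfME !orbit_mapE.
case: ifP => gt; last by rewrite cmul0r.
rewrite (componentM pa dec) ?(star_homM (act_hom pa g))//; last exact: tT.
  exact: comp_dom.
exact: comp_dom.
Qed.

Lemma orbit_map_star a : orbit_map (star a) = star (orbit_map a).
Proof.
apply: linfP => g; rewrite linf_starE !orbit_mapE.
case: ifP => gt; last by rewrite star0.
rewrite (component_star pa dec) ?(star_homS (act_hom pa g))//; last exact: tT.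
exact: comp_dom.
Qed.

Lemma orbit_map_Ind a : T (orbit_map a).
Proof.
apply/IndP; split.
- move=> g; rewrite orbit_mapE; case: ifP => gt; last first.
    exact: subspace0 (ideal_subspace (Tn_ideal pa tau)).
  have gt' : g^-1%g \in translate g^-1%g tau.
    by rewrite in_translate invgK mulgV; exact: Tn1.
  by have := act_idom pa gt' (component_in pa dec a (tT gt)); rewrite translateVK.
- move=> h g hs; rewrite !orbit_mapE stab_mul//.
  case: ifP => gt; last by rewrite (act0 pa).
  rewrite translate_stab//; apply: (actM pa); first exact: comp_dom.
  rewrite -(translate_stab g hs); apply: comp_dom.
  by rewrite stab_mul.
- move=> r r0; apply: finite_image.
  apply: (@sub_finite_set _ _ [set` (tau : {fset G})]) => // g /=.
  by rewrite orbit_mapE; case: ifP => // _; rewrite rnorm0 leNgt r0.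
Qed.

(** [kg] lies in [tau] exactly if [g] lies in [k^-1 tau]; where only one of [k] and
    [kg] lies in [tau], the component concerned vanishes, as [a] is in the domain
    of [alpha_g]. *)
Lemma orbit_map_act g a : dom alpha g^-1%g a ->
  orbit_map (act alpha g a) = Ind_act g (orbit_map a).
Proof.
move=> ga; apply: linfP => k; rewrite Ind_actE !orbit_mapE.
case: ifP => kt; case: ifP => kgt.
- have gk : g \in translate k^-1%g tau by rewrite in_translate invgK.
  rewrite (component_act pa dec (tT kt))// translateM -invgM.
  symmetry; apply: (actM pa); last exact: comp_dom.
  apply: (component_in pa dec a (tT kgt)).
  by rewrite /= in_translate invgK mulgK.
- rewrite (component_dom pa dec (g := g) (tT kt)) ?(act0 pa)//.
    by rewrite in_translate invgK kgt.
  exact: (act_dom pa).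
- rewrite (component_dom pa dec (g := g^-1%g) (tT kgt)) ?(act0 pa)//.
  by rewrite in_translate invgK mulgK kt.
- by [].
Qed.

(** Every element of the induced algebra that is supported in [tau] is determined
    by its values at the coset representatives, which give the components of its
    preimage. *)
Lemma orbit_map_surj (x : 'I_(stab_index tau).+1 -> G) xi :
  coset_representatives x -> T xi -> (forall g, g \notin (tau : {fset G}) -> xi g = 0) ->
  exists2 a, J a & orbit_map a = xi.
Proof.
move=> xr [Tx xt _] x0; pose b k := act alpha (x k)^-1%g (xi (x k)).
have bk k : idom alpha (translate (x k)^-1%g tau) (b k).
  by apply: (act_idomV pa) => //; exact: (rep_in xr).
have bT k : is_Tn n (translate (x k)^-1%g tau) by apply: tT; exact: (rep_in xr).
exists (\sum_k b k).
  apply: subspace_sum_in => [|k _].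
    exact: ideal_subspace (orbit_ideal_ideal pa dec xr).
  apply: (idom_orbit_ideal pa dec xr _ (bk k)).
  by exists (x k) => //; exact: (rep_in xr).
apply: linfP => g; rewrite orbit_mapE; case: ifP => gt; last by rewrite x0// gt.
have [k gk] := coset_rep_exists xr gt.
rewrite (translate_rcoset gk) (component_sum pa dec)// (bigD1 k)//= big1 => [|i ik].
  rewrite addr0 (component_id pa dec)//; have [h hs <-] := gk.
  rewrite xt// /b.
  have xd : dom alpha (x k) (xi (x k)) by apply: Tx; exact: (rep_in xr).
  rewrite (actM pa) ?(actVK pa)//; first exact: (act_domV pa).
  apply: bk; rewrite /= in_translate invgK invgM mulgA mulgV mul1g.
  exact: stab_in (stabV hs).
rewrite (component_other pa dec (bT k) (bT i))//.
by apply: contra_neq ik => e; apply: (rep_inj xr).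
Qed.

Lemma orbit_map_eq0 (x : 'I_(stab_index tau).+1 -> G) a :
  coset_representatives x -> J a -> orbit_map a = 0 -> a = 0.
Proof.
move=> xr /(orbit_idealP pa dec xr) Ja a0; apply: (component_eq0 pa dec) => s sT.
have [[g gt ->]|so] := pselect (translate_of tau s); last exact: Ja.
by apply: rnorm0_eq0; rewrite -(rnorm_orbit_map_coord a gt) a0 linf0E rnorm0.
Qed.

Lemma orbit_map_image (x : 'I_(stab_index tau).+1 -> G) : coset_representatives x ->
  orbit_map @` J =
  T `&` [set xi | forall g, g \notin (tau : {fset G}) -> xi g = 0].
Proof.
move=> xr; apply/seteqP; split=> xi.
  move=> [a _ <-]; split; first exact: orbit_map_Ind.
  by move=> g; exact: orbit_map_out.
by move=> [Tx x0]; have [a Ja <-] := orbit_map_surj xr Tx x0; exists a.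
Qed.

End OrbitMap.

Section OrbitEnveloping.
Context (R : realType) (G : groupType) (A : cstarAlgType R) (n : nat).
Context (alpha : pact_data G A) (pa : is_partial_action setT alpha).
Hypothesis dec : decomposition_property n alpha.
Context (tau : Tn G n) (x : 'I_(stab_index tau).+1 -> G).
Hypothesis xr : coset_representatives x.
Implicit Types (g h : G) (a b c : A) (xi eta : linf G A) (r : R).
Local Open Scope complex_scope.

Local Notation E := (component alpha).
Local Notation J := (orbit_ideal alpha tau).
Local Notation H := (stab tau).
Local Notation T := (Ind (stab tau) (idom alpha tau) (act alpha)).
Local Notation iota := (orbit_map alpha tau).

Let translates := [set b | exists g, exists2 a, J a & b = Ind_act g (iota a)].

Lemma stab_mulgP h g : H h -> H (h * g)%g <-> H g.
Proof.
move=> hs; split=> [|gs]; rewrite /stab /= -translateM.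
  by move=> e; rewrite -[LHS](translateK h) e; exact: stabV.
by rewrite gs.
Qed.

(** The part of [xi] over one coset is a translate of a section supported in the
    stabiliser, which is contained in [tau], so that this section is in the image
    of the orbit ideal. *)
Lemma coset_section_in_span xi g0 : T xi ->
  exists2 eta, translates eta & forall g,
    (rcoset H g0 g -> eta g = xi g) /\ (~ rcoset H g0 g -> eta g = 0).
Proof.
move=> [Tx xt vx]; pose u k := if k \in H then xi (k * g0)%g else 0.
have ub k : rnorm (u k) <= rnorm xi.
  by rewrite /u; case: ifP => _; rewrite ?rnorm_coord// rnorm0 rnorm_ge0.
pose eta0 := to_linf u; have e0 k : eta0 k = u k by exact: (to_linfE k ub).
have Te : T eta0.
  apply/IndP; split=> [k|h k hs|r r0].
  - rewrite e0 /u; case: ifP => _; first exact: Tx.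
    exact: subspace0 (ideal_subspace (Tn_ideal pa tau)).
  - rewrite !e0 /u; have [/set_mem kH|kH] := boolP (k \in H).
      have -> : (h * k)%g \in H by apply/mem_set/(stab_mulgP _ hs).
      by rewrite -mulgA; exact: xt.
    rewrite ifF ?(act0 pa)//; apply/negP => /set_mem/(stab_mulgP _ hs) kH'.
    by move: kH; rewrite mem_set.
  - apply: finite_image; apply: (@sub_finite_set _ _ [set` (tau : {fset G})]) => //.
    move=> k /=; rewrite e0 /u; case: ifP => [/set_mem/stab_in//|_].
    by rewrite rnorm0 leNgt r0.
have e0out g : g \notin (tau : {fset G}) -> eta0 g = 0.
  move=> gt; rewrite e0 /u ifF//; apply/negP => /set_mem/stab_in.
  by rewrite (negPf gt).
have [a Ja aE] := orbit_map_surj pa dec xr Te e0out.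
exists (Ind_act g0^-1%g (iota a)); first by exists g0^-1%g, a.
move=> g; rewrite Ind_actE aE e0 /u; split=> [[h hs <-]|gn].
  by rewrite mulgK (mem_set hs).
rewrite ifF//; apply/negP => /set_mem gH; apply: gn.
by exists (g * g0^-1)%g => //=; rewrite mulgVK.
Qed.

Lemma cosets_section_in_span xi (s : seq G) : T xi ->
  exists2 zeta, lspan translates zeta & forall g,
    ((exists2 g0, g0 \in s & rcoset H g0 g) -> zeta g = xi g) /\
    (~ (exists2 g0, g0 \in s & rcoset H g0 g) -> zeta g = 0).
Proof.
move=> Tx; elim: s => [|g1 s [zeta Vz hz]].
  exists 0; first exact: subspace0 (lspan_subspace translates).
  by move=> g; split=> // -[].
have [[g2 g2s [h hs hg1]]|new] := pselect (exists2 g2, g2 \in s & rcoset H g2 g1).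
  exists zeta => // g; split=> [[g0]|no].
    rewrite in_cons => /orP[/eqP -> [h' hs' <-]|g0s gg0]; last by apply: (hz g).1; exists g0.
    apply: (hz _).1; exists g2 => //; exists (h' * h)%g; last by rewrite -mulgA hg1.
    exact/(stab_mulgP _ hs').
  apply: (hz g).2 => -[g0 g0s gg0]; apply: no; exists g0 => //.
  by rewrite in_cons g0s orbT.
have [eta Ve he] := coset_section_in_span g1 Tx.
exists (zeta + eta).
  by apply: (subspaceD (lspan_subspace _)) => //; exact: sub_lspan.
move=> g; rewrite linfDE; have [g1g|g1g] := pselect (rcoset H g1 g).
  have -> : zeta g = 0.
    apply: (hz g).2 => -[g0 g0s [h hs hg]]; apply: new; exists g0 => //.
    have [h' hs' hg'] := g1g; exists (h'^-1 * h)%g.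
      exact/(stab_mulgP _ (stabV hs'))/hs.
    by rewrite -mulgA hg -hg' mulKg.
  rewrite (he g).1// add0r; split=> // no; case: no.
  by exists g1; rewrite // mem_head.
rewrite (he g).2// addr0; split=> [[g0]|no].
  rewrite in_cons => /orP[/eqP ->//|g0s gg0].
  by apply: (hz g).1; exists g0.
apply: (hz g).2 => -[g0 g0s gg0]; apply: no; exists g0 => //.
by rewrite in_cons g0s orbT.
Qed.

(** As [xi] vanishes at infinity, it is approximated by its part over finitely
    many cosets. *)
Lemma Ind_dense : T = closure (lspan translates).
Proof.
apply/seteqP; split=> [xi Tx|xi /closureP lim].
  apply/closureP => r r0; have [_ _ vx] := Tx; have r2 : 0 < r / 2 by rewrite divr_gt0.
  have /finite_seqP[X XE] := vx _ r2.
  pose s := [seq xget 1%g [set g | rcoset H g = Y] | Y <- X].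
  have [zeta Vz hz] := cosets_section_in_span s Tx; exists zeta => //.
  apply: (@le_lt_trans _ _ (r / 2)); last first.
    by rewrite ltr_pdivrMr// mulr_natr mulr2n ltrDl.
  apply: rnorm_linf_le => [|g]; first exact: ltW.
  rewrite linfBE; have [g0|g0] := pselect (exists2 g0, g0 \in s & rcoset H g0 g).
    by rewrite (hz g).1// subrr rnorm0 ltW.
  rewrite (hz g).2// subr0 leNgt; apply/negP => /ltW gr; apply: g0.
  have gX : rcoset H g \in X.
    have : [set` X] (rcoset H g) by rewrite -XE; exists g.
    by [].
  exists (xget 1%g [set g' | rcoset H g' = rcoset H g]).
    by apply/mapP; exists (rcoset H g).
  have -> : rcoset H (xget 1%g [set g' | rcoset H g' = rcoset H g]) = rcoset H g.
    by apply: (@xgetPex _ 1%g [set g' | rcoset H g' = rcoset H g]); exists g.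
  by exists 1%g; rewrite ?mul1g//= /stab /= translate1.
apply: (closed_limit (Ind_cstar pa tau).2) => r /lim[b Vb xb]; exists b => //.
apply: (lspan_min _ _ Vb) => [|_ [g [a _ ->]]].
  by have [[h _ _] _] := Ind_cstar pa tau.
by apply: (Ind_act_in g); exact: orbit_map_Ind.
Qed.

(** The image of the orbit ideal consists of the sections supported in [tau], hence
    is an ideal. Translation by [g] moves supports in [tau] to supports in
    [tau g^-1], and a section in the image is supported in both exactly if its
    preimage lies in [A_g]. *)
Theorem orbit_enveloping :
  enveloping_action J (restr J alpha) T (@Ind_act R G A) iota.
Proof.
have Jp := orbit_ideal_pact pa dec xr; have [[Js _] _ _ _ _ _] := Jp.
have hT := Ind_cstar pa tau; have [[Tl Tm _] Tc] := hT.
have inj a b : J a -> J b -> iota a = iota b -> a = b.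
  move=> Ja Jb e; apply/eqP; rewrite -subr_eq0; apply/eqP.
  apply: (orbit_map_eq0 pa dec xr).
    by apply: subspaceB => //; exact: starsub_subspace Js.
  have := orbit_map_lin pa dec tau (-1) b a; rewrite !scaleN1r addrC => ->.
  by rewrite e addrC subrr.
split=> //.
- exact: Ind_action.
- split=> // [c a b _ _|a b _ _|a _].
  + exact: orbit_map_lin.
  + exact: orbit_mapM.
  + exact: orbit_map_star.
- by move=> a b /set_mem Ja /set_mem Jb; exact: inj.
- rewrite (orbit_map_image pa dec xr); split=> [xi []//|||xi eta Tx [Te e0]|xi eta [Tx x0] Te].
  + apply/closedP => xi lim; split.
      by apply: (closed_limit Tc) => r /lim[eta [Te _] d]; exists eta.
    move=> g gt; apply: rnorm_le0 => e /lim[eta [_ e0] d].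
    rewrite -[xi g]subr0 -(e0 _ gt); apply: le_trans (ltW d).
    exact: (rnorm_coord (xi - eta)).
  + split=> [|c xi eta [Tx x0] [Te e0]]; first by split=> //; exact: subspace0 Tl.
    split; first exact: (subspaceP Tl).
    by move=> g gt; rewrite linfDE linfZE x0// e0// scaler0 addr0.
  + by split; [exact: Tm | move=> g gt; rewrite linfME e0// cmul0r].
  + by split; [exact: Tm | move=> g gt; rewrite linfME x0// cmul0l].
- move=> g /=; apply/seteqP; split=> [_ [a [Ja ga] <-]|_ [[a Ja <-] [_ [b Jb <-] e]]].
    split; first by exists a.
    have gd := act_domV pa ga; exists (iota (act alpha g^-1%g a)).
      exists (act alpha g^-1%g a) => //; apply: (orbit_ideal_act pa dec xr) => //.
      by rewrite invgK.
    by rewrite -(orbit_map_act pa dec)// (actVK pa).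
  exists a => //; split=> //; apply: (component_dom_in pa dec) => s sT.
  have zero : dom alpha g 0 by exact: subspace0 (dom_subspace pa g).
  have [[k kt ->]|so] := pselect (translate_of tau s); last first.
    by rewrite ((orbit_idealP pa dec xr a).1 Ja s sT so).
  have kT := is_Tn_translate (is_TnP tau) kt.
  have [kgt|kgt] := boolP ((k * g)%g \in (tau : {fset G})).
    apply: (component_in pa dec a kT).
    by rewrite /= in_translate invgK.
  suff -> : E (translate k^-1%g tau) a = 0 by [].
  apply: rnorm0_eq0; rewrite -(rnorm_orbit_map_coord pa dec a kt) -e Ind_actE.
  by rewrite orbit_map_out// rnorm0.
- by move=> g a [_ ga]; exact: orbit_map_act.
- exact: Ind_dense.
Qed.

Lemma iota_tauE a : J a -> iota_tau alpha tau x a = iota a.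
Proof.
move=> Ja; rewrite /iota_tau /orbit_map; congr to_linf; apply/funext => g.
case: pickP => [k /set_mem gk|no].
  by rewrite (rcoset_in xr gk) (orbit_projE pa dec xr)// (translate_rcoset gk).
case: ifP => // gt; have [k gk] := coset_rep_exists xr gt.
by have := no k; rewrite mem_set.
Qed.

End OrbitEnveloping.

(** * The direct sum over the orbits *)

Lemma finite_set_induction (T : Type) (P : set T -> Prop) : P set0 ->
  (forall x D, ~ D x -> P D -> P (x |` D)) -> forall D, finite_set D -> P D.
Proof.
move=> P0 PS D /(@finite_seqP {classic T})[s ->]; elim: s => [|x s IH]; first by rewrite set_nil.
have -> : [set` x :: s] = x |` [set` s].
  apply/seteqP; split=> y; first by rewrite /= in_cons => /orP[/eqP|]; [left|right].
  by case=> [->|ys] /=; rewrite ?mem_head// in_cons ys orbT.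
have [xs|xs] := boolP (x \in s); last first.
  by apply: PS => //; exact/negP.
by have -> : x |` [set` s] = [set` s] by apply/setUidr => y ->.
Qed.

Section DirectSums.
Context (R : realType) (G : groupType) (Z : Type) (B : cstarAlgType R).
Variables (T : Z -> set B) (beta : Z -> G -> B -> B).
Hypothesis T_cstar : forall z, cstar_subalgebra (T z).
Hypothesis T_action : forall z, is_action (T z) (beta z).
Hypothesis beta_norm : forall z g b, rnorm (beta z g b) <= rnorm b.
Implicit Types (zeta eta : linf Z B) (g h : G) (r : R).

Lemma c0_sumP zeta : c0_sum T zeta <-> (forall z, T z (zeta z)) /\ vanishing id zeta.
Proof.
split=> -[Tz fz]; split=> // r r0; have := fz r r0; rewrite ?image_id//.
Qed.

Lemma c0_sum_cstar : cstar_subalgebra (c0_sum T).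
Proof.
split; last first.
  apply/closedP => zeta lim; apply/c0_sumP; split.
    move=> z; apply: (closed_limit (T_cstar z).2) => r /lim[eta /c0_sumP[Te _] d].
    by exists (eta z) => //; apply: le_lt_trans d; exact: (rnorm_coord (zeta - eta)).
  by apply: vanishing_limit => r /lim[eta /c0_sumP[_ ve] d]; exists eta.
split.
- split.
    apply/c0_sumP; split; last exact: vanishing0.
    by move=> z; have [[Tl _ _] _] := T_cstar z; exact: subspace0.
  move=> c zeta eta /c0_sumP[Tz vz] /c0_sumP[Te ve]; apply/c0_sumP; split.
    move=> z; have [[Tl _ _] _] := T_cstar z.
    exact: (subspaceP Tl c (Tz z) (Te z)).
  exact: vanishing_lin.
- move=> zeta eta /c0_sumP[Tz vz] /c0_sumP[Te ve]; apply/c0_sumP; split.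
    by move=> z; have [[_ Tm _] _] := T_cstar z; exact: (Tm _ _ (Tz z) (Te z)).
  exact: vanishing_mul.
- move=> zeta /c0_sumP[Tz vz]; apply/c0_sumP; split.
    by move=> z; have [[_ _ Ts] _] := T_cstar z; exact: (Ts _ (Tz z)).
  exact: vanishing_star.
Qed.

Lemma c0_sum_actE g zeta z : c0_sum_act beta g zeta z = beta z g (zeta z).
Proof.
apply: (to_linfE (M := rnorm zeta)) => w.
by apply: le_trans (beta_norm _ _ _) _; exact: rnorm_coord.
Qed.

Let beta_hom z g : star_hom (T z) (beta z g).
Proof. by have [h _] := pact_iso (T_action z) g. Qed.

Let beta_in z g b : T z b -> T z (beta z g b).
Proof. by move=> Tb; have [_ [h _ _]] := pact_iso (T_action z) g; exact: h. Qed.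

Lemma c0_sum_action : is_action (c0_sum T) (c0_sum_act beta).
Proof.
have hT := c0_sum_cstar; apply: action_intro => //.
- move=> g; split; first by have [] := hT.
  + move=> c zeta eta /c0_sumP[Tz _] /c0_sumP[Te _]; apply: linfP => z.
    by rewrite linfDE linfZE !c0_sum_actE (star_homP (beta_hom z g)).
  + move=> zeta eta /c0_sumP[Tz _] /c0_sumP[Te _]; apply: linfP => z.
    by rewrite linfME !c0_sum_actE (star_homM (beta_hom z g)).
  + move=> zeta /c0_sumP[Tz _]; apply: linfP => z.
    by rewrite linf_starE !c0_sum_actE (star_homS (beta_hom z g)).
- move=> g zeta /c0_sumP[Tz vz]; apply/c0_sumP; split=> [z|].
    by rewrite c0_sum_actE; exact: beta_in.
  apply: (vanishing_le (M := 1)) vz => // z.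
  by rewrite c0_sum_actE mul1r.
- move=> zeta /c0_sumP[Tz _]; apply: linfP => z; rewrite c0_sum_actE.
  exact: (pact_act1 (T_action z)).
- move=> g h zeta /c0_sumP[Tz _]; apply: linfP => z; rewrite !c0_sum_actE.
  have [] // := pact_extends (T_action z) (g := g) (h := h) (a := zeta z) (Tz z).
  exact: beta_in.
Qed.

(** Discarding the coordinates of norm below [r / 2] leaves finitely many, which can
    be approximated one at a time. *)
Lemma c0_sum_dense (V : Z -> set B) (W : set (linf Z B)) :
  linear_subspace W ->
  (forall z, T z `<=` closure (V z)) ->
  (forall z b, V z b -> exists2 eta, W eta & eta z = b /\ forall w, w <> z -> eta w = 0) ->
  c0_sum T `<=` closure W.
Proof.
move=> Wl TV VW zeta /c0_sumP[Tz vz]; apply/closureP => r r0.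
have r2 : 0 < r / 2 by rewrite divr_gt0.
have := vz _ r2; rewrite image_id; set D := [set z | _] => fD.
suff [eta We he] : exists2 eta, W eta & forall z,
    (D z -> rnorm (zeta z - eta z) <= r / 2) /\ (~ D z -> eta z = 0).
  exists eta => //; apply: (@le_lt_trans _ _ (r / 2)); last first.
    by rewrite ltr_pdivrMr// mulr_natr mulr2n ltrDl.
  apply: rnorm_linf_le => [|z]; first exact: ltW.
  rewrite linfBE; have [Dz|Dz] := pselect (D z); first exact: (he z).1.
  by rewrite (he z).2// subr0 ltW// ltNge; exact/negP.
move: fD; move: D; apply: finite_set_induction.
  by exists 0; [exact: subspace0 Wl | move=> z; split].
move=> z0 D Dz0 [eta We he].
have [b Vb zb] := (closureP _ _).1 (TV z0 _ (Tz z0)) _ r2.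
have [u Wu [uz0 u0]] := VW _ _ Vb; exists (eta + u); first exact: subspaceD.
move=> z; rewrite linfDE; have [->|zz0] := pselect (z = z0).
  rewrite (he z0).2// add0r uz0; split=> [_|no]; first exact: ltW.
  by case: no; left.
rewrite u0// addr0; split=> [[//|Dz]|Dz]; first exact: (he z).1.
by apply: (he z).2 => Dz'; apply: Dz; right.
Qed.

End DirectSums.

Section OrbitSpace.
Context (G : groupType) (n : nat) (rep : orbit_space G n -> Tn G n).
Hypothesis rep_mem : forall z, sval z (rep z).
Implicit Types (sigma : {fset G}) (z w : orbit_space G n).

Lemma orbit_translate_of (tau rho : Tn G n) : Defs.orbit tau rho <-> translate_of tau rho.
Proof.
split=> -[g gt e]; exists g^-1%g; rewrite ?invgK//.
Qed.

Lemma translate_of_sym (tau rho : Tn G n) : translate_of tau rho -> translate_of rho tau.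
Proof.
move=> [g gt e]; exists g^-1%g; last by rewrite e invgK translateVK.
by rewrite e in_translate invgK mulgV; exact: Tn1.
Qed.

Lemma translate_of_trans (tau rho : Tn G n) sigma :
  translate_of tau rho -> translate_of rho sigma -> translate_of tau sigma.
Proof.
move=> tr [g gr ->]; have [k kt e] := tr.
exists (k * g)%g; last by rewrite e translateM invgM.
by move: gr; rewrite e in_translate invgK.
Qed.

Lemma orbit_rep_exists sigma : is_Tn n sigma -> exists z, translate_of (rep z) sigma.
Proof.
move=> sT; pose s : Tn G n := exist _ sigma sT.
exists (exist _ (Defs.orbit s) (ex_intro _ s erefl)).
by apply: (@translate_of_sym s); apply/orbit_translate_of; exact: (rep_mem (exist _ (Defs.orbit s) _)).
Qed.

Lemma orbit_rep_unique z w sigma :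
  translate_of (rep z) sigma -> translate_of (rep w) sigma -> z = w.
Proof.
move=> zs ws; have sT := translate_of_Tn zs; pose s : Tn G n := exist _ sigma sT.
have key (u : orbit_space G n) : translate_of (rep u) s -> sval u = Defs.orbit s.
  move=> us; have [t ut] := svalP u; rewrite ut.
  have tr : translate_of t (rep u) by apply/orbit_translate_of; rewrite -ut.
  have ts := translate_of_trans tr us.
  apply/seteqP; split=> v /orbit_translate_of h; apply/orbit_translate_of.
    exact: (translate_of_trans (translate_of_sym ts) h).
  exact: (translate_of_trans ts h).
apply: eq_sig_hprop => [v p q|]; first exact: Prop_irrelevance.
by rewrite [LHS](key z zs) [RHS](key w ws).
Qed.

End OrbitSpace.

Section Globalization.
Context (R : realType) (G : groupType) (A : cstarAlgType R) (n : nat).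
Context (alpha : pact_data G A) (pa : is_partial_action setT alpha).
Hypothesis dec : decomposition_property n alpha.
Variable x : forall tau : Tn G n, 'I_(stab_index tau).+1 -> G.
Hypothesis xr : forall tau, coset_representatives (@x tau).
Variable rep : orbit_space G n -> Tn G n.
Hypothesis rep_mem : forall z, sval z (rep z).
Implicit Types (g h : G) (a b : A) (z w : orbit_space G n) (r : R).
Implicit Types (zeta eta : linf (orbit_space G n) (linf G A)).
Local Open Scope complex_scope.

Local Notation E := (component alpha).
Local Notation J z := (orbit_ideal alpha (rep z)).
Local Notation T z := (Ind (stab (rep z)) (idom alpha (rep z)) (act alpha)).
Local Notation TT := (c0_sum (fun z => T z)).
Local Notation beta := (c0_sum_act (fun _ : orbit_space G n => @Ind_act R G A)).

Definition global_map a : linf (orbit_space G n) (linf G A) :=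
  to_linf (fun z => orbit_map alpha (rep z) a).

Lemma global_mapE a z : global_map a z = orbit_map alpha (rep z) a.
Proof. by apply: (to_linfE (M := rnorm a)) => w; exact: rnorm_orbit_map. Qed.

(** Each component of [a] has the norm of some coordinate of some [orbit_map a],
    and the norm of [a] is the supremum of those of its components. *)
Lemma rnorm_global_map a : rnorm (global_map a) = rnorm a.
Proof.
apply/le_anti/andP; split.
  apply: rnorm_linf_le => [|z]; first exact: rnorm_ge0.
  by rewrite global_mapE; exact: rnorm_orbit_map.
apply: (rnorm_le_component pa dec); first exact: rnorm_ge0.
move=> s sT; have [z [g gz ->]] := orbit_rep_exists rep_mem sT.
rewrite -(rnorm_orbit_map_coord pa dec a gz) -global_mapE.
exact: le_trans (rnorm_coord _ _) (rnorm_coord _ _).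
Qed.

Lemma global_map_lin (c : R[i]) a b :
  global_map (c *: a + b) = c *: global_map a + global_map b.
Proof.
by apply: linfP => z; rewrite linfDE linfZE !global_mapE; exact: orbit_map_lin.
Qed.

Lemma global_mapB a b : global_map (a - b) = global_map a - global_map b.
Proof. by have := global_map_lin (-1) b a; rewrite !scaleN1r !(addrC (- _)). Qed.

Lemma orbit_map_other z w a : z <> w -> J z a -> orbit_map alpha (rep w) a = 0.
Proof.
move=> zw /(orbit_idealP pa dec (@xr (rep z))) Ja; apply: linfP => g.
rewrite linf0E; have [gw|gw] := boolP (g \in (rep w : {fset G})); last exact: orbit_map_out.
apply: rnorm0_eq0; rewrite rnorm_orbit_map_coord// Ja ?rnorm0//.
  exact: is_Tn_translate (is_TnP _) gw.
by move=> zg; apply: zw; apply: (orbit_rep_unique rep_mem zg); exists g.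
Qed.

Lemma global_map_c0 a : TT (global_map a).
Proof.
apply/c0_sumP; split=> [z|]; first by rewrite global_mapE; exact: orbit_map_Ind.
apply: vanishing_limit => r r0; have r2 : 0 < r / 2 by rewrite divr_gt0.
have [s sT hs] := component_approx pa dec a r2.
pose b := \sum_(sigma <- undup s) E sigma a.
exists (global_map b); last first.
  rewrite -global_mapB rnorm_global_map; apply: (@le_lt_trans _ _ (r / 2)); last first.
    by rewrite ltr_pdivrMr// mulr_natr mulr2n ltrDl.
  apply: hs; first exact: undup_uniq.
    by apply/allP => t; rewrite mem_undup => /(allP sT).
  by move=> t; rewrite mem_undup.
have fin : finite_set [set z | exists2 sigma, sigma \in s & translate_of (rep z) sigma].
  elim: (s) => [|t s' IH].
    by apply: (@sub_finite_set _ _ set0) => // z [].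
  have one : finite_set [set z | translate_of (rep z) t].
    have [[z0 z0t]|no] := pselect (exists z, translate_of (rep z) t).
      apply: (@sub_finite_set _ _ [set z0]) => // z zt.
      exact: (orbit_rep_unique rep_mem zt z0t).
    by apply: (@sub_finite_set _ _ set0) => // z zt; apply: no; exists z.
  apply: (@sub_finite_set _ _ ([set z | translate_of (rep z) t] `|`
    [set z | exists2 sigma, sigma \in s' & translate_of (rep z) sigma])); last by rewrite finite_setU.
  move=> z [u]; rewrite in_cons => /orP[/eqP ->|us] zu; first by left.
  by right; exists u.
move=> e e0; rewrite image_id; apply: sub_finite_set fin => z /= ez.
have [//|no] := pselect (exists2 sigma, sigma \in s & translate_of (rep z) sigma).
suff b0 : global_map b z = 0 by move: ez; rewrite b0 rnorm0 leNgt e0.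
rewrite global_mapE; apply: linfP => g; rewrite linf0E.
have [gz|gz] := boolP (g \in (rep z : {fset G})); last exact: orbit_map_out.
apply: rnorm0_eq0; rewrite rnorm_orbit_map_coord//.
have gT := is_Tn_translate (is_TnP (rep z)) gz.
rewrite (component_sum pa dec)// big_seq big1 ?rnorm0// => t; rewrite mem_undup => ts.
have tT := allP sT t ts.
rewrite (component_other pa dec gT tT)//; last exact: (component_in pa dec).
by apply/eqP => e'; apply: no; exists t => //; exists g.
Qed.

(** A family of sections supported in the [tau_z] is the limit of its truncations
    to finitely many orbits; these are in the image, which is closed because the
    map is isometric. *)
Lemma global_map_image : range global_map =
  TT `&` [set zeta : linf (orbit_space G n) (linf G A) | forall z g, g \notin (rep z : {fset G}) -> zeta z g = 0].
Proof.
apply/seteqP; split=> zeta.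
  move=> [a _ <-]; split; first exact: global_map_c0.
  by move=> z g gz; rewrite global_mapE; exact: orbit_map_out.
move=> [/c0_sumP[Tz vz] z0].
pose P eta a := global_map a = eta.
have Pc eta a eta' a' : P eta a -> P eta' a' -> rnorm (a - a') <= rnorm (eta - eta').
  by move=> <- <-; rewrite -global_mapB rnorm_global_map.
have [|a ha] := lift_limit Pc (a := zeta).
  move=> r r0; have r2 : 0 < r / 2 by rewrite divr_gt0.
  have := vz _ r2; rewrite image_id; set D := [set z | _] => fD.
  suff [a ha] : exists a, forall z,
      (D z -> global_map a z = zeta z) /\ (~ D z -> global_map a z = 0).
    exists (global_map a), a => //; apply: (@le_lt_trans _ _ (r / 2)); last first.
      by rewrite ltr_pdivrMr// mulr_natr mulr2n ltrDl.
    apply: rnorm_linf_le => [|z]; first exact: ltW.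
    rewrite linfBE; have [Dz|Dz] := pselect (D z).
      by rewrite (ha z).1// subrr rnorm0 ltW.
    by rewrite (ha z).2// subr0 ltW// ltNge; exact/negP.
  move: fD; move: D; apply: finite_set_induction.
    exists 0 => z; split=> // _; apply: rnorm0_eq0; apply/le_anti.
    rewrite rnorm_ge0 andbT; apply: le_trans (rnorm_coord _ _) _.
    by rewrite rnorm_global_map rnorm0.
  move=> w D Dw [a ha].
  have [b Jb bE] := orbit_map_surj pa dec (@xr (rep w)) (Tz w) (z0 w).
  exists (a + b) => z; have := global_map_lin 1 a b; rewrite !scale1r => ->.
  rewrite linfDE [global_map b z]global_mapE; have [->|zw] := pselect (z = w).
    by rewrite bE (ha w).2// add0r; split=> // no; case: no; left.
  rewrite (orbit_map_other _ Jb) ?addr0//; last by move=> e; apply: zw.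
  split=> [[//|Dz]|Dz]; first exact: (ha z).1.
  by apply: (ha z).2 => Dz'; apply: Dz; right.
exists a => //; apply/eqP; rewrite -subr_eq0; apply/eqP/rnorm_le0 => e e0.
have [eta [b [<- d1 d2]]] := ha _ (divr_gt0 e0 (ltr0n _ 2)).
rewrite -(subrKA (global_map b)) [leRHS]splitr; apply: le_trans (rnormD _ _) _.
apply: lerD; first by rewrite -global_mapB rnorm_global_map ltW.
by rewrite rnormB ltW.
Qed.

Lemma global_map_act g a : dom alpha g^-1%g a ->
  global_map (act alpha g a) = beta g (global_map a).
Proof.
move=> ga; apply: linfP => z; rewrite c0_sum_actE; last by move=> *; exact: rnorm_Ind_act.
by rewrite !global_mapE (orbit_map_act pa dec).
Qed.

Let translates := [set b | exists g, exists2 a, [set: A] a & b = beta g (global_map a)].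

Lemma global_dense : TT = closure (lspan translates).
Proof.
have Ic z : cstar_subalgebra (T z) by exact: (Ind_cstar pa).
have Ia z : is_action (T z) (@Ind_act R G A) by exact: (Ind_action pa).
have In (z : orbit_space G n) g (b : linf G A) := @rnorm_Ind_act R G A g b.
have [[[Tl _ _] Tc] _ _ _ _ _] := c0_sum_action Ic Ia In.
apply/seteqP; split=> [|zeta /closureP lim]; last first.
  apply: (closed_limit Tc) => r /lim[b Vb zb]; exists b => //.
  apply: (lspan_min Tl _ Vb) => _ [g [a _ ->]].
  have [_ _ h _ _ _] := c0_sum_action Ic Ia In.
  by have [_ [h' _ _]] := h g; apply: h'; exact: global_map_c0.
pose V z := lspan [set b | exists g, exists2 a, J z a & b = Ind_act g (orbit_map alpha (rep z) a)].
apply: (@c0_sum_dense _ _ _ (fun z => T z) V) => [|z|z b Vb].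
- exact: lspan_subspace.
- by rewrite (Ind_dense pa dec (@xr (rep z))).
pose P v := exists2 eta, lspan translates eta & eta z = v /\ forall w, w <> z -> eta w = 0.
apply: (@lspan_min _ _ _ P _ _ _ Vb) => [|_ [g [a Ja ->]]].
  split; first by exists 0; [exact: subspace0 (lspan_subspace _) | split].
  move=> c v1 v2 [eta1 V1 [e1 h1]] [eta2 V2 [e2 h2]]; exists (c *: eta1 + eta2).
    exact: (subspaceP (lspan_subspace _)).
  by rewrite linfDE linfZE e1 e2; split=> // w wz; rewrite linfDE linfZE h1// h2// scaler0 addr0.
exists (beta g (global_map a)); first by apply: sub_lspan; exists g, a.
split=> [|w wz]; rewrite c0_sum_actE ?global_mapE//.
rewrite (orbit_map_other _ Ja); last by move=> e; apply: wz.
by apply: linfP => k; rewrite Ind_actE.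
Qed.

Theorem global_enveloping :
  enveloping_action setT alpha TT beta global_map.
Proof.
have Ic z : cstar_subalgebra (T z) by exact: (Ind_cstar pa).
have Ia z : is_action (T z) (@Ind_act R G A) by exact: (Ind_action pa).
have In (z : orbit_space G n) g (b : linf G A) := @rnorm_Ind_act R G A g b.
have Ta := c0_sum_action Ic Ia In; have [[[Tl Tm _] Tc] _ _ _ _ _] := Ta.
have [[As _] _ _ _ _ _] := pa.
split=> //.
- split=> // [c a b _ _|a b _ _|a _].
  + exact: global_map_lin.
  + by apply: linfP => z; rewrite linfME !global_mapE; exact: orbit_mapM.
  + by apply: linfP => z; rewrite linf_starE !global_mapE; exact: orbit_map_star.
- move=> a b _ _ e; apply/eqP; rewrite -subr_eq0 -rnorm_eq0 -rnorm_global_map.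
  by rewrite global_mapB e subrr rnorm0.
- rewrite global_map_image; split=> [zeta []//|||zeta eta Tz [Te e0]|zeta eta [Tz z0] Te].
  + apply/closedP => zeta lim; split.
      by apply: (closed_limit Tc) => r /lim[eta [Te _] d]; exists eta.
    move=> z g gz; apply: rnorm_le0 => e /lim[eta [_ e0] d].
    rewrite -[zeta z g]subr0 -(e0 _ _ gz); apply: le_trans (ltW d).
    apply: le_trans (rnorm_coord (zeta - eta) z).
    exact: (rnorm_coord (zeta z - eta z)).
  + split=> [|c zeta eta [Tz z0] [Te e0]]; first by split=> //; exact: subspace0 Tl.
    split; first exact: (subspaceP Tl).
    by move=> z g gz; rewrite !linfDE !linfZE z0// e0// scaler0 addr0.
  + by split; [exact: Tm | move=> z g gz; rewrite !linfME e0// cmul0r].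
  + by split; [exact: Tm | move=> z g gz; rewrite !linfME z0// cmul0l].
- move=> g; apply/seteqP; split=> [_ [a ga <-]|_ [[a _ <-] [_ [b _ <-] e]]].
    split; first by exists a.
    have gd := act_domV pa ga; exists (global_map (act alpha g^-1%g a)).
      by exists (act alpha g^-1%g a).
    by rewrite -global_map_act// (actVK pa).
  exists a => //; apply: (component_dom_in pa dec) => s sT.
  have [z [k kz ->]] := orbit_rep_exists rep_mem sT.
  have kT := is_Tn_translate (is_TnP (rep z)) kz.
  have [kgz|kgz] := boolP ((k * g)%g \in (rep z : {fset G})).
    apply: (component_in pa dec a kT).
    by rewrite /= in_translate invgK.
  suff -> : E (translate k^-1%g (rep z)) a = 0 by exact: subspace0 (dom_subspace pa g).
  apply: rnorm0_eq0; rewrite -(rnorm_orbit_map_coord pa dec a kz) -global_mapE -e.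
  by rewrite c0_sum_actE// Ind_actE global_mapE orbit_map_out// rnorm0.
- by move=> g a ga; exact: global_map_act.
- exact: global_dense.
Qed.

End Globalization.

Theorem theorem3p6 (R : realType) (G : groupType) (A : cstarAlgType R)
    (n : nat) (n_gt0 : (0 < n)%N) (alpha : pact_data G A)
    (alpha_pact : is_partial_action setT alpha)
    (alpha_decomp : decomposition_property n alpha)
    (x : forall tau : Tn G n, 'I_(stab_index tau).+1 -> G)
    (x_reps : forall tau, coset_representatives (x tau))
    (rep : orbit_space G n -> Tn G n)
    (rep_mem : forall z, sval z (rep z)) :
  (forall tau : Tn G n,
     let AGtau := orbit_ideal alpha tau in
     [/\ globalizable AGtau (restr AGtau alpha),
         amenable (restr AGtau alpha),
         enveloping_action AGtau (restr AGtau alpha)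
           (Ind (stab tau) (idom alpha tau) (act alpha)) (@Ind_act R G A)
           (iota_tau alpha tau (x tau)) &
         forall a g, AGtau a -> g \notin (tau : {fset G}) ->
           iota_tau alpha tau (x tau) a g = 0]) /\
  [/\ globalizable setT alpha,
      amenable alpha &
      exists iota : A -> linf (orbit_space G n) (linf G A),
        enveloping_action setT alpha
          (c0_sum (fun z : orbit_space G n =>
             Ind (stab (rep z)) (idom alpha (rep z)) (act alpha)))
          (c0_sum_act (fun _ : orbit_space G n => @Ind_act R G A)) iota /\
        forall z a, orbit_ideal alpha (rep z) a ->
          iota a z = iota_tau alpha (rep z) (x (rep z)) a /\
          forall w, w <> z -> iota a w = 0].
Proof.
have env_tau tau := orbit_enveloping alpha_pact alpha_decomp (x_reps tau).
split=> [tau /=|].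
  have env : enveloping_action (orbit_ideal alpha tau)
      (restr (orbit_ideal alpha tau) alpha)
      (Ind (stab tau) (idom alpha tau) (act alpha)) (@Ind_act R G A)
      (iota_tau alpha tau (x tau)).
    apply: eq_enveloping_action (env_tau tau) => a Ja.
    by rewrite (iota_tauE alpha_pact alpha_decomp (x_reps tau)).
  split=> [||//|a g Ja gt].
  - by exists (linf G A); do 3!eexists; exact: env.
  - apply: (@decomposes_amenable _ _ _ n (orbit_ideal alpha tau)).
      exact: (orbit_ideal_pact alpha_pact alpha_decomp (x_reps tau)).
    exact: (orbit_ideal_decomposes alpha_pact alpha_decomp (x_reps tau)).
  - rewrite (iota_tauE alpha_pact alpha_decomp (x_reps tau))//.
    exact: orbit_map_out.
have env := global_enveloping alpha_pact alpha_decomp x_reps rep_mem.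
split.
- by exists (linf (orbit_space G n) (linf G A)); do 3!eexists; exact: env.
- apply: (@decomposes_amenable _ _ _ n setT alpha alpha_pact).
  exact: decomposition_decomposes.
exists (global_map alpha rep); split=> // z a Ja; split=> [|w wz].
  rewrite (global_mapE alpha_pact alpha_decomp).
  by rewrite (iota_tauE alpha_pact alpha_decomp (x_reps (rep z))).
rewrite (global_mapE alpha_pact alpha_decomp).
apply: (orbit_map_other alpha_pact alpha_decomp x_reps rep_mem _ Ja).
by move=> e; apply: wz.
Qed.
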